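(* Let $k$ be an uncountable field and let $A$ be a finitely generated prime Goldie $k$-algebra of quadratic growth. Then either $A$ is primitive or $A$ satisfies a polynomial identity.
   Context: Algebras are associative and unital. A frame of a finitely generated $k$-algebra $A$ is a finite-dimensional $k$-subspace $V\subseteq A$ with $1\in V$ that generates $A$ as a $k$-algebra; $V^n$ denotes the $k$-span of all products of $n$ elements of $V$. $A$ has quadratic growth if there exist a frame $V$ of $A$ and constants $C_1,C_2>0$ such that $C_1n^2\le \dim_k(V^n)\le C_2n^2$ for all $n\ge 1$. A ring $R$ is right Goldie if (1) $R$ does not contain an infinite direct sum of nonzero right ideals, and (2) $R$ satisfies the ascending chain condition on right annihilators. Left Goldie is defined analogously, and $R$ is Goldie if it is both left and right Goldie. A $k$-algebra $A$ satisfies a polynomial identity if there is a nonzero noncommutative polynomial $p(t_1,\ldots,t_d)\in k\{t_1,\ldots,t_d\}$ (an element of the free associative algebra) such that $p(a_1,\ldots,a_d)=0$ for all $(a_1,\ldots,a_d)\in A^d$. $A$ is primitive if it has a faithful simple left module. *)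

(* Defs.v *)
From HB Require Import structures.
From mathcomp Require Import all_boot all_order all_algebra.
From mathcomp Require Import boolp classical_sets functions cardinality reals.
From mathcomp Require Import monalg.

Set Implicit Arguments.
Unset Strict Implicit.
Unset Printing Implicit Defensive.

Import Order.TTheory GRing.Theory Num.Theory.
Local Open Scope classical_set_scope.
Local Open Scope ring_scope.

Section Subspaces.
Variables (k : fieldType) (M : lmodType k).

Definition lspan (S : set M) : set M :=
  [set x | exists n (c : 'I_n -> k) (s : 'I_n -> M),
     (forall i, S (s i)) /\ x = \sum_i c i *: s i].

Definition lin_indep (n : nat) (b : 'I_n -> M) : Prop :=
  forall c : 'I_n -> k, \sum_i c i *: b i = 0 -> forall i, c i = 0.

Definition has_dim (W : set M) (d : nat) : Prop :=
  exists b : 'I_d -> M, lin_indep b /\ W = lspan (range b).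

End Subspaces.

Section Growth.
Variables (k : fieldType) (A : algType k).

Definition generates_alg (S : set A) : Prop :=
  forall B : set A,
    GRing.subalg_closed [in B] -> S `<=` B -> B = [set: A].

Definition finitely_generated : Prop :=
  exists2 S : set A, finite_set S & generates_alg S.

Definition frame (V : set A) : Prop :=
  [/\ exists d, has_dim V d, V 1 & generates_alg V].

Definition frame_pow (V : set A) (n : nat) : set A :=
  lspan [set x | exists v : 'I_n -> A,
           (forall i, V (v i)) /\ x = \prod_(i < n) v i].

Definition quadratic_growth (R : realType) : Prop :=
  exists V : set A, frame V /\
  exists C1 C2 : R, [/\ 0 < C1, 0 < C2 &
    forall n : nat, (1 <= n)%N ->
      exists d : nat, has_dim (frame_pow V n) d /\
        C1 * n%:R ^+ 2 <= d%:R <= C2 * n%:R ^+ 2].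

End Growth.

Section Rings.
Variable R : nzRingType.

Definition right_ideal (I : set R) : Prop :=
  GRing.zmod_closed [in I] /\ (forall x a, I x -> I (x * a)).

Definition two_sided_ideal (I : set R) : Prop :=
  right_ideal I /\ (forall a x, I x -> I (a * x)).

(* The product ideal I J is zero iff all products x * y vanish; R is nonzero
   because it is an nzRingType. *)
Definition prime_ring : Prop :=
  forall I J : set R, two_sided_ideal I -> two_sided_ideal J ->
    (forall x y, I x -> J y -> x * y = 0) -> I = [set 0] \/ J = [set 0].

Definition direct_family (I : nat -> set R) : Prop :=
  forall (n : nat) (x : 'I_n -> R), (forall i : 'I_n, I i (x i)) ->
    \sum_i x i = 0 -> forall i, x i = 0.

Definition right_ann (S : set R) : set R :=
  [set x | forall s, S s -> s * x = 0].

Definition acc_right_ann : Prop :=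
  forall S : nat -> set R,
    (forall n, right_ann (S n) `<=` right_ann (S n.+1)) ->
    exists N, forall n, (N <= n)%N -> right_ann (S n) = right_ann (S N).

Definition right_goldie : Prop :=
  ~ (exists I : nat -> set R,
       (forall n, right_ideal (I n) /\ I n <> [set 0]) /\ direct_family I)
  /\ acc_right_ann.

Definition faithful_module (M : lmodType R) : Prop :=
  forall a : R, (forall m : M, a *: m = 0) -> a = 0.

Definition simple_module (M : lmodType R) : Prop :=
  (exists m : M, m <> 0) /\
  (forall N : set M, GRing.submod_closed [in N] ->
     N = [set 0] \/ N = [set: M]).

Definition primitive_ring : Prop :=
  exists M : lmodType R, simple_module M /\ faithful_module M.

End Rings.

(* Right ideals and right annihilators of the converse ring R^c are the left
   ideals and left annihilators of R. *)
Definition left_goldie (R : nzRingType) : Prop := right_goldie R^c.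

Definition goldie (R : nzRingType) : Prop := left_goldie R /\ right_goldie R.

Section PolynomialIdentity.
Variables (k : fieldType) (A : algType k).

(* {malg k[{fmonom 'I_d}]} is the free associative algebra k{t_1, ..., t_d}:
   the monoid algebra of the words over 'I_d. *)
Definition nc_eval (d : nat) (a : 'I_d -> A) (p : {malg k[{fmonom 'I_d}]}) : A :=
  mmap (in_alg A) (fun w : {fmonom 'I_d} => \prod_(i <- fmonom_val w) a i) p.

Definition satisfies_pi : Prop :=
  exists (d : nat) (p : {malg k[{fmonom 'I_d}]}),
    p != 0 /\ (forall a : 'I_d -> A, nc_eval a p = 0).

End PolynomialIdentity.

(* Main.v *)
(* Suppose that A is neither primitive nor PI.  The annihilator P of a simple
   module A/L is then nonzero, so it contains a regular element and A/P has
   linear growth; as k is uncountable this forces P to have finite codimension.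
   Over an algebraically closed K containing k, each such P is the kernel of a
   matrix representation without zero matrix coefficients.

   For every nonzero ideal J there is a nonzero ideal I such that uncountably
   many P contain I but not J.  Otherwise take c regular and transcendental in
   the intersection of J with some P; for generic l the annihilator of a simple
   quotient of A/A(c - l) does not contain c, and the countably many such P have
   together countably many eigenvalues.

   Let b have a maximal left annihilator and let c0 = sum_t a_t b a'_t be left
   regular.  If rho(c0) is singular on such an uncountable family, vectors killed
   by rho(c0) give functionals on A that vanish on A c0.  If it is nonsingular,
   rho(b) has large rank and traces against matrices commuting with rho(y0)
   compressed by rho(b) vanish on all x b y0 - y0 b x, where y0 is fixed with
   b y0 b nonzero and y0 in an annihilator not containing b.  Either way order n functionals that are independent on V^(n + c) arise from points of the
   family, and families for smaller and smaller ideals J can be stacked.  Hence for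
   every m some V^(n + c) has order m n independent functionals that vanish on the
   image of V^n under a linear map with kernel of linear growth; summing over n
   contradicts quadratic growth. *)
Require Import Defs.
From HB Require Import structures.
From mathcomp Require Import all_boot all_order all_algebra all_fingroup all_field.
From mathcomp Require Import generic_quotient ring_quotient mpoly.
From mathcomp Require Import boolp classical_sets functions cardinality filter reals.
From mathcomp Require Import zify.

Set Implicit Arguments.
Unset Strict Implicit.
Unset Printing Implicit Defensive.

Import Order.TTheory GRing.Theory Num.Theory.
Local Open Scope classical_set_scope.
Local Open Scope ring_scope.

(** * Rank over an integral domain *)

(** A has zero divisors, and b supplies the missing cancellation: when b y b is nonzero, x b y b = 0
    forces x b = 0, so right multiplication by y b is injective on A b. With y0 in an annihilator
    that omits b, z = y0 b is transcendental and A b is a torsion-free right k[z]-module. Its rank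
    is infinite, for on a module of finite rank A would act by matrices and satisfy a standard
    identity. Hence elements centralizing z are few: n + 1 elements of degree n are independent over
    them, and products with these exhaust quadratic growth. This is the source of the kernel of
    linear growth in the nonsingular case. Traces are chosen because a matrix of size r commutes
    with a space of dimension at least r, whatever its Jordan form, so each point yields r
    functionals. Their independence on short words is the obstacle. A combination of the
    representations with rank one at uncountably many points turns traces into matrix coefficients,
    whose independence follows by a dimension count. Reaching rank one takes linear growth modulo I
    and a system of determinantal equations with more unknowns than equations, solvable over K. *)

Local Notation tofrac := (@FracField.tofrac _).

Lemma fractionP (R : idomainType) (x : {fraction R}) :
  exists n d : R, d != 0 /\ x * tofrac d = tofrac n.
Proof.
elim/quotW: x => x; exists (\n_x), (\d_x); split; first exact: denom_ratioP.
rewrite !piE /FracField.mulf.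
apply/eqP; rewrite FracField.equivf_def.
have d0 := denom_ratioP x.
by rewrite !numden_Ratio ?mulr1 ?oner_eq0 // mulrC.
Qed.

Lemma idomain_kernel (R : idomainType) (S T : finType) (B : S -> T -> R) :
  (#|T| < #|S|)%N ->
  exists c : S -> R, (exists s, c s != 0) /\ forall t, \sum_s c s * B s t = 0.
Proof.
move=> lt_TS.
pose M : 'M[{fraction R}]_(#|S|, #|T|) :=
  \matrix_(i, j) tofrac (B (enum_val i) (enum_val j)).
have /rowV0Pn[v /sub_kermxP vM vn0] : kermx M != 0.
  rewrite -mxrank_eq0 mxrank_ker subn_eq0 -ltnNge.
  exact: leq_ltn_trans (rank_leq_col _) lt_TS.
have /choice[nd ndP] : forall i, exists nd : R * R,
    nd.2 != 0 /\ v 0 i * tofrac nd.2 = tofrac nd.1.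
  by move=> i; have [n [d [d0 e]]] := fractionP (v 0 i); exists (n, d).
pose D := \prod_i (nd i).2.
have D0 : D != 0 by apply/prodf_neq0 => i _; case: (ndP i).
pose c i := (nd i).1 * \prod_(j | j != i) (nd j).2.
have cE i : tofrac (c i) = v 0 i * tofrac D.
  have -> : D = (nd i).2 * \prod_(j | j != i) (nd j).2 by rewrite /D (bigD1 i).
  rewrite !tofracM mulrA; congr (_ * _).
  by case: (ndP i).
exists (fun s => c (enum_rank s)); split.
  have /rV0Pn[j vj] := vn0.
  exists (enum_val j); rewrite enum_valK -tofrac_eq0 cE mulf_neq0 //.
  by rewrite tofrac_eq0.
move=> t; apply/eqP; rewrite -tofrac_eq0 rmorph_sum /=.
rewrite (reindex (@enum_val S S)) /=; last first.
  by exists enum_rank => i _; rewrite ?enum_valK ?enum_rankK.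
have := congr1 (fun X : 'rV_#|T| => X 0 (enum_rank t)) vM.
rewrite !mxE => /(congr1 (fun y => y * tofrac D)); rewrite mul0r mulr_suml => e.
apply/eqP; rewrite -[RHS]e; apply: eq_bigr => i _.
by rewrite tofracM enum_valK cE !mxE enum_rankK mulrAC.
Qed.

Lemma big_option (M : nmodType) (T : finType) (F : option T -> M) :
  \sum_o F o = F None + \sum_t F (Some t).
Proof.
rewrite (bigD1 None) //=; congr (_ + _).
rewrite (reindex_omap Some id) /=; last by case.
by apply: eq_bigl => t; rewrite eqxx.
Qed.

(* Linear algebra over an integral domain acting on a submodule N of M, modulo
   a submodule Z, up to torsion.  The action is an explicit function and its
   laws are required on N only, because the scalars of interest act by right
   multiplications which commute on a left ideal but not on the whole algebra. *)
Record domain_action (R : idomainType) (M : zmodType) (act : R -> M -> M)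
    (N Z : set M) : Prop := DomainAction {
  dact_N0 : N 0;
  dact_ND : forall x y, N x -> N y -> N (x + y);
  dact_Nact : forall r x, N x -> N (act r x);
  dact_Z0 : Z 0;
  dact_ZB : forall x y, Z x -> Z y -> Z (x - y);
  dact_Zact : forall r x, Z x -> Z (act r x);
  dact_0 : forall r, act r 0 = 0;
  dact_1 : forall x, N x -> act 1 x = x;
  dact_M : forall r s x, N x -> act (r * s) x = act r (act s x);
  dact_Dl : forall r s x, N x -> act (r + s) x = act r x + act s x;
  dact_Dr : forall r x y, act r (x + y) = act r x + act r y;
  dact_tf : forall r x, N x -> r != 0 -> Z (act r x) -> Z x }.

Section Rank.
Variables (R : idomainType) (M : zmodType) (act : R -> M -> M) (N Z : set M).

Definition rfree (T : finType) (x : T -> M) :=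
  forall r : T -> R, Z (\sum_t act (r t) (x t)) -> forall t, r t = 0.

Definition rdep (T : finType) (x : T -> M) (y : M) :=
  exists p : R, p != 0 /\ exists r : T -> R, Z (act p y - \sum_t act (r t) (x t)).

Hypothesis H : domain_action act N Z.
Let N0 := dact_N0 H.
Let ND := dact_ND H.
Let Nact := dact_Nact H.
Let Z0 := dact_Z0 H.
Let ZB := dact_ZB H.
Let Zact := dact_Zact H.
Let act0 := dact_0 H.
Let actM := dact_M H.
Let actDl := dact_Dl H.
Let actDr := dact_Dr H.

Let ZN x : Z x -> Z (- x).
Proof. by move=> Zx; rewrite -sub0r; apply: ZB. Qed.
Let ZD x y : Z x -> Z y -> Z (x + y).
Proof. by move=> Zx Zy; rewrite -[y]opprK; apply/ZB/ZN. Qed.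
Let Zsum (T : finType) (f : T -> M) : (forall t, Z (f t)) -> Z (\sum_t f t).
Proof. by move=> Zf; elim/big_ind: _ => //. Qed.
Let actN r x : act r (- x) = - act r x.
Proof. by apply/eqP; rewrite -subr_eq0 opprK -actDr addNr act0. Qed.
Let act0l x : N x -> act 0 x = 0.
Proof. by move=> Nx; apply: (@addrI _ (act 0 x)); rewrite -actDl ?addr0. Qed.
Let act_sum (T : finType) r (f : T -> M) :
  act r (\sum_t f t) = \sum_t act r (f t).
Proof. by apply: (big_morph (act r)) => //; apply: actDr. Qed.
Let act_suml (T : finType) (f : T -> R) x : N x ->
  act (\sum_t f t) x = \sum_t act (f t) x.
Proof.
by move=> Nx; apply: (big_morph (act^~ x)) => [a b|]; rewrite ?actDl ?act0l.
Qed.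

(** Were S larger than T, the coefficient rows of the relations p x = sum r y would have a nonzero
    combination that cancels every y; it leaves a relation among the x whose coefficients c s * p s
    do not all vanish. *)
Lemma steinitz (S T : finType) (x : S -> M) (y : T -> M) :
  (forall s, N (x s)) -> (forall t, N (y t)) ->
  rfree x -> (forall s, rdep y (x s)) -> (#|S| <= #|T|)%N.
Proof.
move=> Nx Ny fx dx; rewrite leqNgt; apply/negP => ltTS.
have /choice[p pP] : forall s, exists p : R, p != 0 /\ exists r : T -> R,
    Z (act p (x s) - \sum_t act (r t) (y t)) by [].
have /choice[r rP] : forall s, exists r : T -> R,
    Z (act (p s) (x s) - \sum_t act (r t) (y t)) by move=> s; case: (pP s).
have [c [[s cs] cr]] := idomain_kernel r ltTS.
have : c s * p s = 0.
  apply: (fx (fun s => c s * p s)).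
  have -> : \sum_t act (c t * p t) (x t) =
     \sum_t act (c t) (act (p t) (x t) - \sum_u act (r t u) (y u)).
    rewrite [RHS](eq_bigr (fun t => act (c t * p t) (x t)
       - \sum_u act (c t * r t u) (y u))); last first.
      move=> t _; rewrite actDr actN act_sum actM //; congr (_ - _).
      by apply: eq_bigr => u _; rewrite actM.
    rewrite sumrB exchange_big /= [X in _ - X]big1 ?subr0 // => u _.
    by rewrite -act_suml // cr act0l.
  by apply: Zsum => t; apply/Zact/rP.
by move/eqP; rewrite mulf_eq0 (negPf cs) /=; case: (pP s) => /negPf->.
Qed.

Lemma rfree_option (T : finType) (x : T -> M) y : (forall t, N (x t)) -> N y ->
  rfree x -> ~ rdep x y -> rfree (fun o : option T => if o is Some t then x t else y).
Proof.
move=> Nx Ny fx ndy r; rewrite big_option /= => Zr.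
have rN : r None = 0.
  apply: contrapT => /eqP r0; apply: ndy.
  exists (r None); split=> //; exists (fun t => - r (Some t)).
  rewrite -sumrN (eq_bigr (fun t => act (r (Some t)) (x t))) // => t _.
  apply/eqP; rewrite eq_sym -subr_eq0 opprK -actDl // addrN.
  by rewrite act0l.
case=> // t; apply: (fx (fun t => r (Some t))).
by move: Zr; rewrite rN act0l // add0r.
Qed.

Lemma rdep_mem (T : finType) (x : T -> M) t : (forall t, N (x t)) -> rdep x (x t).
Proof.
move=> Nx; exists 1; split; first exact: oner_neq0.
exists (fun s => if s == t then 1 else 0).
rewrite (bigD1 t) //= eqxx big1 ?addr0 ?subrr // => s /negPf->.
exact: act0l.
Qed.

Lemma rdepD (T : finType) (x : T -> M) y z : (forall t, N (x t)) -> N y -> N z ->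
  rdep x y -> rdep x z -> rdep x (y + z).
Proof.
move=> Nx Ny Nz [p [p0 [r rP]]] [q [q0 [s sP]]].
exists (p * q); split; first by rewrite mulf_neq0.
exists (fun t => q * r t + p * s t).
rewrite (eq_bigr (fun t => act q (act (r t) (x t)) + act p (act (s t) (x t)))).
  rewrite big_split -!act_sum actDr opprD addrACA; apply: ZD.
    by rewrite mulrC actM // -actN -actDr; apply: Zact.
  by rewrite actM // -actN -actDr; apply: Zact.
by move=> t _; rewrite actDl // !actM.
Qed.

Lemma rdep_act (T : finType) (x : T -> M) y r : (forall t, N (x t)) -> N y ->
  rdep x y -> rdep x (act r y).
Proof.
move=> Nx Ny [p [p0 [s sP]]]; exists p; split=> //.
exists (fun t => r * s t).
rewrite (eq_bigr (fun t => act r (act (s t) (x t)))).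
  by rewrite -act_sum -actM // mulrC actM // -actN -actDr; apply: Zact.
by move=> t _; rewrite actM.
Qed.

Lemma rdep_unact (T : finType) (x : T -> M) y r : (forall t, N (x t)) -> N y ->
  r != 0 -> rdep x (act r y) -> rdep x y.
Proof.
move=> Nx Ny r0 [p [p0 [s sP]]]; exists (p * r); rewrite mulf_neq0 //.
by split=> //; exists s; rewrite actM.
Qed.

Lemma rdepZ (T : finType) (x : T -> M) y z : (forall t, N (x t)) -> 
  Z (y - z) -> rdep x z -> rdep x y.
Proof.
move=> Nx Zyz [p [p0 [s sP]]]; exists p; split=> //; exists s.
rewrite -[y](subrK z) actDr -addrA; apply: ZD => //; exact: Zact.
Qed.

Lemma rdep0 (T : finType) (x : T -> M) : (forall t, N (x t)) -> rdep x 0.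
Proof.
move=> Nx; exists 1; split; first exact: oner_neq0.
exists (fun=> 0); rewrite big1 ?subr0 ?act0 // => t _; exact: act0l.
Qed.

Lemma rdep_sum (S T : finType) (x : T -> M) (y : S -> M) :
  (forall t, N (x t)) -> (forall s, N (y s)) ->
  (forall s, rdep x (y s)) -> rdep x (\sum_s y s).
Proof.
move=> Nx Ny dy.
suff [] : N (\sum_s y s) /\ rdep x (\sum_s y s) by [].
elim/big_rec: _ => [|s z _ [Nz dz]]; first by split=> //; apply: rdep0.
by split; [apply: ND | apply: rdepD].
Qed.

Lemma rdep_trans (S T : finType) (x : S -> M) (y : T -> M) z :
  (forall s, N (x s)) -> (forall t, N (y t)) -> N z ->
  rdep x z -> (forall s, rdep y (x s)) -> rdep y z.
Proof.
move=> Nx Ny Nz [p [p0 [r rP]]] dy.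
apply: (@rdep_unact _ _ _ p) => //; apply: (rdepZ _ rP) => //.
by apply: rdep_sum => // s; [apply: Nact | apply: rdep_act].
Qed.

Lemma rdep_comp (S T : finType) (f : S -> T) (x : T -> M) y :
  (forall t, N (x t)) -> N y -> rdep (x \o f) y -> rdep x y.
Proof.
move=> Nx Ny d; apply: (rdep_trans _ _ _ d) => //= s.
exact: rdep_mem.
Qed.

(** The bound on free families replaces Zorn's lemma: one of largest size cannot be enlarged by
    [rfree_option]. *)
Lemma rfree_max (S : set M) (m : nat) : S `<=` N ->
  (forall (T : finType) (x : T -> M), (forall t, S (x t)) -> rfree x -> (#|T| <= m)%N) ->
  exists (T : finType) (x : T -> M),
    [/\ forall t, S (x t), rfree x & forall y, S y -> rdep x y].
Proof.
move=> SN bnd.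
pose P n := `[< exists (T : finType) (x : T -> M),
   [/\ #|T| = n, forall t, S (x t) & rfree x] >].
have exP : exists n, P n.
  exists 0%N; apply/asboolP; exists void, (fun t : void => match t with end).
  by split; [rewrite card_void | case | move=> r _ []].
have ubP n : P n -> (n <= m)%N.
  by move=> /asboolP[T [x [<- Sx fx]]]; apply: bnd.
case: (ex_maxnP exP ubP) => n /asboolP[T [x [cT Sx fx]]] nmax.
exists T, x; split=> // y Sy; apply: contrapT => ndy.
suff : (n.+1 <= n)%N by rewrite ltnn.
apply/nmax/asboolP; exists (option T),
  (fun o : option T => if o is Some t then x t else y).
rewrite card_option cT; split=> //; first by case.
by apply: rfree_option => // [t|]; apply: SN.
Qed.

Lemma rfree_inj (S T : finType) (f : S -> T) (x : T -> M) :
  (forall t, N (x t)) ->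
  injective f -> rfree x -> rfree (x \o f).
Proof.
move=> Nx finj fx r Zr s.
pose r' t := if [pick s | f s == t] is Some s then r s else 0.
have r'f u : r' (f u) = r u.
  rewrite /r'; case: pickP => [v /eqP/finj-> //|/(_ u)].
  by rewrite eqxx.
rewrite -r'f; apply: fx.
rewrite (bigID (mem (codom f))) /= [X in _ + X]big1 ?addr0; last first.
  move=> t tf; rewrite /r'; case: pickP => [v /eqP e|_]; last exact: act0l.
  by rewrite -e codom_f in tf.
rewrite -big_uniq; last by rewrite map_inj_uniq ?enum_uniq.
rewrite codomE big_map big_enum /=.
by under eq_bigr do rewrite r'f.
Qed.

End Rank.

(** * Spans of words *)

Section Span.
Variables (k : fieldType) (M : lmodType k).

(** An inductive counterpart of [lspan], which allows induction on the terms of a combination. *)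
Inductive kspan (S : set M) : M -> Prop :=
| kspan0 : kspan S 0
| kspan_cons c s x : S s -> kspan S x -> kspan S (c *: s + x).

Lemma kspan_mem (S : set M) x : S x -> kspan S x.
Proof.
by move=> Sx; rewrite -[x]addr0 -[x]scale1r; apply: kspan_cons => //; apply: kspan0.
Qed.

Lemma kspanD (S : set M) x y : kspan S x -> kspan S y -> kspan S (x + y).
Proof.
move=> Sx Sy; elim: Sx => [|c s z Ss _ IH]; first by rewrite add0r.
by rewrite -addrA; apply: kspan_cons.
Qed.

Lemma kspanZ (S : set M) c x : kspan S x -> kspan S (c *: x).
Proof.
elim=> [|d s z Ss _ IH]; first by rewrite scaler0; apply: kspan0.
by rewrite scalerDr scalerA; apply: kspan_cons.
Qed.

Lemma kspan_sum (S : set M) (T : finType) (x : T -> M) :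
  (forall t, kspan S (x t)) -> kspan S (\sum_t x t).
Proof.
by move=> Sx; elim/big_ind: _ => //; [apply: kspan0 | apply: kspanD].
Qed.

Lemma kspanS (S S' : set M) x : (forall y, S y -> kspan S' y) ->
  kspan S x -> kspan S' x.
Proof.
move=> SS'; elim=> [|c s y Ss _ IH]; first exact: kspan0.
by apply/kspanD/IH/kspanZ/SS'.
Qed.

Lemma kspan_range (T : finType) (y : T -> M) x :
  kspan (range y) x -> exists c : T -> k, x = \sum_t c t *: y t.
Proof.
elim=> [|c s z [t _ <-] _ [d ->]].
  by exists (fun=> 0); rewrite big1 // => t _; rewrite scale0r.
exists (fun u => (if u == t then c else 0) + d u).
under [RHS]eq_bigr do rewrite scalerDl.
rewrite big_split /= [X in _ = X + _](bigD1 t) //= eqxx [X in _ = _ + X + _]big1 ?addr0 //.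
by move=> u /negPf->; rewrite scale0r.
Qed.

(** With this instance the rank lemmas specialise to dimension modulo the subspace [Z]. *)
Lemma kact_domain (Z : set M) :
  Z 0 -> (forall x y, Z x -> Z y -> Z (x - y)) ->
  (forall c x, Z x -> Z (c *: x)) ->
  domain_action (fun (c : k) (x : M) => c *: x) setT Z.
Proof.
move=> Z0 ZB ZZ; split=> //.
- by move=> r; rewrite scaler0.
- by move=> x _; rewrite scale1r.
- by move=> r s x _; rewrite scalerA.
- by move=> r s x _; rewrite scalerDl.
- by move=> r x y; rewrite scalerDr.
- by move=> r x _ r0 /(ZZ r^-1); rewrite scalerA mulVf // scale1r.
Qed.

Definition kfree (Z : set M) (T : finType) (x : T -> M) :=
  rfree (fun (c : k) (x : M) => c *: x) Z x.
Definition kdep (Z : set M) (T : finType) (x : T -> M) (y : M) :=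
  exists c : T -> k, Z (y - \sum_t c t *: x t).

Lemma kdepP (Z : set M) (T : finType) (x : T -> M) (y : M) :
  (forall c x, Z x -> Z (c *: x)) ->
  rdep (fun (c : k) (x : M) => c *: x) Z x y <-> kdep Z x y.
Proof.
move=> ZZ; split=> [[p [p0 [r Zr]]]|[c Zc]]; last first.
  by exists 1; rewrite oner_neq0 scale1r; split=> //; exists c.
exists (fun t => p^-1 * r t); move/(ZZ p^-1): Zr.
rewrite scalerBr scalerA mulVf // scale1r scaler_sumr.
by under eq_bigr do rewrite scalerA.
Qed.

End Span.

(** * The filtration of A by word length *)

Section Words.
Variables (k : fieldType) (A : algType k) (g : nat) (v : 'I_g -> A).

Definition ev (w : seq 'I_g) : A := \prod_(i <- w) v i.

Definition Vn (n : nat) : set A := kspan [set x | exists2 w, (size w <= n)%N & x = ev w].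

Lemma ev_cat u w : ev (u ++ w) = ev u * ev w.
Proof. by rewrite /ev big_cat. Qed.

Lemma ev_nil : ev [::] = 1.
Proof. by rewrite /ev big_nil. Qed.

Lemma ev_cons i w : ev (i :: w) = v i * ev w.
Proof. by rewrite /ev big_cons. Qed.

Lemma Vn_ev n w : (size w <= n)%N -> Vn n (ev w).
Proof. by move=> sw; apply: kspan_mem; exists w. Qed.

Lemma Vn1 n : Vn n 1.
Proof. by rewrite -ev_nil; apply: Vn_ev. Qed.

Lemma VnD n x y : Vn n x -> Vn n y -> Vn n (x + y).
Proof. exact: kspanD. Qed.

Lemma VnZ n c x : Vn n x -> Vn n (c *: x).
Proof. exact: kspanZ. Qed.

Lemma VnB n x y : Vn n x -> Vn n y -> Vn n (x - y).
Proof. by move=> Vx Vy; rewrite -scaleN1r; apply/VnD/VnZ. Qed.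

Lemma Vn_sum n (T : finType) (x : T -> A) :
  (forall t, Vn n (x t)) -> Vn n (\sum_t x t).
Proof. exact: kspan_sum. Qed.

Lemma Vn_mono m n x : (m <= n)%N -> Vn m x -> Vn n x.
Proof.
move=> mn; apply: kspanS => y [w sw ->]; apply: Vn_ev; exact: leq_trans mn.
Qed.

Lemma VnM m n x y : Vn m x -> Vn n y -> Vn (m + n) (x * y).
Proof.
move=> Vx Vy; elim: Vx => [|c s z [u su ->] _ IH].
  by rewrite mul0r; apply: kspan0.
rewrite mulrDl; apply: VnD => //; rewrite -scalerAl; apply: VnZ.
elim: Vy => [|d s' z' [w sw ->] _ IH']; first by rewrite mulr0; apply: kspan0.
rewrite mulrDr; apply: VnD => //; rewrite -scalerAr -ev_cat; apply/VnZ/Vn_ev.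
by rewrite size_cat leq_add.
Qed.

Lemma VnX m n x : Vn m x -> Vn (n * m) (x ^+ n).
Proof.
move=> Vx; elim: n => [|n IH]; first by rewrite expr0; apply: Vn1.
by rewrite exprS mulSn; apply: VnM.
Qed.

Lemma Vn_S n x : Vn n.+1 x ->
  exists c : k, exists y : 'I_g -> A, (forall i, Vn n (y i)) /\ x = c%:A + \sum_i v i * y i.
Proof.
elim=> [|c s z [w sw ->] _ [d [y [Vy ->]]]].
  exists 0, (fun=> 0); split=> [i|]; first exact: kspan0.
  by rewrite scale0r add0r big1 // => i _; rewrite mulr0.
case: w sw => [|i w] sw.
  by exists (c + d), y; split=> //; rewrite ev_nil scalerDl addrA.
exists d, (fun j => (if j == i then c *: ev w else 0) + y j); split.
  move=> j; apply: VnD => //; case: eqP => _; last exact: kspan0.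
  by apply/VnZ/Vn_ev.
under [X in _ = _ + X]eq_bigr do rewrite mulrDr.
rewrite big_split /= addrCA; congr (_ + (_ + _)).
rewrite (bigD1 i) //= eqxx big1 ?addr0; first by rewrite ev_cons scalerAr.
by move=> j /negPf->; rewrite mulr0.
Qed.

Lemma VnP n x : Vn n x -> exists c : n.-bseq 'I_g -> k, x = \sum_w c w *: ev w.
Proof.
move=> Vx; have [] := @kspan_range _ _ _ (fun w : n.-bseq 'I_g => ev w) x.
  apply: kspanS Vx => y [w sw ->]; apply: kspan_mem.
  by exists (Bseq sw).
by move=> c ->; exists c.
Qed.

End Words.

(** The letters are a basis of the frame. The bound uses n.+1 so that it also covers degree 0, where
    the growth condition says nothing. *)
Lemma quadratic_growth_words (R : realType) (k : fieldType) (A : algType k) :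
  quadratic_growth A R ->
  exists (g : nat) (v : 'I_g -> A) (C : nat),
    (forall x, exists n, Vn v n x) /\
    forall n (T : finType) (x : T -> A), (forall t, Vn v n (x t)) ->
      kfree [set 0] x -> (#|T| <= C * n.+1 ^ 2)%N.
Proof.
move=> [V [[[g [v [vfree VE]]] V1 genV] [C1 [C2 [C1p C2p dimV]]]]].
have Vv i : V (v i).
  rewrite VE; exists 1%N, (fun=> 1), (fun=> v i); split; first by move=> _; exists i.
  by rewrite big_ord1 scale1r.
exists g, v, (Num.bound C2); split.
  move=> x; suff : [set x | exists n, Vn v n x] = [set: A].
    by move/(congr1 (fun S : set A => S x)) => /= ->.
  apply: genV; last first.
    move=> y; rewrite VE => -[n [c [s [sv ->]]]].
    exists 1%N; apply: Vn_sum => i; apply: VnZ.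
    case: (sv i) => j _ <-; rewrite -[v j]mulr1 -(ev_nil v) -ev_cons.
    exact: Vn_ev.
  split; rewrite ?inE /=.
  - by exists 0%N; apply: Vn1.
  - move=> a u w; rewrite !inE /= => -[m Vu] [n Vw]; exists (m + n)%N.
    apply: VnD; first by apply/VnZ/(Vn_mono _ Vu)/leq_addr.
    exact/(Vn_mono _ Vw)/leq_addl.
  - move=> u w; rewrite !inE /= => -[m Vu] [n Vw]; exists (m + n)%N.
    exact: VnM.
move=> n T x Vx fx.
have [|d [[b [_ bE]] /andP[_ dC]]] := dimV n.+1; first by [].
have dle : (d <= Num.bound C2 * n.+1 ^ 2)%N.
  rewrite -(ler_nat R); apply: le_trans dC _.
  rewrite natrM natrX ler_wpM2r ?exprn_ge0 //.
  exact/ltW/archi_boundP/ltW.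
apply: leq_trans dle; rewrite -[d]card_ord.
have HD : domain_action (fun (c : k) (x : A) => c *: x) setT [set 0].
  apply: kact_domain => //=; first by move=> ? ? -> ->; rewrite subr0.
  by move=> c ? ->; rewrite scaler0.
apply: (steinitz HD (y := b)) fx _ => // t.
apply/kdepP => [c ? ->|]; first by rewrite /= scaler0.
suff : lspan (range b) (x t).
  move=> [m [c [s [sb ->]]]].
  have [|c' e] := @kspan_range _ _ _ b (\sum_i c i *: s i).
    by apply: kspan_sum => i; apply/kspanZ/kspan_mem.
  by exists c'; rewrite e subrr.
rewrite -bE.
have [c ->] := VnP (Vn_mono (leqnSn n) (Vx t)).
pose W := {: n.+1.-bseq 'I_g}.
exists #|W|, (fun i => c (enum_val i)), (fun i => ev v (enum_val i : W)).
split; last first.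
  rewrite (reindex (@enum_val W W)) //=.
  by exists enum_rank => i _; rewrite ?enum_valK ?enum_rankK.
move=> i; move: (enum_val i) => w.
(* A word shorter than n.+1 is padded with factors 1, which belong to the frame. *)
exists (fun j : 'I_n.+1 => nth 1 [seq v l | l <- w] j); split.
  move=> j; case: (ltnP j (size [seq v l | l <- w])) => jw.
    by have /mapP[l _ ->] := mem_nth 1 jw.
  by rewrite nth_default.
rewrite /ev -(big_map v predT id) /=.
have sw : (size [seq v l | l <- w] <= n.+1)%N by rewrite size_map size_bseq.
rewrite -(big_mkord predT (fun j => nth 1 [seq v l | l <- w] j)).
rewrite (big_cat_nat (leq0n _) sw) /= [X in _ = _ * X]big_nat_cond.
rewrite [X in _ = _ * X]big1 ?mulr1; first by rewrite (big_nth 1) big_mkord.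
by move=> j /andP[/andP[jw _] _]; rewrite nth_default.
Qed.

(** * Ideals of left Goldie rings *)

Section Ideals.
Variable A : nzRingType.

Definition lideal (L : set A) : Prop :=
  [/\ L 0, forall x y, L x -> L y -> L (x - y) & forall a x, L x -> L (a * x)].

(** Closure conditions in [Prop], without the boolean membership of [two_sided_ideal]. *)
Definition ideal2 (I : set A) : Prop :=
  lideal I /\ forall a x, I x -> I (x * a).

Lemma lidealN (L : set A) x : lideal L -> L x -> L (- x).
Proof. by move=> [L0 LB _] Lx; rewrite -sub0r; apply: LB. Qed.

Lemma lidealD (L : set A) x y : lideal L -> L x -> L y -> L (x + y).
Proof.
by move=> LL Lx Ly; rewrite -[y]opprK; case: (LL) => _ LB _; apply: LB => //; apply: lidealN.
Qed.

Lemma lideal_sum (L : set A) (T : finType) (x : T -> A) :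
  lideal L -> (forall t, L (x t)) -> L (\sum_t x t).
Proof.
move=> LL Lx; elim/big_ind: _ => // [|y z]; first by case: LL.
exact: lidealD.
Qed.

Lemma ideal2_set0 : ideal2 [set 0].
Proof.
by split=> [|a _ ->]; [split=> // [_ _ -> ->|a _ ->] |]; rewrite ?subr0 ?mulr0 ?mul0r.
Qed.

Definition ideal_gen (x : A) : set A :=
  [set z | exists (T : finType) (a b : T -> A), z = \sum_t a t * x * b t].

Lemma ideal_gen_mem x a b : ideal_gen x (a * x * b).
Proof.
exists unit, (fun=> a), (fun=> b); by rewrite (bigD1 tt) //= big1 ?addr0 // => -[].
Qed.

Lemma ideal2_gen x : ideal2 (ideal_gen x).
Proof.
split; first split.
- by exists void, (fun=> 0), (fun=> 0); rewrite big1 // => -[].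
- move=> _ _ [T1 [a1 [b1 ->]]] [T2 [a2 [b2 ->]]].
  exists (T1 + T2)%type, (fun t => match t with inl u => a1 u | inr u => - a2 u end),
    (fun t => match t with inl u => b1 u | inr u => b2 u end).
  rewrite big_sumType; congr (_ + _); rewrite -sumrN; apply: eq_bigr => t _.
  by rewrite !mulNr.
- move=> c _ [T [a [b ->]]]; exists T, (fun t => c * a t), b.
  by rewrite mulr_sumr; under eq_bigr do rewrite !mulrA.
- move=> c _ [T [a [b ->]]]; exists T, a, (fun t => b t * c).
  by rewrite mulr_suml; under [RHS]eq_bigr do rewrite !mulrA.
Qed.

Lemma ideal2_two_sided I : ideal2 I -> two_sided_ideal I.
Proof.
move=> [[I0 IB Il] Ir]; split=> //; split=> [|x a]; last exact: Ir.
by split; rewrite ?inE // => x y; rewrite !inE; apply: IB.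
Qed.

Lemma prime_ring_mul : prime_ring A -> forall x y : A, (forall a, x * a * y = 0) -> x = 0 \/ y = 0.
Proof.
move=> prA x y xAy.
have [] := prA (ideal_gen x) (ideal_gen y); try exact/ideal2_two_sided/ideal2_gen.
- move=> _ _ [T1 [a1 [b1 ->]]] [T2 [a2 [b2 ->]]].
  rewrite big_distrlr /= big1 // => i _; rewrite big1 // => j _.
  have -> : a1 i * x * b1 i * (a2 j * y * b2 j)
    = a1 i * (x * (b1 i * a2 j) * y) * b2 j by rewrite !mulrA.
  by rewrite xAy mulr0 mul0r.
- move=> e; left; have := ideal_gen_mem x 1 1; rewrite e mul1r mulr1.
  by [].
- move=> e; right; have := ideal_gen_mem y 1 1; rewrite e mul1r mulr1.
  by [].
Qed.

End Ideals.

(** * Annihilators and regular elements in prime left Goldie rings *)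

Section LeftGoldie.
Variable A : nzRingType.

Definition lann (S : set A) : set A := [set x | forall s, S s -> x * s = 0].

Lemma left_goldie_acc : left_goldie A -> forall S : nat -> set A,
  (forall n, lann (S n) `<=` lann (S n.+1)) ->
  exists N, forall n, (N <= n)%N -> lann (S n) = lann (S N).
Proof. by move=> [_ acc] S; apply: (acc S). Qed.

Lemma left_goldie_direct : left_goldie A -> forall I : nat -> set A,
  (forall n, lideal (I n) /\ exists x, I n x /\ x <> 0) -> ~ direct_family I.
Proof.
move=> [nd _] I II dI; apply: nd; exists (I : nat -> set A^c); split=> // n.
have [[I0 IB Il] [x [Ix x0]]] := II n; split.
  split=> [|y a Iy]; last exact: Il.
  by split; rewrite ?inE // => y z; rewrite !inE; apply: IB.
by move=> e; apply: x0; move: Ix; rewrite e.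
Qed.

Hypothesis prA : prime_ring A.
Hypothesis goA : left_goldie A.

(** Otherwise iterated choice gives an endless strictly increasing chain of left annihilators of
    elements of [L]. *)
Lemma max_annihilator (L : set A) x0 : L x0 -> x0 <> 0 ->
  exists a, [/\ L a, a <> 0 & forall b, L b -> b <> 0 ->
    (forall x, x * a = 0 -> x * b = 0) -> forall x, x * b = 0 -> x * a = 0].
Proof.
move=> Lx0 x00; apply: contrapT => nomax.
pose T := {a | L a /\ a <> 0}.
have /choice[f fP] : forall a : T, exists b : T,
   (forall x, x * sval a = 0 -> x * sval b = 0) /\
   ~ (forall x, x * sval b = 0 -> x * sval a = 0).
  move=> [a [La a0]] /=; apply: contrapT => nob; apply: nomax.
  exists a; split=> // b Lb b0 ab; apply: contrapT => nba; apply: nob.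
  by exists (exist _ b (conj Lb b0)).
pose s n : T := iter n f (exist _ x0 (conj Lx0 x00)).
have [n|N NP] := left_goldie_acc goA (S := fun n => [set sval (s n)]).
  by move=> x xs _ ->; apply: (fP (s n)).1; apply: xs.
case: (fP (s N)) => _; apply=> x xs.
have : lann [set sval (s N)] x.
  by rewrite -(NP N.+1) // => _ ->.
by apply.
Qed.

(** For [a] of maximal annihilator, primeness makes some a u a nonzero, and u a has the property: x
    u a u a = 0 puts x u in the annihilator of a u a, which by maximality is that of a. *)
Lemma idempotent_annihilator (L : set A) x0 : lideal L -> L x0 -> x0 <> 0 ->
  exists a, [/\ L a, a <> 0 & forall x, x * a * a = 0 -> x * a = 0].
Proof.
move=> [_ _ Ll] Lx0 x00.
have [a [La a0 amax]] := max_annihilator Lx0 x00.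
have [u aua0] : exists u, a * u * a <> 0.
  apply: contrapT => nou; have [] // := prime_ring_mul prA (x := a) (y := a).
  by move=> u; apply: contrapT => aua; apply: nou; exists u.
exists (u * a); split; first exact: Ll.
  by move=> ua0; apply: aua0; rewrite -mulrA ua0 mulr0.
move=> x xuaua; have -> : x * (u * a) = x * u * a by rewrite mulrA.
apply: (amax (a * u * a)) => // [|y ya|]; first exact: Ll.
  by rewrite !mulrA ya !mul0r.
by rewrite !mulrA in xuaua *.
Qed.

(** Right multiplication by [a i] kills the later terms by the triangular relations, and the earlier
    ones vanish by induction. *)
Lemma direct_products (a x : nat -> A) n :
  (forall i j, (i < j)%N -> a j * a i = 0) ->
  (forall i y, y * a i * a i = 0 -> y * a i = 0) ->
  \sum_(i < n) x i * a i = 0 -> forall i, (i < n)%N -> x i * a i = 0.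
Proof.
move=> aa ai xa i; elim/ltn_ind: i => i IH lti.
apply: ai; have := congr1 (fun y => y * a i) xa.
rewrite mul0r mulr_suml (bigD1 (Ordinal lti)) //= big1 ?addr0 // => j.
rewrite -val_eqE /= => ji; case: (ltngtP j i) => [ltji|ltij|eji].
- by rewrite IH ?mul0r //; apply: ltn_trans lti.
- by rewrite -mulrA aa // mulr0.
- by rewrite eji eqxx in ji.
Qed.

(* Choose a_0, a_1, ... in I with a_n annihilated by no more than its square
   and a_n a_i = 0 for i < n.  The sum of the A a_n is direct, hence the
   process stops, and then a_0 + ... + a_n has no left annihilator. *)
Lemma left_regular_mem (I : set A) y : ideal2 I -> I y -> y <> 0 ->
  exists c, I c /\ forall x, x * c = 0 -> x = 0.
Proof.
move=> [[I0 IB Il] Ir] Iy y0; apply: contrapT => noc.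
pose P (s : seq A) a := [/\ I a, a <> 0,
   forall b, b \in s -> a * b = 0 & forall x, x * a * a = 0 -> x * a = 0].
have /choice[next nextP] : forall s, exists a, (exists b, P s b) -> P s a.
  by move=> s; case: (pselect (exists b, P s b)) => [[b Pb]|nP]; [exists b | exists 0].
pose pre := fix pre n := if n is m.+1 then rcons (pre m) (next (pre m)) else [::].
pose a n := next (pre n).
have mem_pre m n : (m < n)%N -> a m \in pre n.
  elim: n => // n IH; rewrite ltnS leq_eqVlt /= mem_rcons inE => /orP[/eqP->|/IH->].
    by rewrite eqxx.
  by rewrite orbT.
have preE n : pre n = [seq a i | i <- iota 0 n].
  elim: n => // n IH; rewrite -[in RHS]addn1 iotaD map_cat /= cats1 -IH add0n.
  by [].
have aP n : P (pre n) (a n).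
  elim/ltn_ind: n => n IH; apply: nextP.
  apply: contrapT => nP.
  (* A nonzero z in I that kills the earlier terms would, through [idempotent_annihilator] on the
     left ideal of all such z, supply the next term. *)
  have ann0 z : I z -> (forall b, b \in pre n -> z * b = 0) -> z = 0.
    move=> Iz zb; apply: contrapT => z0.
    have [||b [[Ib bb] b0 bi]] := @idempotent_annihilator
        [set z | I z /\ forall b, b \in pre n -> z * b = 0] z _ _ z0; first last.
    - by apply: nP; exists b.
    - by [].
    - split=> [|u w [Iu ub] [Iw wb]|u w [Iw wb]].
      + by split=> // b _; rewrite mul0r.
      + by split; [apply: IB | move=> b bp; rewrite mulrBl ub ?wb ?subrr].
      + by split; [apply: Il | move=> b bp; rewrite -mulrA wb ?mulr0].
  apply: noc; exists (\sum_(i < n) a i); split.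
    by apply: (@lideal_sum _ I) => // i; case: (IH i).
  move=> x; rewrite mulr_sumr => xa.
  pose a' i := if (i < n)%N then a i else 0.
  have xa' : forall i, (i < n)%N -> x * a' i = 0.
    apply: (@direct_products a' (fun=> x) n).
    - move=> i j ij; rewrite /a'; case: ltnP => [jn|_]; last by rewrite mul0r.
      rewrite (ltn_trans ij jn).
      by case: (IH j jn) => _ _ + _; apply; apply: mem_pre.
    - move=> i z; rewrite /a'; case: ltnP => [jn|_]; last by rewrite !mulr0.
      by case: (IH i jn) => _ _ _; apply.
    - by rewrite -[RHS]xa; apply: eq_bigr => i _; rewrite /a' ltn_ord.
  (* x kills the earlier terms, so y u x does too and lies in I; it vanishes for all u. *)
  have [|//|//] := prime_ring_mul prA (x := y) (y := x).
  move=> u; apply: ann0; first by rewrite -mulrA; apply: Ir.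
  move=> b; rewrite preE => /mapP[i]; rewrite mem_iota add0n => /= lti ->.
  by have := xa' i lti; rewrite /a' lti -!mulrA => ->; rewrite !mulr0.
apply: (left_goldie_direct goA (I := fun n => [set z | exists x, z = x * a n])).
  move=> n; split; last first.
    exists (a n); split; first by exists 1; rewrite mul1r.
    by case: (aP n).
  split=> [|_ _ [u ->] [w ->]|u _ [w ->]]; first by exists 0; rewrite mul0r.
    by exists (u - w); rewrite mulrBl.
  by exists (u * w); rewrite mulrA.
move=> n x /choice[u uP] xs i; rewrite uP.
pose u' j := if insub j is Some i then u i else 0.
have u'E (j : 'I_n) : u' j = u j by rewrite /u' valK.
rewrite -u'E; apply: (@direct_products a u' n).
- by move=> j l jl; case: (aP l) => _ _ + _; apply; apply: mem_pre.
- by move=> j z; case: (aP j) => _ _ _; apply.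
- by rewrite -[RHS]xs; apply: eq_bigr => j _; rewrite u'E uP.
- exact: ltn_ord.
Qed.

(** The annihilator of b y b contains that of b, hence equals it by maximality. This is the
    cancellation law for b on which the nonsingular case rests. *)
Lemma max_annihilator_mul : exists b : A, b <> 0 /\
  forall y x, b * y * b <> 0 -> x * b * y * b = 0 -> x * b = 0.
Proof.
have [b [_ b0 bmax]] := @max_annihilator setT 1 I (fun e => negP (oner_neq0 A) (introT eqP e)).
exists b; split=> // y x byb xbyb; apply: (bmax (b * y * b)) => // [z zb|].
  by rewrite !mulrA zb !mul0r.
by rewrite !mulrA.
Qed.

End LeftGoldie.

(** * Linear growth modulo an ideal *)

Lemma lidealZ (k : fieldType) (A : algType k) (L : set A) (c : k) x :
  lideal L -> L x -> L (c *: x).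
Proof. by move=> [_ _ Ll] Lx; rewrite -[x]mul1r scalerAl; apply: Ll. Qed.

Lemma lideal_kact (k : fieldType) (A : algType k) (L : set A) :
  lideal L -> domain_action (fun (c : k) (x : A) => c *: x) setT L.
Proof.
move=> LL; apply: kact_domain; first by case: LL.
- by case: LL.
- by move=> c x; apply: lidealZ.
Qed.

Lemma kdep_lideal (k : fieldType) (A : algType k) (L : set A) (T : finType)
    (x : T -> A) y : lideal L ->
  rdep (fun (c : k) (x : A) => c *: x) L x y <-> kdep L x y.
Proof. by move=> LL; apply: kdepP => c z; apply: lidealZ. Qed.

Lemma kfreeS (k : fieldType) (M : lmodType k) (Z Z' : set M) (T : finType) (x : T -> M) :
  Z `<=` Z' -> kfree Z' x -> kfree Z x.
Proof. by move=> ZZ' fx r /ZZ'; apply: fx. Qed.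

Section Growth.
Variables (k : fieldType) (A : algType k) (g : nat) (v : 'I_g -> A) (C : nat).
Hypothesis Vall : forall x, exists n, Vn v n x.
Hypothesis growth : forall n (T : finType) (x : T -> A),
  (forall t, Vn v n (x t)) -> kfree [set 0] x -> (#|T| <= C * n.+1 ^ 2)%N.

Definition linear_growth (I : set A) (D : nat) : Prop :=
  forall n (T : finType) (x : T -> A),
    (forall t, Vn v n (x t)) -> kfree I x -> (#|T| <= D * n.+1)%N.

Lemma linear_growthS (I J : set A) D : I `<=` J -> linear_growth I D -> linear_growth J D.
Proof. by move=> IJ gI n T x Vx fx; apply: gI Vx _; apply: kfreeS fx. Qed.

(** For x t independent modulo I the products x t * c ^+ j are independent: modulo I only j = 0
    remains, and then c cancels. With j up to n this gives (n + 1) |T| elements of degree O(n), and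
    quadratic growth leaves |T| = O(n). *)
Lemma linear_growth_ideal (I : set A) c : ideal2 I -> I c ->
  (forall x, x * c = 0 -> x = 0) -> exists D, linear_growth I D.
Proof.
move=> II Ic creg; have [s Vc] := Vall c.
exists (C * s.+1 ^ 2)%N => n T x Vx fx.
have key : forall m (r : T -> nat -> k),
    \sum_(j < m) (\sum_t r t j *: x t) * c ^+ j = 0 ->
    forall j t, (j < m)%N -> r t j = 0.
  elim=> // m IH r; rewrite big_ord_recl expr0 mulr1 /= => r0.
  have r0E t : r t 0%N = 0.
    apply: (fx (fun t => r t 0%N)).
    have -> : \sum_t r t 0%N *: x t
       = - (\sum_(i < m) (\sum_t r t (bump 0 i) *: x t) * c ^+ bump 0 i).
      by apply/eqP; rewrite -subr_eq0 opprK r0.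
    apply: lidealN; first by case: II.
    apply: lideal_sum => [|i]; first by case: II.
    by case: II => -[_ _ Il] _; rewrite /bump add1n exprSr mulrA; apply: Il.
  move: r0; rewrite big1 ?add0r; last by move=> t _; rewrite r0E scale0r.
  rewrite (eq_bigr (fun i : 'I_m => (\sum_t r t i.+1 *: x t) * c ^+ i * c)).
    rewrite -mulr_suml => /creg /(IH (fun t j => r t j.+1)) rE [|j] t ltj //.
    exact: (rE j t).
  by move=> i _; rewrite /bump /= add1n exprSr mulrA.
have Vxc (tj : T * 'I_n.+1) : Vn v (n + n * s) (x tj.1 * c ^+ tj.2).
  apply: VnM => //; apply: Vn_mono (VnX tj.2 Vc).
  by rewrite leq_mul2r -ltnS ltn_ord orbT.
have fxc : kfree [set 0] (fun tj : T * 'I_n.+1 => x tj.1 * c ^+ tj.2).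
  move=> r /= r0 [t j].
  pose r' t i := if insub i is Some j then r (t, j) else 0.
  have r'E u (i : 'I_n.+1) : r' u i = r (u, i) by rewrite /r' valK.
  rewrite -r'E; apply: (key n.+1 r') => //.
  rewrite -[RHS]r0 [RHS](eq_bigr (fun tj : T * 'I_n.+1 =>
    r (tj.1, tj.2) *: (x tj.1 * c ^+ tj.2))); last by case.
  rewrite -(pair_bigA _ (fun u i => r (u, i) *: (x u * c ^+ nat_of_ord i))) /=.
  rewrite exchange_big; apply: eq_bigr => i _; rewrite mulr_suml.
  by apply: eq_bigr => u _; rewrite r'E scalerAl.
have := growth Vxc fxc.
rewrite card_prod card_ord -mulnS => /leq_trans le1.
have le2 : (C * (n * s.+1).+1 ^ 2 <= C * s.+1 ^ 2 * n.+1 * n.+1)%N.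
  have le3 : ((n * s.+1).+1 <= s.+1 * n.+1)%N by lia.
  apply: (@leq_trans (C * (s.+1 * n.+1) ^ 2)).
    by rewrite leq_mul2l leq_exp2r // le3 orbT.
  by rewrite expnMn -[X in (_ <= X)%N]mulnA mulnn mulnA.
by have := le1 _ le2; rewrite leq_pmul2r.
Qed.

Lemma finite_basis (I : set A) n : lideal I ->
  exists (T : finType) (u : T -> A), [/\ forall t, Vn v n (u t), kfree I u &
    forall x, Vn v n x -> kdep I u x].
Proof.
move=> II; have I0 : I 0 by case: II.
have [||T [u [Vu fu du]]] := @rfree_max _ _ _ _ _ (lideal_kact II) (Vn v n) (C * n.+1 ^ 2).
- by [].
- move=> T x Vx fx; apply: growth Vx _; apply: kfreeS fx.
  by move=> _ ->.
by exists T, u; split=> // x Vx; apply/kdep_lideal => //; apply: du.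
Qed.

End Growth.

(** * Languages of linear growth *)

Section Language.
Local Open Scope nat_scope.
Variable (g : nat).
Let X := 'I_g.

Definition wpow (w : seq X) (N : nat) : seq X := flatten (nseq N w).

Lemma size_wpow w N : size (wpow w N) = (N * size w)%N.
Proof. by elim: N => //= N IH; rewrite /wpow /= size_cat -/(wpow w N) IH mulSn. Qed.

Lemma wpowS w N : wpow w N.+1 = w ++ wpow w N.
Proof. by []. Qed.

Lemma wpowD w m n : wpow w (m + n) = wpow w m ++ wpow w n.
Proof. by rewrite /wpow nseqD flatten_cat. Qed.

Lemma nth_wpow x0 w N m : (m < N * size w)%N ->
  nth x0 (wpow w N) m = nth x0 w (m %% size w).
Proof.
elim: N m => // N IH m; rewrite mulSn wpowS nth_cat => ltm.
case: ltnP => [lt|le]; first by rewrite modn_small.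
by rewrite IH ?ltn_subLR // -[in RHS](subnKC le) modnDl.
Qed.

(* A language with boundedly many words of some large length n has, in every
   long word, two equal factors of length n at small distance q, hence a factor
   w^N with |w| = q and N of order n / q. *)
Lemma bounded_language (Lg : seq X -> Prop) (D : nat) :
  (forall a w b, Lg (a ++ w ++ b) -> Lg w) ->
  (forall n (T : finType) (f : T -> seq X), injective f ->
     (forall t, (size (f t) <= n)%N /\ Lg (f t)) -> (#|T| <= D * n.+1)%N) ->
  (forall w, w <> [::] -> exists N, ~ Lg (wpow w N)) ->
  exists L, forall w, Lg w -> (size w <= L)%N.
Proof.
move=> fac cnt pow; apply: contrapT => nobnd.
have long L : exists w, Lg w /\ (L <= size w)%N.
  apply: contrapT => nw; apply: nobnd; exists L => w Lw.
  by rewrite leqNgt; apply/negP => /ltnW lt; apply: nw; exists w.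
pose Q := (2 * D)%N.
have [N0 N0P] : exists N0, forall w, w <> [::] -> (size w <= Q)%N -> ~ Lg (wpow w N0).
  have /choice[Nf NfP] : forall w : Q.-bseq X, exists N, bseqval w <> [::] -> ~ Lg (wpow w N).
    move=> w; case: (pselect (bseqval w = [::])) => [e|/pow[N NP]]; last by exists N.
    by exists 0%N.
  exists (\max_w Nf w) => w w0 sw Lw.
  apply: (NfP (Bseq sw)) => //=.
  have le : (Nf (Bseq sw) <= \max_w Nf w)%N by apply: leq_bigmax.
  apply: (fac [::] _ (wpow w (\max_w Nf w - Nf (Bseq sw)))).
  by rewrite cat0s -wpowD subnKC.
(* Words of length l or more have room for N0 periods of any length up to Q. *)
pose l := (Q * N0).+1.
pose p n := #|[pred t : n.-tuple X | `[< Lg t >]]|.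
(* If each of the l lengths from l to 2 l - 1 had more than Q = 2 D words, there would be more than
   2 l D words of length below 2 l. *)
have [n [len ltn pn]] : exists n, [/\ (l <= n)%N, (n < 2 * l)%N & (p n <= Q)%N].
  apply: contrapT => nn.
  pose T := {i : 'I_l & {t : (l + i).-tuple X | `[< Lg t >]}}.
  pose f (t : T) : seq X := tval (val (tagged t)).
  have fi : injective f.
    move=> [i [t Lt]] [j [u Lu]]; rewrite /f /= => e.
    have ij : i = j.
      have := size_tuple t; rewrite e size_tuple => /addnI ji; exact/val_inj.
    move: t Lt e; rewrite {}ij => t Lt e.
    have tu : t = u by apply: val_inj.
    by move: Lt; rewrite {}tu => Lt; rewrite (bool_irrelevance Lt Lu).
  have := cnt (2 * l).-1 T f fi; rewrite prednK; last by rewrite muln_gt0.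
  have fP (t : T) : (size (f t) <= (2 * l).-1)%N /\ Lg (f t).
    case: t => i [t Lt]; split; last exact/asboolP.
    rewrite /f /= size_tuple.
    have := ltn_ord i; lia.
  move=> /(_ fP); rewrite leqNgt => /negP; apply.
  rewrite card_tagged sumnE big_map big_enum /=.
  apply: (@leq_trans (\sum_(i < l) Q.+1)).
    by rewrite sum_nat_const card_ord /Q; lia.
  apply: leq_sum => i _; rewrite card_sig ltnNge; apply/negP => le; apply: nn.
  by exists (l + i)%N; split=> //; have := ltn_ord i; lia.
have [u [Lu leu]] := long (n + Q)%N.
have lfac i : (i <= Q)%N -> size (take n (drop i u)) == n.
  move=> iQ; rewrite size_takel // size_drop; lia.
have Lfac i : Lg (take n (drop i u)).
  apply: (fac (take i u) _ (drop n (drop i u))).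
  by rewrite cat_take_drop cat_take_drop.
pose F (i : 'I_Q.+1) : n.-tuple X := Tuple (lfac i (ltn_ord i)).
have /injectivePn[i [j ij eF]] : ~~ injectiveb F.
  apply/negP => /injectiveP Fi.
  have : (#|'I_Q.+1| <= p n)%N.
    rewrite -(card_codom Fi); apply: subset_leq_card.
    apply/fintype.subsetP => _ /codomP[i0 ->]; rewrite unfold_in /=; apply/asboolP; exact: (Lfac (nat_of_ord i0)).
  by rewrite card_ord; lia.
wlog ltij : i j ij eF / (i < j)%N.
  move=> W; case: (ltngtP i j) => [|lt|e]; first exact: W eF.
    by apply: (W j i) => //; rewrite eq_sym.
  by case/eqP: ij; apply: val_inj.
pose q := (j - i)%N.
have qQ : (q <= Q)%N by have := ltn_ord j; rewrite /q; lia.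
have q0 : (0 < q)%N by rewrite subn_gt0.
have nge : (q * N0 <= n)%N by apply: leq_trans len; rewrite /l leqW // leq_mul2r qQ orbT.
case: u => [|x0 u0] in Lu leu lfac Lfac F eF *.
  by move: leu; rewrite leqn0 addn_eq0 => /andP[/eqP n0 _]; rewrite n0 in len.
set u := x0 :: u0 in Lu leu lfac Lfac F eF *.
have per m : (m < n)%N -> nth x0 u (i + m) = nth x0 u (j + m).
  move=> mn; have := congr1 (fun t : n.-tuple X => nth x0 t m) eF.
  by rewrite /= !nth_take // !nth_drop.
(* The factors starting at i and j agree, so u has period q = j - i on n + q letters. *)
have perm m : (m < n + q)%N -> nth x0 u (i + m) = nth x0 u (i + m %% q).
  elim/ltn_ind: m => m IH ltm; case: (ltnP m q) => [lt|le]; first by rewrite modn_small.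
  have -> : (i + m = j + (m - q))%N by rewrite /q; lia.
  rewrite -per; last by lia.
  by rewrite IH; [rewrite -[in RHS](subnK le) modnDr | lia | lia].
pose w := take q (drop i u).
have sw : size w = q.
  by rewrite /w size_takel // size_drop; have := ltn_ord j; rewrite /q; lia.
apply: (N0P w); rewrite ?sw //; first by move=> w0; rewrite -sw w0 in q0.
have -> : wpow w N0 = take (q * N0) (drop i u).
  have sz : size (take (q * N0) (drop i u)) = (q * N0)%N.
    by rewrite size_takel // size_drop; have := ltn_ord i; lia.
  apply: (@eq_from_nth _ x0) => [|m]; first by rewrite size_wpow sw sz mulnC.
  rewrite size_wpow sw => ltm; rewrite nth_wpow sw //.
  have lm : (m %% q < q)%N by rewrite ltn_pmod.
  rewrite /w !nth_take ?nth_drop //; last by rewrite mulnC.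
  by rewrite -perm //; lia.
apply: (fac (take i u) _ (drop (q * N0) (drop i u))).
by rewrite cat_take_drop cat_take_drop.
Qed.

(* Numerical order of the codes is the degree lexicographic order. *)
Let B := g.+1.
Definition code (w : seq X) : nat := foldl (fun c (i : X) => (c * B + i.+1)%N) 0%N w.

Lemma code_rcons w i : code (rcons w i) = (code w * B + i.+1)%N.
Proof. by rewrite /code foldl_rcons. Qed.

Lemma code_cat a b : code (a ++ b) = (code a * B ^ size b + code b)%N.
Proof.
elim/last_ind: b => [|b i IH]; first by rewrite cats0 muln1 addn0.
rewrite -rcons_cat !code_rcons IH size_rcons expnSr mulnDl -!mulnA.
by rewrite addnA.
Qed.

(** The digits run from 1 to g and never take the value 0, so the code determines the length as
    well. *)
Lemma code_inj : injective code.
Proof.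
elim/last_ind => [|w i IH] w'; case/lastP: w' => [|w' i'] //; rewrite ?code_rcons //.
- by rewrite /code /=; lia.
- by rewrite /code /=; lia.
move=> e; have iB (l : X) : (l.+1 < B)%N by rewrite ltnS.
have ei : i = i'.
  have := congr1 (modn^~ B) e; rewrite !modnMDl !modn_small // => -[].
  exact: val_inj.
move: e; rewrite ei => /addIn /eqP; rewrite eqn_pmul2r // => /eqP /IH ->.
by [].
Qed.

Lemma code_lt w : (code w < B ^ size w)%N.
Proof.
elim/last_ind: w => // w i IH; rewrite code_rcons size_rcons expnSr.
have := ltn_ord i; rewrite /B in IH *; nia.
Qed.

Lemma code_ge w : w <> [::] -> (B ^ (size w).-1 <= code w)%N.
Proof.
elim/last_ind: w => // w i IH _; rewrite code_rcons size_rcons /=.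
case: w IH => [|j w] IH; first by rewrite expn0; lia.
have := IH ltac:(done); rewrite /= expnS /B; nia.
Qed.

Lemma code_size a b : (size a < size b)%N -> (code a < code b)%N.
Proof.
move=> lt; apply: leq_trans (code_lt a) _; apply: leq_trans (code_ge _).
  by rewrite leq_pexp2l //; lia.
by case: b lt.
Qed.

Lemma code_mono a b u w : (code u < code w)%N -> (code (a ++ u ++ b) < code (a ++ w ++ b))%N.
Proof.
move=> lt; case: (ltngtP (size u) (size w)) => [s|s|s].
- by apply: code_size; rewrite !size_cat; lia.
- by have := code_size s; lia.
- rewrite !code_cat !size_cat s ltn_add2l ltn_add2r ltn_pmul2r //.
  by rewrite expn_gt0.
Qed.

Variables (R : idomainType) (M : zmodType) (act : R -> M -> M) (N Z : set M).
Hypothesis H : domain_action act N Z.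
Variable ev : seq X -> M.
Hypothesis Nev : forall w, N (ev w).
Hypothesis compat : forall (T : finType) (r : T -> R) (w : T -> seq X) a b,
  Z (\sum_t act (r t) (ev (w t)))%R -> Z (\sum_t act (r t) (ev (a ++ w t ++ b)))%R.

(** Standard monomials up to denominators: a word is discarded once a nonzero multiple of it reduces
    to smaller words. *)
Definition normal_word (w : seq X) := ~ exists (T : finType) (f : T -> seq X),
  (forall t, (code (f t) < code w)%N) /\ rdep act Z (ev \o f) (ev w).

Lemma normal_factor a w b : normal_word (a ++ w ++ b) -> normal_word w.
Proof.
move=> nw [T [f [cf [p [p0 [r Zr]]]]]]; apply: nw.
exists T, (fun t => a ++ f t ++ b); split; first by move=> t; apply: code_mono.
exists p; split=> //; exists r.
pose r' o := (if o is Some t then - r t else p)%R.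
pose f' o := (if o is Some t then f t else w).
have := @compat _ r' f' a b; rewrite !big_option /= => cp.
have oppE (h : T -> seq X) :
   (\sum_t act (- r t) (ev (h t)) = - \sum_t act (r t) (ev (h t)))%R.
  rewrite -sumrN; apply: eq_bigr => t _; apply/eqP; rewrite -subr_eq0 opprK.
  rewrite -(dact_Dl H) // addNr; apply/eqP/(@addrI _ (act 0 (ev (h t)))%R).
  by rewrite -(dact_Dl H) ?addr0.
by move: cp; rewrite !oppE; apply.
Qed.

Lemma normal_free (T : finType) (f : T -> seq X) : injective f ->
  (forall t, normal_word (f t)) -> rfree act Z (ev \o f).
Proof.
move=> fi nf r Zr t; apply: contrapT => /eqP rt.
case: (@arg_maxnP _ t (fun s => r s != 0)%R (fun s => code (f s)) rt) => s rs smax.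
apply: (nf s).
pose A := [pred u | code (f u) < code (f s)]%N.
have act0l x : N x -> (act 0 x = 0)%R.
  by move=> Nx; apply: (@addrI _ (act 0 x)%R); rewrite -(dact_Dl H) ?addr0.
have actN q x : N x -> (act (- q) x = - act q x)%R.
  move=> Nx; apply/eqP; rewrite -subr_eq0 opprK.
  by rewrite -(dact_Dl H) // addNr act0l.
exists {u : T | u \in A}, (f \o val); split; first by case.
exists (r s); split=> //; exists (fun u => - r (val u))%R.
have E : (\sum_(u : {u : T | u \in A}) act (- r (val u)) (ev (f (val u))) =
          - \sum_(u | u != s) act (r u) (ev (f u)))%R.
  rewrite -(@big_sub _ _ _ _ A (fun u => act (- r u)%R (ev (f u)))) /= -sumrN.
  rewrite (bigID (fun u => r u != 0)%R) /= addrC big1 ?add0r; last first.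
    by move=> u /andP[_ /negPn /eqP ->]; rewrite oppr0 act0l.
  rewrite [RHS](bigID (fun u => r u != 0)%R) /= [X in _ = (_ + X)%R]big1 ?addr0; last first.
    by move=> u /andP[_ /negPn /eqP ->]; rewrite act0l ?oppr0.
  apply: eq_big => [u|u _]; last exact: actN.
  apply/andP/andP => -[h ru]; split=> //.
    by apply/eqP => us; move: h; rewrite us unfold_in /= ltnn.
  have le : (code (f u) <= code (f s))%N := smax u ru.
  rewrite unfold_in /= ltn_neqAle le andbT.
  by apply/eqP => /code_inj /fi us; case/eqP: h.
by rewrite /= E opprK -(bigD1 s (P := predT)).
Qed.

(** Normal words form a factor-closed language, small by the rank growth, and an algebraic equation
    for each word keeps its high powers from being normal. [bounded_language] bounds their length;
    the reduction of other words ends because codes decrease. *)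
Lemma words_finite D :
  (forall n (T : finType) (f : T -> seq X), injective f ->
     (forall t, (size (f t) <= n)%N) -> rfree act Z (ev \o f) -> (#|T| <= D * n.+1)%N) ->
  (forall w, w <> [::] ->
     exists n, rdep act Z (fun i : 'I_n => ev (wpow w i)) (ev (wpow w n))) ->
  exists L, forall w, rdep act Z (fun u : L.-bseq X => ev u) (ev w).
Proof.
move=> gr pow.
have [L LP] : exists L, forall w, normal_word w -> (size w <= L)%N.
  apply: (bounded_language (D := D)); first exact: normal_factor.
    by move=> n T f fi fP; apply: (gr n T f fi) => [t|]; [case: (fP t)|apply: normal_free => // t; case: (fP t)].
  move=> w w0; have [n dn] := pow w w0; exists n => nw; apply: nw.
  exists 'I_n, (fun i : 'I_n => wpow w i); split=> // i; apply: code_size.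
  by rewrite !size_wpow ltn_pmul2r //; case: w w0 {dn}.
exists L => w; have [c] := ubnP (code w); elim: c w => // c IH w lt.
case: (leqP (size w) L) => [le|gt]; first by have := @rdep_mem _ _ _ _ _ H _ (fun u : L.-bseq X => ev u) (Bseq le); apply.
have : ~ normal_word w by move/LP; lia.
move/contrapT => [T [f [cf df]]]; apply: (rdep_trans H _ _ _ df) => //= t.
by apply: IH; have := cf t; lia.
Qed.

End Language.

(** * Annihilators of simple modules *)

Lemma infinite_inj (T : choiceType) (S : set T) n :
  ~ finite_set S -> exists f : 'I_n -> T, injective f /\ forall i, S (f i).
Proof.
move=> nfin.
have [s [us ss Ss]] : exists s : seq T, [/\ uniq s, size s = n & forall x, x \in s -> S x].
  elim: n => [|n [s [us ss Ss]]]; first by exists [::].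
  have [x [Sx xs]] : exists x, S x /\ x \notin s.
    apply: contrapT => nx; apply: nfin; apply: (@sub_finite_set _ _ [set` s]); last exact: finite_seq.
    by move=> x Sx /=; apply/negPn/negP => xs; apply: nx; exists x.
  exists (x :: s); split=> /=; [by rewrite xs|by rewrite ss|].
  by move=> y; rewrite inE => /orP[/eqP->//|/Ss].
pose t := Tuple (introT eqP ss).
exists (tnth t); split; last by move=> i; apply/Ss/(mem_tnth i t).
move=> i j; have x0 := tnth t i; rewrite !(tnth_nth x0) /= => /eqP.
by rewrite nth_uniq ?ss // => /eqP /val_inj.
Qed.

(** * Amitsur's countability argument *)

Section Amitsur.
Variables (k : fieldType) (A : algType k) (W : nat -> set A) (b : nat -> nat).
Hypothesis Wall : forall x, exists n, W n x.
Hypothesis Wfin : forall n (T : finType) (x : T -> A),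
  (forall t, W n (x t)) -> kfree [set 0] x -> (#|T| <= b n)%N.

(** Uncountably many left inverses of c - l modulo P would put infinitely many into one
    finite-dimensional W n. A linear relation among them, multiplied by the product of the factors c
    - l, is a polynomial in c that lies in P. The filtration is abstract so that polynomial rings,
    filtered by degree, are covered too. *)
Lemma amitsur (P : set A) c : ideal2 P ->
  (forall q : {poly k}, q != 0 -> ~ P (horner_alg c q)) ->
  countable [set l : k | exists y, P (y * (c - l%:A) - 1)].
Proof.
move=> [Pl Pr] nalg.
have -> : [set l : k | exists y, P (y * (c - l%:A) - 1)] =
    \bigcup_(n in setT) [set l : k | exists2 y, W n y & P (y * (c - l%:A) - 1)].
  apply/seteqP; split=> [l [y Py]|l [n _ [y _ Py]]]; last by exists y.
  by have [n Vy] := Wall y; exists n => //; exists y.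
apply: bigcup_countable => // n _; apply: finite_set_countable; apply: contrapT => nfin.
have [l [linj /= lP]] := infinite_inj (b n).+1 nfin.
have /choice[y yP] : forall i, exists y, W n y /\ P (y * (c - (l i)%:A) - 1).
  by move=> i; have [y Vy Py] := lP i; exists y.
have : ~ kfree [set 0] y.
  by move=> fy; have := Wfin (fun i => (yP i).1) fy; rewrite card_ord ltnn.
move=> /existsNP[r /not_implyP[/= r0 /existsNP[j /eqP rj]]].
pose q : {poly k} := \sum_i r i *: \prod_(h | h != i) ('X - (l h)%:P).
apply: (nalg q).
  (* At l j, where r j is nonzero, only the j-th product survives. *)
  apply/eqP => /(congr1 (fun p => p.[l j])) /eqP; rewrite horner0 horner_sum (bigD1 j) //= [X in _ + X]big1 ?addr0.
    rewrite hornerZ mulf_eq0 (negPf rj) /= horner_prod prodf_seq_eq0 => /hasP[h _ /andP[hj]].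
    by rewrite hornerXsubC subr_eq0 (inj_eq linj) eq_sym (negPf hj).
  move=> i ij; rewrite hornerZ horner_prod (bigD1 j) /=; last by rewrite eq_sym.
  by rewrite hornerXsubC subrr mul0r mulr0.
pose Q := \prod_h ('X - (l h)%:P) : {poly k}.
have xE h : horner_alg c ('X - (l h)%:P) = c - (l h)%:A.
  by rewrite rmorphB /= horner_algX horner_algC.
have Pi i : P (y i * horner_alg c Q - horner_alg c (\prod_(h | h != i) ('X - (l h)%:P))).
  rewrite /Q (bigD1 i) //= rmorphM /= xE mulrA -[X in _ - X]mul1r -mulrBl.
  by apply: Pr; case: (yP i).
have e : horner_alg c q = - \sum_i r i *: (y i * horner_alg c Q - horner_alg c (\prod_(h | h != i) ('X - (l h)%:P))).
  rewrite -sumrN /q rmorph_sum /=.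
  have z : \sum_i r i *: (y i * horner_alg c Q) = 0.
    rewrite (eq_bigr (fun i => (r i *: y i) * horner_alg c Q)) => [|i _]; last by rewrite scalerAl.
    by rewrite -mulr_suml r0 mul0r.
  rewrite -[RHS]add0r -[X in X + _]z -big_split; apply: eq_bigr => i _ /=.
  by rewrite scalerBr opprB [RHS]addrC subrK -mul_polyC rmorphM /= horner_algC -scalerAl mul1r.
rewrite e; apply: lidealN => //; apply: lideal_sum => // i; exact: lidealZ.
Qed.

End Amitsur.

Section Modules.
Variables (k : fieldType) (A : algType k) (g : nat) (v : 'I_g -> A) (C : nat).
Hypothesis Vall : forall x, exists n, Vn v n x.
Hypothesis growth : forall n (T : finType) (x : T -> A),
  (forall t, Vn v n (x t)) -> kfree [set 0] x -> (#|T| <= C * n.+1 ^ 2)%N.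
Hypothesis kunc : ~ countable [set: k].

(** Maximality is expressed as simplicity of A / L: every nonzero vector generates it. *)
Definition lmax (L : set A) :=
  [/\ lideal L, ~ L 1 & forall x, ~ L x -> exists a, L (1 - a * x)].

(* The annihilator of the module A / L. *)
Definition core (L : set A) : set A := [set a | forall b, L (a * b)].

Lemma core_ideal2 L : lideal L -> ideal2 (core L).
Proof.
move=> [L0 LB LM]; split; last by move=> a x Lx b; rewrite -mulrA; apply: Lx.
by split=> [b|x y Lx Ly b|a x Lx b]; rewrite ?mul0r // ?mulrBl -?mulrA;
   [apply: LB|apply: LM].
Qed.

Lemma core_sub L : core L `<=` L.
Proof. by move=> a /(_ 1); rewrite mulr1. Qed.

Lemma ex_lmax (I : set A) : lideal I -> ~ I 1 -> exists L, lmax L /\ I `<=` L.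
Proof.
move=> Il I1.
(* [I] is adjoined so that the union of the empty chain is good as well. *)
pose good (X : set A) := lideal (I `|` X) /\ ~ (I `|` X) 1.
have [|X [[Ll L1] Xmax]] := @Zorn_bigcup A good.
  move=> F Fg tot.
  have com x y : (I `|` \bigcup_(X in F) X) x -> (I `|` \bigcup_(X in F) X) y ->
     exists J, [/\ lideal J, J x, J y & J `<=` I `|` \bigcup_(X in F) X].
    have FJ X : F X -> lideal (I `|` X) /\ I `|` X `<=` I `|` \bigcup_(X in F) X.
      by move=> FX; split; [case: (Fg X FX)|move=> z [|Xz]; [left|right; exists X]].
    case=> [Ix|[X FX Xx]] [Iy|[Y FY Yy]].
    - by exists I; split=> // z Iz; left.
    - by have [? ?] := FJ Y FY; exists (I `|` Y); split=> //; [left|right].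
    - by have [? ?] := FJ X FX; exists (I `|` X); split=> //; [right|left].
    - case: (tot X Y FX FY) => XY.
        by have [? ?] := FJ Y FY; exists (I `|` Y); split=> //; right=> //; apply: XY.
      by have [? ?] := FJ X FX; exists (I `|` X); split=> //; right=> //; apply: XY.
  split; last by case=> // -[X FX X1]; case: (Fg X FX) => _; apply; right.
  split; first by left; case: Il.
    by move=> x y Ux Uy; have [J [[_ JB _] Jx Jy JU]] := com x y Ux Uy; apply/JU/JB.
  by move=> a x Ux; have [J [[_ _ JM] Jx _ JU]] := com x x Ux Ux; apply/JU/JM.
have [L0 LB LM] := Ll.
exists (I `|` X); split; last by move=> x; left.
split=> // x Lx; apply: contrapT => nx.
pose L' := [set y | exists a, (I `|` X) (y - a * x)].
have LL' y : (I `|` X) y -> L' y by move=> Ly; exists 0; rewrite mul0r subr0.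
apply: (Xmax L').
  split=> [y Xy|sub]; first by apply: LL'; right.
  by apply: Lx; right; apply: sub; exists 1; rewrite mul1r subrr; left; case: Il.
have -> : good L' = (lideal L' /\ ~ L' 1).
  rewrite /good; suff -> : I `|` L' = L' by [].
  by apply/seteqP; split=> y; [case=> // Iy; apply: LL'; left|right].
split=> [|[a La]]; last by apply: nx; exists a.
split; first exact: LL'.
  move=> y z [a La] [b Lb]; exists (a - b); have := LB _ _ La Lb.
  by rewrite mulrBl !opprD !opprK addrACA.
by move=> a y [b Lb]; exists (a * b); rewrite -mulrA -mulrBr; apply: LM.
Qed.

(** Longer words reduce by peeling off the first letter, since left multiplication preserves [L]. *)
Lemma stable_growth (L : set A) n : lideal L ->
  (forall x, Vn v n.+1 x -> exists2 y, Vn v n y & L (x - y)) ->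
  forall x, exists2 y, Vn v n y & L (x - y).
Proof.
move=> Ll st x; have [m Vx] := Vall x; elim: m x Vx => [|m IH] x Vx.
  by exists x; [apply: Vn_mono Vx|rewrite subrr; case: Ll].
have [c [y [Vy ->]]] := Vn_S Vx.
have /choice[z zP] : forall i, exists z, Vn v n z /\ L (y i - z).
  by move=> i; have [z ? ?] := IH _ (Vy i); exists z.
have [|w Vw Lw] := st (c%:A + \sum_i v i * z i).
  apply: VnD; first by apply: VnZ; apply: Vn1.
  apply: Vn_sum => i; rewrite -add1n; apply: VnM; last by case: (zP i).
  by rewrite -[v i]mulr1 -(ev_nil v) -ev_cons; apply: Vn_ev.
exists w => //; rewrite -[_ - w](subrKA (c%:A + \sum_i v i * z i)).
apply: lidealD => //; rewrite opprD addrACA subrr add0r -sumrB.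
apply: lideal_sum => // i; rewrite -mulrBr; case: Ll => _ _; apply.
by case: (zP i).
Qed.

Lemma infinite_growth (L : set A) : lideal L -> ~ L 1 ->
  (forall n, ~ forall x, exists2 y, Vn v n y & L (x - y)) ->
  forall n, exists u : 'I_n.+1 -> A, (forall t, Vn v n (u t)) /\ kfree L u.
Proof.
move=> Ll L1 inf n.
have HL := lideal_kact Ll.
have [T [u [cT Vu fu]]] : exists (T : finType) (u : T -> A),
    [/\ #|T| = n.+1, forall t, Vn v n (u t) & kfree L u].
  elim: n => [|n [T [u [cT Vu fu]]]].
    exists unit, (fun=> 1); split=> [|_|]; [by rewrite card_unit|exact: Vn1|].
    move=> r; rewrite (big_pred1 tt) => [Lr [] |[]//]; apply: contrapT => /eqP r0.
    by apply: L1; have := lidealZ (r tt)^-1 Ll Lr; rewrite scalerA mulVf // scale1r.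
  have [y [Vy ny]] : exists y, Vn v n.+1 y /\ ~ kdep L u y.
    apply: contrapT => ny; apply: (inf n); apply: stable_growth => // x Vx.
    have [c Lc] : kdep L u x by apply: contrapT => nx; apply: ny; exists x.
    by exists (\sum_t c t *: u t) => //; apply: Vn_sum => t; apply: VnZ.
  exists (option T), (fun o => if o is Some t then u t else y); split.
  - by rewrite card_option cT.
  - by case=> [t|//]; apply: Vn_mono (Vu t).
  - by apply: (rfree_option HL) => //; rewrite kdep_lideal.
pose f (i : 'I_n.+1) : T := enum_val (cast_ord (esym cT) i).
exists (u \o f); split=> [t|]; first exact: Vu.
apply: (rfree_inj HL) => //.
by move=> i j /enum_val_inj /cast_ord_inj.
Qed.

Section Cofinite.
Variables (L : set A) (D : nat).
Hypothesis Lm : lmax L.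
Hypothesis lgr : linear_growth v (core L) D.
Hypothesis inf : forall n, ~ forall x, exists2 y, Vn v n y & L (x - y).

Let Ll : lideal L. Proof. by case: Lm. Qed.

(** By the density theorem this is linear independence of the vectors s i of A / L over the
    endomorphism division ring of this simple module. *)
Definition ann_indep (s : nat -> A) m := forall i, (i < m)%N ->
  exists t, (forall j, (j < i)%N -> L (t * s j)) /\ ~ L (t * s i).

(** The annihilator of s in A / L has infinite codimension because s generates A / L. *)
Lemma cyclic_growth s n : ~ L s ->
  exists u : 'I_n.+1 -> A, (forall t, Vn v n (u t)) /\ kfree L (fun t => u t * s).
Proof.
move=> Ls; have [L0 LB LM] := Ll.
have Lsl : lideal [set a | L (a * s)].
  by split=> [|x y|a x] /=; rewrite ?mul0r // ?mulrBl -?mulrA; [apply: LB|apply: LM].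
have [|n0 st|u [Vu fu]] := infinite_growth Lsl _ _ n.
- by rewrite /= mul1r.
- have [j Vs] := Vall s; apply: (inf (n := n0 + j)) => x.
  have [a La] : exists a, L (1 - a * s) by case: Lm => _ _; apply.
  have [y Vy /= Ly] := st (x * a).
  exists (y * s); first exact: VnM.
  have -> : x - y * s = x * (1 - a * s) + (x * a - y) * s.
    by rewrite mulrBr mulr1 mulrBl mulrA addrA subrK.
  by apply: lidealD => //; apply: LM.
exists u; split=> // r Lr; apply: fu => /=; rewrite mulr_suml.
by rewrite (eq_bigr (fun t => r t *: (u t * s))) // => t _; rewrite scalerAl.
Qed.

(** Multiplying t i by n + 1 elements from [cyclic_growth] for each i gives m (n + 1) elements,
    independent modulo the core by triangularity; linear growth then bounds m. *)
Lemma ann_indep_bound s m : ann_indep s m -> (m <= D)%N.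
Proof.
move=> ind; have [L0 LB LM] := Ll.
have /choice[t tP] : forall i : 'I_m, exists t,
    (forall j, (j < i)%N -> L (t * s j)) /\ ~ L (t * s i) by move=> i; apply: ind.
have /choice[c cP] : forall i, exists c, Vn v c (t i) by move=> i; apply: Vall.
(* For this n the inequality m (n + 1) <= D (n + c0 + 1) already fails at m = D + 1. *)
pose c0 := (\max_i c i)%N; pose n := (D * c0.+1)%N.
have /choice[u uP] : forall i, exists u : 'I_n.+1 -> A, (forall a, Vn v n (u a)) /\
    kfree L (fun a => u a * (t i * s i)).
  by move=> i; apply: cyclic_growth; case: (tP i).
pose w (p : 'I_m * 'I_n.+1) := u p.1 p.2 * t p.1.
have Vw p : Vn v (n + c0) (w p).
  apply: VnM; first by case: (uP p.1).
  by apply: Vn_mono (cP p.1); apply: leq_bigmax.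
have fw : kfree (core L) w.
  move=> r Lr [i]; have [d] := ubnP (nat_of_ord i); elim: d i => // d IH i /ltnSE lei.
  have := Lr (s i); rewrite mulr_suml.
  rewrite (eq_bigr (fun p => r (p.1, p.2) *: w (p.1, p.2) * s i)); last by case.
  rewrite -(pair_bigA _ (fun j a => r (j, a) *: w (j, a) * s i)) /= (bigD1 i) //= => Li.
  have [_ fi] := uP i; apply: fi => /=.
  rewrite -[X in L X](addrK (\sum_(j < m | j != i) \sum_(a < n.+1) r (j, a) *: w (j, a) * s i)).
  apply: LB; last first.
    apply: big_ind => [//|x y Lx Ly|j ji]; first exact: lidealD.
    apply: lideal_sum => // a.
    case: (ltngtP j i) => [lt|gt|/val_inj e]; last by rewrite e eqxx in ji.
      by rewrite (IH j) ?scale0r ?mul0r // (leq_trans lt).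
    rewrite -scalerAl; apply: lidealZ => //; rewrite /w /= -mulrA; apply: LM.
    by case: (tP j) => + _; apply.
  rewrite (eq_bigr (fun a => r (i, a) *: w (i, a) * s i)) // => a _.
  by rewrite -scalerAl /w /= mulrA.
have := lgr Vw fw; rewrite card_prod !card_ord /n.
case: (leqP m D) => // lt; nia.
Qed.

(** A family of maximal length embeds A / core L in a finite power of A / L. *)
Lemma ann_indep_max : exists s m, ann_indep s m /\
  forall t, (forall j, (j < m)%N -> L (t * s j)) -> core L t.
Proof.
pose Q m := `[< exists s, ann_indep s m >].
have exQ : exists m, Q m by exists 0%N; apply/asboolP; exists (fun=> 0) => i.
have bQ m : Q m -> (m <= D)%N by move/asboolP => [s /ann_indep_bound].
case: (ex_maxnP exQ bQ) => m /asboolP[s sP] mmax; exists s, m; split=> // t tP b.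
apply: contrapT => nb.
suff : Q m.+1 by move/mmax; rewrite ltnn.
apply/asboolP; exists (fun i => if i == m then b else s i) => i; rewrite ltnS leq_eqVlt.
case/orP => [/eqP ->|lt].
  exists t; rewrite eqxx; split=> // j lt; rewrite ltn_eqF //; exact: tP.
have [t' [t1 t2]] := sP i lt; exists t'; rewrite ltn_eqF //; split=> // j ltj.
by rewrite ltn_eqF ?(ltn_trans ltj) //; apply: t1.
Qed.

Lemma core_algebraic_finite : ~ forall x, exists q : {poly k}, q != 0 /\ core L (horner_alg x q).
Proof.
move=> alg; have Pi := core_ideal2 Ll; have [Pl Pr] := Pi; have [P0 PB PM] := Pl.
have HP := lideal_kact Pl.
have evX w i : ev v (wpow w i) = ev v w ^+ i.
  by elim: i => [|i IH]; rewrite ?ev_nil // wpowS ev_cat IH exprS.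
have algX x (a : k) i : horner_alg x (a *: 'X^i) = a *: x ^+ i.
  by rewrite -mul_polyC rmorphM rmorphXn /= horner_algC horner_algX mulr_algl.
have [||||L0 dL0] := @words_finite g k A (fun c x => c *: x) setT (core L) HP (ev v) _ _ D.
- by [].
- move=> T r w a b h.
  have {h} : core L (ev v a * (\sum_t r t *: ev v (w t)) * ev v b) := Pr _ _ (PM _ _ h).
  rewrite mulr_sumr mulr_suml; congr (core L _); apply: eq_bigr => t _.
  by rewrite !ev_cat -scalerAr -scalerAl mulrA.
- move=> n T f _ sf; apply: lgr => t; exact: Vn_ev.
- move=> w _; have [q [q0 Pq]] := alg (ev v w).
  exists (size q).-1; exists (lead_coef q); rewrite lead_coef_eq0; split=> //.
  exists (fun i : 'I_(size q).-1 => - q`_i); rewrite -sumrN.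
  move: Pq; rewrite -[q in horner_alg _ q]coefK poly_def linear_sum /=.
  have -> : size q = (size q).-1.+1 by rewrite prednK // lt0n size_poly_eq0.
  rewrite big_ord_recr /= addrC; congr (core L (_ + _)).
    by rewrite algX evX lead_coefE.
  apply: eq_bigr => i _; rewrite algX evX.
  by rewrite scaleNr opprK.
apply: (inf (n := L0)) => x; have [n Vx] := Vall x; have [c ->] := VnP Vx.
have /choice[d dP] : forall w : n.-bseq 'I_g, exists d : L0.-bseq 'I_g -> k,
    core L (ev v w - \sum_u d u *: ev v u).
  by move=> w; have /(kdep_lideal _ _ Pl) := dL0 w.
exists (\sum_w c w *: \sum_u d w u *: ev v u).
  apply: Vn_sum => w; apply/VnZ/Vn_sum => u; apply/VnZ/Vn_ev; exact: size_bseq.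
apply: core_sub; rewrite -sumrB; apply: lideal_sum => // w.
by rewrite -scalerBr; apply: (lidealZ _ Pl).
Qed.

End Cofinite.

(* If all elements are algebraic modulo the core, then the words are bounded.  If
   [x] is transcendental, Amitsur's lemma makes A (x - l) + core L proper for
   uncountably many [l]; a simple quotient is a subquotient of A / core L, hence
   isomorphic to A / L, where [x] has therefore too many eigenvalues. *)
Lemma core_cofinite L D : lmax L -> linear_growth v (core L) D ->
  exists n, forall x, exists2 y, Vn v n y & L (x - y).
Proof.
move=> Lm lgr; apply: contrapT => /forallNP inf.
have [Ll L1 Lmx] := Lm; have [L0 LB LM] := Ll.
have Pi := core_ideal2 Ll; have [Pl Pr] := Pi.
have := core_algebraic_finite Lm lgr inf => /existsNP[x /forallNP xalg].
have nalg q : q != 0 -> ~ core L (horner_alg x q) by move=> q0 Pq; apply: (xalg q).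
have [s [m [sind smax]]] := ann_indep_max Lm lgr inf.
have eig l : ~ (exists y, core L (y * (x - l%:A) - 1)) ->
    exists t, ~ L t /\ L ((x - l%:A) * t).
  move=> nl.
  pose I := [set z | exists y, core L (z - y * (x - l%:A))].
  have [|[y Iy]|M [[Ml M1 Mm] IM]] := @ex_lmax I.
  - split; first by exists 0; rewrite mul0r subr0; case: Pl.
      move=> z1 z2 [y1 P1] [y2 P2]; exists (y1 - y2); have [_ PB _] := Pl.
      have := PB _ _ P1 P2; set w := x - l%:A.
      by rewrite mulrBl !opprD !opprK addrACA.
    by move=> a z [y Py]; exists (a * y); rewrite -mulrA -mulrBr; case: Pl => _ _; apply.
  - by apply: nl; exists y; rewrite -opprB; exact: (lidealN Pl Iy).
  have [M0 MB MM] := Ml.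
  have PM z : core L z -> M z by move=> Pz; apply: IM; exists 0; rewrite mul0r subr0.
  have xM : M (x - l%:A) by apply: IM; exists 1; rewrite mul1r subrr; case: Pl.
  (* K 0 is A and K m lies in the core, so some step from K i to K i.+1 enters M. There A / M occurs
     as a subquotient and is compared with A / L through s i. *)
  pose K i := [set t | forall j, (j < i)%N -> L (t * s j)].
  have KS i t : K i t -> L (t * s i) -> K i.+1 t.
    by move=> Kt Lt j; rewrite ltnS leq_eqVlt => /orP[/eqP->|/Kt].
  have KM i a t : K i t -> K i (a * t) by move=> Kt j ij; rewrite -mulrA; apply/LM/Kt.
  have KB i t u : K i t -> K i u -> K i (t - u).
    by move=> Kt Ku j ij; rewrite mulrBl; apply: LB; [apply: Kt|apply: Ku].
  have [i [nKi Ki]] : exists i, ~ K i `<=` M /\ K i.+1 `<=` M.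
    apply: contrapT => ni.
    have Kn i : ~ K i `<=` M.
      elim: i => [sub|i IH sub]; first by apply: M1; apply: sub.
      by apply: ni; exists i.
    by apply: (Kn m) => t Kt; apply/PM/smax.
  have [e0 /not_implyP[Ke0 nMe0]] : exists t, ~ (K i t -> M t) by apply/existsNP.
  have [a Ma] := Mm _ nMe0.
  pose e := a * e0.
  have Ke : K i e by apply: KM.
  have nMe : ~ M e by move=> Me; apply: M1; rewrite -(subrK e 1); apply: lidealD.
  exists (e * s i); split.
    by move=> Le; apply: nMe; apply/Ki/KS.
  (* If (x - l) e s_i were nonzero in A / L, some b would send it to 1. Then e - e s_i b (x - l) e
     lies in K i.+1, hence in M; since (x - l) e lies in M, so would e. *)
  rewrite mulrA; apply: contrapT => /Lmx[b].
  have Mxe : M ((x - l%:A) * e).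
    rewrite -[_ * e](subKr (x - l%:A)); apply: MB => //.
    by rewrite -{1}[x - _]mulr1 -mulrBr; apply: MM.
  move=> Lb; apply: nMe.
  rewrite -[e](subrK (e * s i * b * ((x - l%:A) * e))); apply: lidealD => //; last exact: MM.
  apply: (Ki); apply: (KS i); first exact: (KB i _ _ Ke (KM i _ _ (KM i _ _ Ke))).
  have -> : (e - e * s i * b * ((x - l%:A) * e)) * s i = e * s i * (1 - b * ((x - l%:A) * e * s i)).
    by rewrite mulrBl mulrBr mulr1 !mulrA.
  exact: LM.
have cnt := amitsur Vall growth Pi nalg.
have nfin : ~ finite_set [set l : k | ~ exists y, core L (y * (x - l%:A) - 1)].
  move=> /finite_set_countable fin; apply: kunc.
  set S := [set l : k | exists y, core L (y * (x - l%:A) - 1)] in cnt.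
  have -> : [set: k] = S `|` [set l : k | ~ S l].
    by apply/seteqP; split=> l // _; case: (pselect (S l)); [left|right].
  by rewrite -bigcup2E; apply: bigcup_countable => // -[|[|n]] _ //=; apply: countable0.
have [l [linj lP]] := infinite_inj D.+1 nfin.
have /choice[t tP] : forall i, exists t, ~ L t /\ L ((x - (l i)%:A) * t).
  by move=> i; apply: eig; apply: lP.
(* Polynomials in x separate eigenvectors of distinct eigenvalues, so D + 1 of them are too many. *)
suff /(ann_indep_bound Lm lgr inf) : ann_indep L (fun i => t (inord i)) D.+1 by rewrite ltnn.
move=> i ltiD.
have horE h (q : {poly k}) : exists z, horner_alg x q * t h = q.[l h] *: t h + z * ((x - (l h)%:A) * t h).
  have [r ->] : exists r, q = r * ('X - (l h)%:P) + q.[l h]%:P.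
    have /factor_theorem[r rE] : root (q - q.[l h]%:P) (l h).
      by rewrite /root hornerD hornerN hornerC subrr.
    by exists r; rewrite -rE subrK.
  exists (horner_alg x r); rewrite hornerD hornerM hornerXsubC subrr mulr0 add0r !hornerC.
  rewrite rmorphD rmorphM rmorphB /= horner_algX !horner_algC mulrDl -scalerAl mul1r.
  by rewrite addrC -mulrA.
pose q : {poly k} := \prod_(j < D.+1 | (j < i)%N) ('X - (l j)%:P).
exists (horner_alg x q); split.
  move=> j ltji; have [z ->] := horE (inord j) q.
  have -> : q.[l (inord j)] = 0.
    rewrite horner_prod (bigD1 (inord j)) /=; last by rewrite inordK // (ltn_trans ltji).
    by rewrite hornerXsubC subrr mul0r.
  by rewrite scale0r add0r; apply: LM; case: (tP (inord j)).
have [z ->] := horE (inord i) q; move=> Lq.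
have q0 : q.[l (inord i)] != 0.
  rewrite horner_prod; apply/prodf_neq0 => j ltji; rewrite hornerXsubC subr_eq0.
  by apply/eqP => /linj e; move: ltji; rewrite -e inordK // ltnn.
case: (tP (inord i)) => nt Lt; apply: nt.
have := LB _ _ Lq (LM z _ Lt); rewrite addrK => /(lidealZ (q.[l (inord i)])^-1 Ll).
by rewrite scalerA mulVf // scale1r.
Qed.

End Modules.

(** * The quotient module A / L *)

Section QuotientModule.
Local Open Scope quotient_scope.
Variables (A : nzRingType) (L : set A).
Hypothesis Ll : lideal L.

Definition lpred : {pred A} := fun x => `[< L x >].

Fact lpred_closed : GRing.zmod_closed lpred.
Proof.
case: Ll => L0 LB _; split; first exact/asboolP.
by move=> x y /asboolP Lx /asboolP Ly; apply/asboolP/LB.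
Qed.

HB.instance Definition _ := GRing.isZmodClosed.Build A lpred lpred_closed.

Definition qmod := Quotient.quot lpred.
HB.instance Definition _ := GRing.Zmodule.on qmod.

Definition qpi (a : A) : qmod := \pi_(Quotient.quot lpred) a.
Definition qscale (a : A) (x : qmod) : qmod := qpi (a * repr x).

Lemma qpi_eq x y : qpi x = qpi y <-> L (x - y).
Proof.
split=> [/eqP|Lxy]; first by rewrite /qpi -Quotient.idealrBE => /asboolP.
by apply/eqP; rewrite /qpi -Quotient.idealrBE; apply/asboolP.
Qed.

Lemma qpi_surj (x : qmod) : exists a, x = qpi a.
Proof. by exists (repr x); rewrite /qpi reprK. Qed.

Lemma qpiD x y : qpi (x + y) = qpi x + qpi y.
Proof. by rewrite /qpi; exact: raddfD. Qed.

Lemma qscaleE a x : qscale a (qpi x) = qpi (a * x).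
Proof.
have /qpi_eq e : qpi (repr (qpi x)) = qpi x by rewrite /qpi reprK.
by apply/qpi_eq; rewrite -mulrBr; case: Ll => _ _; apply.
Qed.

Fact qscaleA a b x : qscale a (qscale b x) = qscale (a * b) x.
Proof. by have [y ->] := qpi_surj x; rewrite !qscaleE mulrA. Qed.
Fact qscale1 : left_id 1 qscale.
Proof. by move=> x; have [y ->] := qpi_surj x; rewrite qscaleE mul1r. Qed.
Fact qscaleDr : right_distributive qscale +%R.
Proof.
move=> a x y; have [x' ->] := qpi_surj x; have [y' ->] := qpi_surj y.
by rewrite -qpiD !qscaleE mulrDr qpiD.
Qed.
Fact qscaleDl x : {morph qscale^~ x : a b / a + b}.
Proof. by move=> a b; have [y ->] := qpi_surj x; rewrite !qscaleE mulrDl qpiD. Qed.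

HB.instance Definition _ := GRing.Zmodule_isLmodule.Build A qmod
  qscaleA qscale1 qscaleDr qscaleDl.

Lemma qmodZ a x : a *: qpi x = qpi (a * x).
Proof. exact: qscaleE. Qed.

Lemma qpi0 : qpi 0 = 0.
Proof. by apply: (@addrI _ (qpi 0)); rewrite -qpiD !addr0. Qed.

End QuotientModule.

Lemma core0_primitive (k : fieldType) (A : algType k) (L : set A) : lmax L -> core L = [set 0] -> primitive_ring A.
Proof.
move=> [Ll L1 Lm] cL; exists (qmod Ll).
have z x : qpi Ll x = 0 <-> L x by rewrite -(qpi0 Ll) qpi_eq subr0.
split; last first.
  move=> a az; suff : core L a by rewrite cL.
  by move=> b; apply/z; rewrite -qmodZ.
split; first by exists (qpi Ll 1) => /z.
move=> N [N0 Nl]; case: (pselect (N = [set 0])) => [->|nN]; [by left|right].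
apply/seteqP; split=> // y _.
have [x [Nx x0]] : exists x, N x /\ x <> 0.
  apply: contrapT => nx; apply: nN; apply/seteqP; split=> [x Nx|_ ->].
    by apply: contrapT => x0; apply: nx; exists x.
  by have := N0; rewrite inE.
have [a e] := qpi_surj x; have [b ->] := qpi_surj y.
have [|c Lc] := Lm a; first by move/z; rewrite -e.
have NE u w : N u -> N w -> forall d : A, N (d *: u + w).
  by move=> Nu Nw d; have := Nl d u w; rewrite !inE => /(_ Nu Nw).
have := NE x 0 Nx _ (b * c); rewrite addr0 e qmodZ.
have -> : qpi Ll (b * c * a) = qpi Ll b.
  apply/qpi_eq; rewrite -[X in _ - X]mulr1 -mulrA -mulrBr -opprB mulrN.
  by apply: lidealN => //; have [_ _ LM] := Ll; apply: LM.
by apply; have := N0; rewrite inE.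
Qed.

(** * Matrix representations *)

(** A subspace of largest dimension inside [S] exhausts it. *)
Lemma subspace_vs (K : fieldType) (V : vectType K) (S : set V) :
  S 0 -> (forall x y, S x -> S y -> S (x + y)) -> (forall c x, S x -> S (c *: x)) ->
  exists U : {vspace V}, forall x, x \in U <-> S x.
Proof.
move=> S0 SD SZ.
pose Q m := `[< exists U : {vspace V}, \dim U = m /\ forall x, x \in U -> S x >].
have exQ : exists m, Q m.
  exists 0%N; apply/asboolP; exists 0%VS; rewrite dimv0; split=> // x.
  by rewrite memv0 => /eqP ->.
have bQ m : Q m -> (m <= \dim {:V})%N by move=> /asboolP[U [<- _]]; apply/dimvS/subvf.
case: (ex_maxnP exQ bQ) => m /asboolP[U [dU US]] mmax; exists U => x; split; first exact: US.
move=> Sx; apply: contrapT => /negP xU.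
have UU' : (U <= U + <[x]>)%VS := addvSl _ _.
have : Q (\dim (U + <[x]>)%VS).
  apply/asboolP; exists (U + <[x]>)%VS; split=> // y /memv_addP[u uU [z /vlineP[c ->] ->]].
  by apply: SD; [apply: US|apply: SZ].
move/mmax; rewrite -dU => le; have := dimv_leqif_eq UU'; case=> _; rewrite eqn_leq le andbT dimvS // => /esym/eqP e.
by move: xU; rewrite e => /negP; apply; rewrite (subvP (addvSr U <[x]>)) ?memv_line.
Qed.

Lemma subspace_mx (K : fieldType) n (S : set 'rV[K]_n) :
  S 0 -> (forall x y, S x -> S y -> S (x + y)) -> (forall c x, S x -> S (c *: x)) ->
  exists M : 'M[K]_n, forall x, (x <= M)%MS <-> S x.
Proof.
move=> S0 SD SZ.
pose Q m := `[< exists M : 'M[K]_n, \rank M = m /\ forall x : 'rV_n, (x <= M)%MS -> S x >].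
have exQ : exists m, Q m.
  exists 0%N; apply/asboolP; exists 0; rewrite mxrank0; split=> // x.
  by rewrite submx0 => /eqP ->.
have bQ m : Q m -> (m <= n)%N by move=> /asboolP[U [<- _]]; apply: rank_leq_row.
case: (ex_maxnP exQ bQ) => m /asboolP[U [dU US]] mmax; exists U => x; split; first exact: US.
move=> Sx; apply: contrapT => /negP xU.
have : Q (\rank (U + x)%MS).
  apply/asboolP; exists (U + x)%MS; split=> // y /sub_addsmxP[[u z] /= ->].
  apply: SD; first by apply: US; rewrite submxMl.
  by rewrite [z]mx11_scalar mul_scalar_mx; apply: SZ.
move/mmax; rewrite -dU => le; have := mxrank_leqif_sup (addsmxSl U x).
case=> _; rewrite eqn_leq le andbT mxrankS ?addsmxSl // => /esym.
by rewrite addsmx_sub submx_refl (negPf xU).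
Qed.

Section Points.
Variables (k : fieldType) (A : algType k) (g : nat) (v : 'I_g -> A).
Variables (K : fieldType) (iota : {rmorphism k -> K}).
Hypothesis Vall : forall x, exists n, Vn v n x.

(* [rep_irr] replaces irreducibility: no matrix coefficient vanishes identically. *)
Record rep (d : nat) (rho : A -> 'M[K]_d) : Prop := Rep {
  rep_pos : (0 < d)%N;
  rep1 : rho 1 = 1%:M;
  repD : forall x y, rho (x + y) = rho x + rho y;
  repM : forall x y, rho (x * y) = rho x *m rho y;
  repZ : forall c x, rho (c *: x) = iota c *: rho x;
  rep_irr : forall (xi : 'rV_d) (w : 'cV_d), xi != 0 -> w != 0 ->
    exists x, xi *m rho x *m w != 0 }.

Lemma ex_coord (L : set A) (N : nat) (u : 'I_N -> A) : lideal L -> kfree L u ->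
  (forall x, kdep L u x) -> exists cd : A -> 'cV[k]_N,
  [/\ forall x y, cd (x + y) = cd x + cd y, forall c x, cd (c *: x) = c *: cd x,
      forall x, cd x = 0 <-> L x & forall j, cd (u j) = delta_mx j 0].
Proof.
move=> Ll fu du; have [L0 LB LM] := Ll.
have /choice[c cP] := du.
pose cd x : 'cV[k]_N := \col_i c x i; exists cd.
have uniq x (e : 'I_N -> k) : L (x - \sum_i e i *: u i) -> cd x = \col_i e i.
  move=> Le; apply/colP => i; rewrite !mxE; apply/eqP; rewrite -subr_eq0; apply/eqP.
  apply: (fu (fun i => c x i - e i)) => /=.
  have -> : \sum_i (c x i - e i) *: u i = (x - \sum_i e i *: u i) - (x - \sum_i c x i *: u i).
    rewrite opprB [RHS]addrC addrA subrK -sumrB.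
    by apply: eq_bigr => i0 _; rewrite scalerBl.
  exact: LB.
split.
- move=> x y; rewrite (uniq _ (fun i => c x i + c y i)); first by apply/colP => i; rewrite !mxE.
  rewrite (eq_bigr (fun i => c x i *: u i + c y i *: u i)) => [|i _]; last by rewrite scalerDl.
  by rewrite big_split opprD addrACA; apply: lidealD.
- move=> a x; rewrite (uniq _ (fun i => a * c x i)); first by apply/colP => i; rewrite !mxE.
  rewrite (eq_bigr (fun i => a *: (c x i *: u i))) => [|i _]; last by rewrite scalerA.
  by rewrite -scaler_sumr -scalerBr; apply: lidealZ.
- move=> x; split=> [cx|Lx].
    have := cP x; rewrite big1 ?subr0 // => i _.
    by have := congr1 (fun M : 'cV_N => M i 0) cx; rewrite !mxE => ->; rewrite scale0r.
  rewrite (uniq x (fun=> 0)); first by apply/colP => i; rewrite !mxE.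
  by rewrite big1 ?subr0 // => i _; rewrite scale0r.
- move=> j; rewrite (uniq _ (fun i => (i == j)%:R)).
    by apply/colP => i; rewrite !mxE eqxx andbT.
  rewrite (bigD1 j) //= eqxx scale1r big1 ?addr0 ?subrr // => i /negPf ->.
  by rewrite scale0r.
Qed.

Lemma cofinite_basis (L : set A) n D : lideal L -> linear_growth v L D ->
  (forall x, exists2 y, Vn v n y & L (x - y)) ->
  exists N (u : 'I_N -> A), kfree L u /\ forall x, kdep L u x.
Proof.
move=> Ll lgr cof; have HL := lideal_kact Ll.
have [T [u [Vu fu du]]] := @rfree_max _ _ _ _ _ HL (Vn v n) (D * n.+1)%N (fun _ _ => I)
  (fun T x Vx fx => lgr n T x Vx fx).
exists #|T|, (u \o enum_val); split; first by apply: (rfree_inj HL) => //; apply: enum_val_inj.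
move=> x; have [y Vy Lxy] := cof x; apply/kdep_lideal => //.
apply: (rdepZ HL _ Lxy) => //.
apply: (rdep_trans HL _ _ _ (du y Vy)) => // t.
by rewrite -[t]enum_rankK; apply: (rdep_mem HL (x := u \o enum_val)).
Qed.

(** Over K the module A / L may become reducible; an invariant row space of least positive dimension
    has no vanishing matrix coefficients. Simplicity over k keeps the kernel from growing. *)
Lemma ex_rep (L : set A) n D : lmax L -> linear_growth v L D ->
  (forall x, exists2 y, Vn v n y & L (x - y)) ->
  exists (d : nat) (rho : A -> 'M[K]_d), rep rho /\ forall a, rho a = 0 <-> core L a.
Proof.
move=> Lm lgr cof; have [Ll L1 Lmx] := Lm; have [L0 LB LM] := Ll.
have [N [u [fu du]]] := cofinite_basis Ll lgr cof.
have [cd [cdD cdZ cd0 cdu]] := ex_coord Ll fu du.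
have cdB x y : cd (x - y) = cd x - cd y by rewrite -scaleN1r cdD cdZ scaleN1r.
pose s a : 'M[k]_N := \matrix_(i, j) cd (a * u j) i 0.
have scd a x : s a *m cd x = cd (a * x).
  have [c Lc] := du x.
  have E y : cd (y * x) = \sum_j c j *: cd (y * u j).
    apply/eqP; rewrite -subr_eq0; apply/eqP.
    have -> : \sum_j c j *: cd (y * u j) = cd (y * \sum_j c j *: u j).
      have cd00 : cd 0 = 0 by apply/cd0.
      rewrite mulr_sumr (big_morph cd cdD cd00); apply: eq_bigr => j _.
      by rewrite -scalerAr cdZ.
    by rewrite -cdB -mulrBr; apply/cd0/LM.
  rewrite E -[x]mul1r E mulmx_sumr; apply: eq_bigr => j _; rewrite mul1r cdu -scalemxAr.
  by congr (_ *: _); apply/colP => i; rewrite -colE !mxE.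
have colP' (M M' : 'M[k]_N) : (forall j, M *m cd (u j) = M' *m cd (u j)) -> M = M'.
  move=> e; apply/matrixP => i j; have := congr1 (fun M : 'cV_N => M i 0) (e j).
  by rewrite cdu -!colE !mxE.
have sM a b : s (a * b) = s a *m s b.
  by apply: colP' => j; rewrite -mulmxA !scd mulrA.
have sD a b : s (a + b) = s a + s b.
  by apply: colP' => j; rewrite mulmxDl !scd mulrDl cdD.
have sZ c a : s (c *: a) = c *: s a.
  by apply: colP' => j; rewrite -scalemxAl !scd -scalerAl cdZ.
have s1 : s 1 = 1%:M by apply: colP' => j; rewrite scd !mul1mx mul1r.
pose t a := map_mx iota (s a).
pose inv (U : 'M[K]_N) := forall a, (U *m t a <= U)%MS.
pose Q m := `[< (0 < m)%N /\ exists U : 'M[K]_N, \rank U = m /\ inv U >].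
have N0 : (0 < N)%N.
  case: N u fu du {cd cdD cdZ cd0 cdu cdB s scd colP' sM sD sZ s1 t inv Q} => // u _ du.
  by have [c] := du 1; rewrite big_ord0 subr0 => /L1.
have exQ : exists m, Q m.
  exists N; apply/asboolP; split=> //; exists 1%:M; rewrite mxrank1; split=> // a.
  by rewrite submx1.
case: (ex_minnP exQ) => r0 /asboolP[d0 [U [dU Uinv]]] dmin.
move: d0 dmin; rewrite -{}dU => d0 dmin.
set d := \rank U in d0 dmin *.
pose B := row_base U.
have Bf : row_free B by apply: row_base_free.
pose rho a := B *m t a *m pinvmx B.
have rhoB a : rho a *m B = B *m t a.
  rewrite mulmxKpV // eq_row_base; apply: submx_trans (Uinv a).
  by rewrite submxMr // eq_row_base.
have Binj m (X Y : 'M[K]_(m, d)) : X *m B = Y *m B -> X = Y by apply: row_free_inj.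
have tM a b : t (a * b) = t a *m t b by rewrite /t sM map_mxM.
have rho1 : rho 1 = 1%:M by apply: Binj; rewrite rhoB /t s1 map_mx1 mulmx1 mul1mx.
have rhoD a b : rho (a + b) = rho a + rho b.
  by apply: Binj; rewrite mulmxDl !rhoB /t sD map_mxD mulmxDr.
have rhoM a b : rho (a * b) = rho a *m rho b.
  apply: Binj; have -> : rho a *m rho b *m B = B *m t a *m t b.
    by rewrite -(mulmxA (rho a)) (rhoB b) (mulmxA (rho a)) (rhoB a).
  by rewrite rhoB tM mulmxA.
have rhoZ c a : rho (c *: a) = iota c *: rho a.
  by apply: Binj; rewrite -scalemxAl !rhoB /t sZ map_mxZ -scalemxAr.
exists d, rho; split; first split=> //.
  move=> xi w xi0 w0; apply: contrapT => nx.
  have xiw x : xi *m rho x *m w = 0.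
    by apply/eqP/negPn/negP => h; apply: nx; exists x.
  have [||| M MP] := @subspace_mx K d [set eta | forall x, eta *m rho x *m w = 0].
  - by move=> x; rewrite !mul0mx.
  - by move=> x y hx hy a; rewrite !mulmxDl hx hy addr0.
  - by move=> c x hx a; rewrite -!scalemxAl hx scaler0.
  have rMB : \rank (M *m B) = \rank M by apply: mxrankMfree.
  have : Q (\rank (<<M *m B>>)%MS).
    apply/asboolP; split.
      rewrite mxrank_gen rMB lt0n mxrank_eq0; apply: contraNneq xi0 => M0.
      by rewrite -submx0 -M0; apply/MP.
    exists (<<M *m B>>)%MS; split=> // a; rewrite (eqmxMr _ (genmxE _)) genmxE.
    rewrite -mulmxA -rhoB mulmxA submxMr //.
    apply/row_subP => i; apply/MP => x; rewrite row_mul -(mulmxA (row i M)) -rhoM.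
    by have /MP := row_sub i M; apply.
  move/dmin; rewrite mxrank_gen rMB => dM.
  have : (1%:M <= M)%MS by rewrite sub1mx /row_full eqn_leq rank_leq_col dM.
  move=> M1; case/eqP: w0; apply/colP => i.
  have /MP/(_ 1) : (delta_mx (0 : 'I_1) i <= M)%MS by apply: submx_trans M1; rewrite submx1.
  by rewrite rho1 mulmx1 -rowE => /rowP/(_ 0); rewrite !mxE.
move=> a; split=> [ra b|Pa]; last first.
  apply: Binj; rewrite rhoB mul0mx /t.
  have -> : s a = 0 by apply: colP' => j; rewrite scd mul0mx; apply/cd0.
  by rewrite map_mx0 mulmx0.
(* Modulo L every x equals x c a b, so with rho a = 0 the matrix B kills all coordinate vectors. *)
apply: contrapT => /Lmx[c Lc].
have Be x : B *m map_mx iota (cd x) = 0.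
  have -> : cd x = cd (x * (c * (a * b)) * 1).
    apply/eqP; rewrite mulr1 -subr_eq0 -cdB; apply/eqP/cd0.
    by rewrite -{1}[x]mulr1 -mulrBr; apply: LM.
  rewrite -scd map_mxM mulmxA -/(t _) -rhoB !rhoM ra.
  by rewrite !(mul0mx, mulmx0).
have B0 : B = 0.
  apply/matrixP => i j; have := congr1 (fun M : 'cV_d => M i 0) (Be (u j)).
  by rewrite cdu map_delta_mx -colE !mxE.
by have := mxrank_eq0 B; rewrite B0 eqxx -B0 (eqnP Bf) => /eqP e; move: d0; rewrite /d e.
Qed.

Lemma rep0 d (rho : A -> 'M[K]_d) : rep rho -> rho 0 = 0.
Proof. by move=> H; apply: (@addrI _ (rho 0)); rewrite -(repD H) !addr0. Qed.

Lemma rep_sum d (rho : A -> 'M[K]_d) (T : finType) (x : T -> A) : rep rho ->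
  rho (\sum_t x t) = \sum_t rho (x t).
Proof. by move=> H; apply: (big_morph _ (repD H) (rep0 H)). Qed.

Lemma rep_prime d (rho : A -> 'M[K]_d) x y : rep rho -> rho x != 0 -> rho y != 0 ->
  exists a, rho (x * a * y) != 0.
Proof.
move=> H x0 y0.
have [i ri] : exists i, row i (rho x) != 0.
  apply: contrapT => /forallNP n; case/eqP: x0; apply/row_matrixP => i.
  by rewrite row0; apply/eqP/negPn/negP => h; apply: (n i).
have [j cj] : exists j, col j (rho y) != 0.
  apply: contrapT => /forallNP n; case/eqP: y0; apply/matrixP => l j.
  have /negP/negPn/eqP/colP/(_ l) := n j; by rewrite !mxE.
have [a ha] := rep_irr H ri cj; exists a; apply: contraNneq ha => e.
rewrite -row_mul -(repM H) colE mulmxA -row_mul -(repM H) e row0 mul0mx //.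
Qed.

Lemma rep_row d (rho : A -> 'M[K]_d) (xi : 'rV_d) m (w : 'M_(d, m)) : rep rho ->
  (forall x, xi *m rho x *m w = 0) -> xi = 0 \/ w = 0.
Proof.
move=> H e; case: (eqVneq xi 0) => [|xi0]; [by left|right].
apply/matrixP => i j; rewrite mxE; apply: contrapT => /eqP wij.
have [|x] := rep_irr H xi0 (w := col j w).
  by apply: contraNneq wij => /colP/(_ i); rewrite !mxE => /eqP.
by rewrite colE mulmxA e mul0mx eqxx.
Qed.

Section Fill.
Variables (d : nat) (T : finType) (rho : T -> A -> 'M[K]_d).
Hypothesis rhoP : forall l, rep (rho l).
Hypothesis sep : forall l l', l != l' -> exists x, rho l x != 0 /\ rho l' x = 0.

Lemma rep_separate l : exists x, rho l x != 0 /\ forall l', l' != l -> rho l' x = 0.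
Proof.
have [x [x0 xP]] : exists x, rho l x != 0 /\ forall l', l' \in enum T -> l' != l -> rho l' x = 0.
  elim: (enum T) => [|t s [x [x0 xP]]].
    exists 1; split=> //; rewrite (rep1 (rhoP l)) -mxrank_eq0 mxrank1 -lt0n.
    exact: rep_pos (rhoP l).
  case: (eqVneq t l) => [->|tl].
    by exists x; split=> // l'; rewrite inE => /orP[/eqP->|//]; [rewrite eqxx|apply: xP].
  have [y [y0 yt]] := sep (l := l) (l' := t) ltac:(by rewrite eq_sym).
  have [a xay] := rep_prime (rhoP l) x0 y0.
  exists (x * a * y); split=> // l'; rewrite inE => /orP[/eqP->|l's] ll'.
    by rewrite (repM (rhoP t)) yt mulmx0.
  by rewrite !(repM (rhoP l')) xP // !mul0mx.
by exists x; split=> // l'; apply: xP; rewrite mem_enum.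
Qed.

(* The spaces of coefficient rows killed by [Vn v j] decrease with [j], and
   are constant as soon as two consecutive ones agree. *)
Lemma fill (xi : T -> 'rV[K]_d) m (w : T -> 'M[K]_(d, m)) :
  (forall x, Vn v (#|T| * d) x -> \sum_l xi l *m rho l x *m w l = 0) ->
  forall l, xi l = 0 \/ w l = 0.
Proof.
move=> van.
pose F : vectType K := {ffun T -> 'rV[K]_d}.
pose Z j : set F := [set eta | forall x, Vn v j x -> \sum_l eta l *m rho l x *m w l = 0].
have /choice[U UP] : forall j, exists U : {vspace F}, forall x, x \in U <-> Z j x.
  move=> j; apply: subspace_vs.
  - by move=> x _; rewrite big1 // => l _; rewrite ffunE !mul0mx.
  - move=> x y Zx Zy a Va.
    rewrite (eq_bigr (fun l => x l *m rho l a *m w l + y l *m rho l a *m w l)).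
      by rewrite big_split /= Zx // Zy // addr0.
    by move=> l _; rewrite ffunE !mulmxDl.
  - move=> c x Zx a Va; rewrite (eq_bigr (fun l => c *: (x l *m rho l a *m w l))).
      by rewrite -scaler_sumr Zx // scaler0.
    by move=> l _; rewrite ffunE -!scalemxAl.
have UZ j i : (i <= j)%N -> (U j <= U i)%VS.
  move=> ij; apply/subvP => x /UP Zx; apply/UP => a Va; apply: Zx; exact: Vn_mono Va.
have Ust j : U j = U j.+1 -> U j.+1 = U j.+2.
  move=> e; apply/eqP; rewrite eqEsubv [X in _ && X]UZ // andbT; apply/subvP => x xU.
  have /UP Zx := xU; apply/UP => a /Vn_S[c [y [Vy ->]]].
  pose xv i : F := [ffun l => x l *m rho l (v i)].
  have Zxv i : Z j.+1 (xv i).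
    apply/UP; rewrite -e; apply/UP => b Vb.
    rewrite (eq_bigr (fun l => x l *m rho l (v i * b) *m w l)).
      apply: Zx; rewrite -add1n; apply: VnM => //.
      by rewrite -[v i]mulr1 -(ev_nil v) -ev_cons; apply: Vn_ev.
    by move=> l _; rewrite ffunE (repM (rhoP l)) !mulmxA.
  rewrite (eq_bigr (fun l => iota c *: (x l *m rho l 1 *m w l) +
     \sum_i xv i l *m rho l (y i) *m w l)).
    rewrite big_split /= -scaler_sumr Zx ?scaler0 ?add0r; last exact: Vn1.
    by rewrite exchange_big big1 //= => i _; apply: (Zxv i).
  move=> l _; rewrite (repD (rhoP l)) (repZ (rhoP l)) mulmxDr mulmxDl.
  rewrite -scalemxAr -scalemxAl; congr (_ + _).
  rewrite (rep_sum _ (rhoP l)) mulmx_sumr mulmx_suml; apply: eq_bigr => i _.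
  by rewrite ffunE (repM (rhoP l)) !mulmxA.
have Ust' j i : U j = U j.+1 -> U (j + i)%N = U j /\ U (j + i).+1 = U j.
  move=> e; elim: i => [|i [e1 e2]]; first by rewrite addn0 -e.
  by rewrite addnS e2; split=> //; rewrite -(Ust (j + i)%N) ?e1 ?e2.
have dF : \dim {:F} = (#|T| * d)%N by rewrite dimvf -[dim F]/(#|T| * (1 * d))%N mul1n.
have [j jle je] : exists2 j, (j <= #|T| * d)%N & U j = U j.+1.
  apply: contrapT => nj.
  have drop j : (j <= (#|T| * d).+1)%N -> (\dim (U j) + j <= #|T| * d)%N.
    elim: j => [_|j IH lej]; first by rewrite addn0 -dF dimvS ?subvf.
    have := IH (ltnW lej); rewrite addnS; apply: leq_trans; rewrite -addSn leq_add2r.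
    rewrite ltn_neqAle dimvS ?UZ // andbT; apply/eqP => e; apply: nj; exists j => //.
    apply/eqP; rewrite eq_sym eqEdim UZ //= e //.
  have := drop _ (leqnn _); lia.
pose x0 : F := [ffun l => xi l].
have Uall i : x0 \in U i.
  have xU : x0 \in U (#|T| * d)%N.
    apply/UP => a Va; apply: etrans (van a Va); apply: eq_bigr => l _; by rewrite ffunE.
  have [le|le] := leqP i (#|T| * d)%N; first exact: (subvP (UZ _ _ le)).
  have [e1 _] := Ust' j (#|T| * d - j)%N je; rewrite subnKC // in e1.
  have [e2 _] := Ust' j (i - j)%N je; rewrite subnKC // in e2; last lia.
  by rewrite e2 -e1.
have all x : \sum_l xi l *m rho l x *m w l = 0.
  have [n Vx] := Vall x; have /UP/(_ x Vx) e := Uall n; apply: etrans e.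
  by apply: eq_bigr => l _; rewrite ffunE.
move=> l; case: (eqVneq (xi l) 0) => [|xi0]; [by left|right].
(* Once the sum vanishes for all x, inserting e, which is zero at every other point, isolates the
   term of l. *)
have [e [e0 eP]] := rep_separate l.
have h a : forall b, xi l *m rho l (a * e) *m rho l b *m w l = 0.
  move=> b; apply: etrans (all (a * e * b)); rewrite [RHS](bigD1 l) //= big1 ?addr0; last first.
    by move=> l' ll'; rewrite !(repM (rhoP l')) eP // !(mulmx0, mul0mx).
  by rewrite (repM (rhoP l) (a * e)) !mulmxA.
have [xe|//] : (forall a, xi l *m rho l a *m rho l e = 0) \/ w l = 0.
  case: (eqVneq (w l) 0) => [|w0]; [by right|left=> a].
  have [//|/eqP] := rep_row (rhoP l) (h a); last by rewrite (negPf w0).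
  by rewrite (repM (rhoP l)) mulmxA.
have [/eqP|/eqP] := rep_row (rhoP l) xe; by rewrite ?(negPf xi0) ?(negPf e0).
Qed.

End Fill.

Lemma functional_count (S T : finType) (I : set A) (V : set A) (f : T -> A -> K) (u : S -> A) :
  (forall t x y, f t (x + y) = f t x + f t y) ->
  (forall t c x, f t (c *: x) = iota c * f t x) ->
  (forall t x, I x -> f t x = 0) ->
  (forall x, V x -> kdep I u x) ->
  (forall r : T -> K, (forall x, V x -> \sum_t r t * f t x = 0) -> forall t, r t = 0) ->
  (#|T| <= #|S|)%N.
Proof.
move=> fD fZ fI du ind; rewrite leqNgt; apply/negP => lt.
have [r [[t rt] rP]] := idomain_kernel (fun t s => f t (u s)) lt.
case/eqP: rt; apply: ind => x Vx; have [c Ic] := du x Vx.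
have f0 t' : f t' 0 = 0 by apply: (@addrI _ (f t' 0)); rewrite -fD !addr0.
have E t' : f t' x = \sum_s iota (c s) * f t' (u s).
  rewrite -[x](subrK (\sum_s c s *: u s)) fD fI // add0r.
  rewrite (big_morph _ (fD t') (f0 t')); apply: eq_bigr => s _; exact: fZ.
rewrite (eq_bigr (fun t => \sum_s iota (c s) * (r t * f t (u s)))).
  rewrite exchange_big big1 //= => s _; by rewrite -mulr_sumr rP mulr0.
by move=> t' _; rewrite E mulr_sumr; apply: eq_bigr => s _; rewrite mulrCA.
Qed.

End Points.

(** * Matrices over an uncountable algebraically closed field *)

Lemma kernel_family (K : fieldType) (S T : finType) (B : S -> T -> K) m :
  (#|T| + m <= #|S|)%N ->
  exists c : 'I_m -> S -> K, (forall i t, \sum_s c i s * B s t = 0) /\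
    forall r : 'I_m -> K, (forall s, \sum_i r i * c i s = 0) -> forall i, r i = 0.
Proof.
move=> le; pose M : 'M[K]_(#|S|, #|T|) := \matrix_(i, j) B (enum_val i) (enum_val j).
have rk : (m <= \rank (kermx M))%N.
  rewrite mxrank_ker; have := rank_leq_col M; lia.
pose C := row_base (kermx M).
pose w i := widen_ord rk i.
exists (fun i s => C (w i) (enum_rank s)); split.
  move=> i t.
  have CM : C *m M = 0.
    by apply/sub_kermxP; rewrite eq_row_base.
  have := congr1 (fun X : 'M_(_, _) => X (w i) (enum_rank t)) CM; rewrite !mxE => e.
  apply: etrans e; rewrite (reindex (@enum_val S predT)) /=; last exact/onW_bij/enum_val_bij.
  by apply: eq_bigr => j _; rewrite enum_valK; congr (_ * _); rewrite mxE enum_rankK.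
move=> r rP i.
pose u : 'rV_(\rank (kermx M)) := \sum_i r i *: delta_mx 0 (w i).
have winj : injective w by move=> x y /(congr1 val) /= /val_inj.
have uE j : u 0 (w j) = r j.
  rewrite summxE (bigD1 j) //= !mxE !eqxx mulr1 big1 ?addr0 // => l lj.
  by rewrite !mxE (inj_eq winj) eq_sym (negPf lj) mulr0.
have uC : u *m C = 0.
  apply/rowP => s; rewrite mulmx_suml summxE mxE -(enum_valK s).
  apply: etrans (rP (enum_val s)); apply: eq_bigr => j _.
  by rewrite -scalemxAl -rowE !mxE.
have u0 : u = 0 by apply: (row_free_inj (row_base_free (kermx M))); rewrite uC mul0mx.
by rewrite -uE u0 mxE.
Qed.

Section Commutant.
Variable K : fieldType.
Hypothesis Kc : forall p : {poly K}, (1 < size p)%N -> exists x, root p x.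

(** [row_ebase] completes a row eigenvector to an invertible matrix whose first row spans the
    eigenline, which deflates G to a smaller block. *)
Lemma trigonalize n (G : 'M[K]_n) : exists P, P \in unitmx /\ is_trig_mx (P *m G *m invmx P).
Proof.
elim: n G => [|n IH] G.
  exists 1%:M; rewrite unitmx1; split=> //; apply/is_trig_mxP => -[]//.
have [a ra] : exists a, root (char_poly G) a by apply: Kc; rewrite size_char_poly.
have /eigenvalueP[v vG v0] : eigenvalue G a by rewrite eigenvalue_root_char.
pose E : 'M[K]_(1 + n) := row_ebase v.
have Eu : E \in unitmx := row_ebase_unit v.
pose c := (col_ebase v) 0 0.
have vE : v = c *: (usubmx E : 'rV_(1 + n)).
  rewrite -[LHS]mulmx_ebase [col_ebase v]mx11_scalar mul_scalar_mx -scalemxAl.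
  congr (_ *: _); rewrite rank_rV v0 -[in LHS]/E -{1}[E]vsubmxK.
  have -> : pid_mx 1 = row_mx (1%:M) 0 :> 'M[K]_(1, 1 + n).
    exact: pid_mx_row.
  apply: (etrans (@mul_row_col K 1 1 n (1 + n) 1%:M 0 (usubmx E) (dsubmx E))).
  by rewrite mul1mx mul0mx addr0.
have c0 : c != 0 by apply: contraNneq v0 => c0; rewrite vE c0 scale0r.
have eG : (usubmx E : 'rV_(1 + n)) *m (G : 'M_(1 + n)) = a *: (usubmx E : 'rV_(1 + n)).
  apply: (@scalerI _ _ c c0).
  by rewrite scalemxAl -vE scalerA mulrC -scalerA -vE.
pose G' : 'M[K]_(1 + n) := E *m (G : 'M_(1 + n)) *m invmx E.
have uG : usubmx G' = a *: row_mx 1%:M 0.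
  rewrite /G' -!mul_usub_mx eG -scalemxAl; congr (_ *: _).
  have : usubmx E *m invmx E = usubmx (1%:M : 'M_(1 + n)) by rewrite mul_usub_mx mulmxV.
  by move=> ->; rewrite (scalar_mx_block 1 n) block_mxEv col_mxKu.
have [P [Pu Pt]] := IH (drsubmx G').
pose Q : 'M[K]_(1 + n) := block_mx 1%:M 0 0 P.
have QV : Q *m block_mx 1%:M 0 0 (invmx P) = 1%:M.
  by rewrite mulmx_block !(mul0mx, mulmx0, mul1mx, addr0, add0r) mulmxV // -scalar_mx_block.
have [Qu _] := mulmx1_unit QV.
have iQ : invmx Q = block_mx 1%:M 0 0 (invmx P).
  by rewrite -[LHS]mulmx1 -QV mulmxA mulVmx // mul1mx.
have QEu : Q *m E \in unitmx by rewrite unitmx_mul Qu.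
have iQE : invmx (Q *m E) = invmx E *m invmx Q.
  apply: (can_inj (mulKmx QEu)); rewrite mulmxV // -mulmxA (mulmxA E) mulmxV //.
  by rewrite mul1mx mulmxV.
exists (Q *m E); split=> //.
have -> : Q *m E *m (G : 'M_(1 + n)) *m invmx (Q *m E) = Q *m G' *m invmx Q.
  by rewrite iQE /G' !mulmxA.
rewrite iQ -[G']submxK.
have -> : ulsubmx G' = a%:M by rewrite /ulsubmx uG linearZ /= row_mxKl scale_scalar_mx mulr1.
have -> : ursubmx G' = 0 by rewrite /ursubmx uG linearZ /= row_mxKr scaler0.
rewrite !mulmx_block !(mul0mx, mulmx0, mul1mx, mulmx1, addr0, add0r).
have := @is_trig_block_mx K 1 n 1 n a%:M 0 (P *m dlsubmx G') (P *m drsubmx G' *m invmx P) (erefl _).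
by rewrite eqxx Pt scalar_mx_is_trig => h; exact: h.
Qed.

(* In a basis where [G] is lower triangular, the commutator with [G] maps lower
   triangular matrices to strictly lower triangular ones. *)
Lemma commutant n (G : 'M[K]_n) : exists N : 'I_n -> 'M[K]_n,
  (forall i, N i *m G = G *m N i) /\
  forall r : 'I_n -> K, \sum_i r i *: N i = 0 -> forall i, r i = 0.
Proof.
have [P [Pu /is_trig_mxP Gt]] := trigonalize G; set T := P *m G *m _ in Gt.
(* Positions on or below the diagonal and strictly below it; their numbers differ by n, the
   dimension obtained. *)
pose S := {p : 'I_n * 'I_n | (p.2 <= p.1)%N}.
pose S' := {p : 'I_n * 'I_n | (p.2 < p.1)%N}.
pose Ex (s : S) : 'M[K]_n := delta_mx (val s).1 (val s).2.
pose B s (t : S') := (T *m Ex s - Ex s *m T) (val t).1 (val t).2.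
have cS : (#|{: S'}| + n <= #|{: S}|)%N.
  rewrite -[X in (_ + X)%N]card_ord -card_sum.
  have f1P (t : S') : ((val t).2 <= (val t).1)%N by case: t => p /= /ltnW.
  pose f (t : S' + 'I_n) : S := match t with inl t => Sub (val t) (f1P t)
    | inr i => Sub (i, i) (leqnn i) end.
  apply: (@leq_card _ _ f) => -[t|i] [u|j] /(congr1 val) /= e.
  - by congr inl; apply: val_inj.
  - by have := valP t; rewrite /= e /= ltnn.
  - by have := valP u; rewrite /= -e /= ltnn.
  - by case: e => ->.
have [c [cB cf]] := kernel_family B cS.
pose Y i := \sum_s c i s *: Ex s.
have YE i (s : S) : Y i (val s).1 (val s).2 = c i s.
  rewrite summxE (bigD1 s) //= !mxE !eqxx mulr1 big1 ?addr0 // => t ts.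
  rewrite !mxE; case: eqP => [e1|_]; last by rewrite mulr0.
  case: eqP => [e2|_]; last by rewrite mulr0.
  by case/eqP: ts; apply: val_inj; rewrite [RHS]surjective_pairing e1 e2 -surjective_pairing.
have Yt i (a b : 'I_n) : (a < b)%N -> Y i a b = 0.
  move=> ab; rewrite summxE big1 // => s _; rewrite !mxE.
  case: eqP => [ea|]; last by rewrite mulr0.
  case: eqP => [eb|]; last by rewrite mulr0.
  by have := valP s; rewrite /= -ea -eb leqNgt ab.
have TY i : T *m Y i = Y i *m T.
  apply/matrixP => a b; apply/eqP; rewrite -subr_eq0; apply/eqP.
  case: (ltngtP a b) => [ab|ba|/val_inj <-].
  - rewrite !mxE !big1 ?subrr // => l _.
      by case: (ltnP a l) => al; [rewrite Yt ?mul0r|rewrite (Gt l b) ?mulr0 // (leq_ltn_trans al)].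
    by case: (ltnP a l) => al; [rewrite Gt ?mul0r|rewrite (Yt i l b) ?mulr0 // (leq_ltn_trans al)].
  - pose t : S' := Sub (a, b) ba.
    have := cB i t; rewrite /B /= => e; apply: etrans e.
    rewrite mulmx_sumr mulmx_suml [X in X - _]summxE [X in _ - X]summxE -sumrB.
    by apply: eq_bigr => s _; rewrite -scalemxAr -scalemxAl !mxE mulrBr.
  - rewrite !mxE !(bigD1 (P := predT) a) //= mulrC !big1 ?subrr // => l la.
      case: (ltngtP a l) => [al|al|/val_inj e]; last by rewrite e eqxx in la.
        by rewrite (Yt i a l) // mul0r.
      by rewrite (Gt l a) // mulr0.
    case: (ltngtP a l) => [al|al|/val_inj e]; last by rewrite e eqxx in la.
      by rewrite (Gt a l) // mul0r.
    by rewrite (Yt i l a) // mulr0.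
have PG : P *m G = T *m P by rewrite /T mulmxKV.
exists (fun i => invmx P *m Y i *m P); split.
  move=> i; apply: (can_inj (mulKmx Pu)).
  by rewrite -!mulmxA mulKVmx // PG (mulmxA P) PG -(mulmxA T) mulKVmx // (mulmxA (Y i)) [RHS]mulmxA TY.
move=> r rN; apply: cf => s.
have YS : \sum_i r i *: Y i = 0.
  have iPu : invmx P \in unitmx by rewrite unitmx_inv.
  apply: (can_inj (mulKmx iPu)); apply: (can_inj (mulmxK Pu)); rewrite mulmx0 mul0mx; apply: etrans rN.
  rewrite mulmx_sumr mulmx_suml; apply: eq_bigr => i _.
  by rewrite -scalemxAr -scalemxAl.
have := congr1 (fun M : 'M_n => M (val s).1 (val s).2) YS; rewrite summxE mxE => e.
by apply: etrans e; apply: eq_bigr => i _; rewrite mxE YE.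
Qed.

End Commutant.

(** * Common zeros of forms *)

Section Common.
Variable K : fieldType.
Hypothesis Kc : forall p : {poly K}, (1 < size p)%N -> exists x, root p x.
Hypothesis Kunc : ~ countable [set: K].
Variables (N M : nat) (f : 'I_N -> {mpoly K[M]}) (r : nat).
Hypothesis fh : forall l, f l \is r.-homog.
Hypothesis r0 : (0 < r)%N.
Let P := {mpoly K[M]}.

Definition fideal : set P := [set p | exists h : 'I_N -> P, p = \sum_l h l * f l].

Lemma fideal_lideal : lideal fideal.
Proof.
split; first by exists (fun=> 0); rewrite big1 // => l _; rewrite mul0r.
  move=> x y [h ->] [h' ->]; exists (fun l => h l - h' l).
  by rewrite -sumrB; apply: eq_bigr => l _; rewrite mulrBl.
move=> a x [h ->]; exists (fun l => a * h l).
by rewrite mulr_sumr; apply: eq_bigr => l _; rewrite mulrA.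
Qed.

Lemma pihomog_mul n (h q : P) : q \is r.-homog ->
  pihomog [measure of mdeg] (n + r) (h * q) = pihomog [measure of mdeg] n h * q.
Proof.
move=> qh; elim/mpolyind: h => [|c m p _ _ IH]; first by rewrite mul0r !raddf0 mul0r.
rewrite mulrDl !raddfD /= mulrDl IH; congr (_ + _).
rewrite -scalerAl !linearZ /= -scalerAl; congr (_ *: _).
rewrite pihomogX; case: eqP => [<-|/eqP mn].
  by apply: pihomog_dE; apply: dhomogM => //; rewrite dhomogX.
rewrite mul0r; apply: (@pihomog_ne0 _ _ _ (mdeg m + r)%N (n + r)%N).
  by rewrite eqn_add2r.
by apply: dhomogM => //; rewrite dhomogX.
Qed.

Lemma fideal_homog n (p : P) : p \is (n + r).-homog -> fideal p ->
  exists h : 'I_N -> P, (forall l, h l \is n.-homog) /\ p = \sum_l h l * f l.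
Proof.
move=> ph [h e]; exists (fun l => pihomog [measure of mdeg] n (h l)); split.
  by move=> l; apply: pihomogP.
rewrite -(pihomog_dE ph) e raddf_sum /=; apply: eq_bigr => l _.
exact: pihomog_mul.
Qed.

(* Otherwise polynomials of degree at most n would be spanned by boundedly many
   multiples of the products of powers of the [N] forms [f l], of which there are
   only O(n ^ N), whereas their dimension has order n ^ M. *)
Lemma nilpotent_impossible : (N < M)%N -> ~ forall i : 'I_M, exists m, fideal ('X_i ^+ m).
Proof.
move=> NM /choice[e eP]; have [J0 JB JM] := fideal_lideal.
(* A monomial of degree n0 or more contains some X_i^mx and lies in the ideal; the summand r makes
   its degree at least that of the forms. *)
pose mx := (\max_i e i)%N; pose n0 := (M * mx + r)%N.+1.
have monJ (m : 'X_{1..M}) : (n0 <= mdeg m)%N -> fideal 'X_[m].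
  move=> le.
  have [i lei] : exists i, (mx <= m i)%N.
    apply: contrapT => /forallNP nle.
    have : (mdeg m <= \sum_(i < M) mx)%N.
      by rewrite mdegE; apply: leq_sum => i _; have := nle i; lia.
    by rewrite sum_nat_const card_ord; lia.
  have mxe : (e i <= mx)%N by apply: leq_bigmax.
  rewrite mpolyXE_id (bigD1 i) //= mulrC -(subnK (leq_trans mxe lei)) exprD mulrA.
  exact: (JM).
pose y n (t : {ffun 'I_N -> 'I_n.+1} * 'X_{1..M < n0}) : P :=
  (\prod_l f l ^+ t.1 l) * 'X_[t.2].
have spanS n n' : (n <= n')%N -> forall p, kspan (range (@y n)) p -> kspan (range (@y n')) p.
  move=> le p; apply: kspanS => _ [[a b] _ <-]; apply: kspan_mem.
  exists ([ffun l => widen_ord (n := n.+1) (m := n'.+1) le (a l)], b) => //.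
  by rewrite /y /=; congr (_ * _); apply: eq_bigr => l _; rewrite ffunE.
have spanf n l p : kspan (range (@y n)) p -> kspan (range (@y n.+1)) (p * f l).
  elim=> [|c _ x [[a b] _ <-] _ IH]; first by rewrite mul0r; apply: kspan0.
  rewrite mulrDl -scalerAl; apply: kspan_cons => //.
  have aP l' : (a l' + (l' == l) < n.+2)%N by have := ltn_ord (a l'); case: (l' == l) => /=; lia.
  exists ([ffun l' => Ordinal (aP l')], b) => //.
  rewrite /y /= mulrAC; congr (_ * _).
  rewrite (bigD1 l) //= [in RHS](bigD1 l) //= ffunE /= eqxx addn1 exprSr mulrAC; congr (_ * _).
  by apply: eq_bigr => l' l'l; rewrite ffunE /= (negPf l'l) addn0.
have gen n (m : 'X_{1..M}) : (mdeg m <= n)%N -> kspan (range (@y n)) 'X_[m].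
  elim/ltn_ind: n m => n IH m le.
  case: (ltnP (mdeg m) n0) => [lt|ge].
    apply: kspan_mem; exists ([ffun=> ord0], BMultinom lt) => //.
    by rewrite /y /= big1 ?mul1r // => l _; rewrite ffunE expr0.
  have ger : (r <= mdeg m)%N by rewrite /n0 in ge; lia.
  have [|h [hh ->]] := @fideal_homog (mdeg m - r) 'X_[m] _ (monJ m ge).
    by rewrite dhomogX subnK.
  case: n IH le => [|n] IH le; first by move: le ger; lia.
  elim/big_ind: _ => [||l _]; [exact: kspan0|exact: kspanD|apply: spanf].
  rewrite [h l]mpolyE big_seq; elim/big_ind: _ => [||u us]; [exact: kspan0|exact: kspanD|].
  apply: kspanZ; apply: (IH n) => //.
  have -> : mdeg u = (mdeg m - r)%N by move/dhomogP: (hh l) => /(_ u us).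
  by lia.
pose B := #|{: 'X_{1..M < n0}}|.
(* This E makes (M (E + 1))^N B equal to E (E + 1)^N, which is less than (E + 1)^(N + 1). *)
pose E := (M ^ N * B)%N.
pose x (g : {ffun 'I_M -> 'I_E.+1}) : P := 'X_[[multinom (g i : nat) | i < M]].
have xfree : kfree [set 0] x.
  move=> c /= ce g0.
  have := congr1 (mcoeff [multinom (g0 i : nat) | i < M]) ce.
  rewrite raddf_sum mcoeff0 (bigD1 g0) //= big1 ?addr0.
    by rewrite mcoeffZ mcoeffX eqxx mulr1.
  move=> g gg0; rewrite mcoeffZ mcoeffX; case: eqP => [/mnmP h|_]; last by rewrite mulr0.
  by case/eqP: gg0; apply/ffunP => i; apply: val_inj; have := h i; rewrite !mnmE.
have := @steinitz _ _ _ _ _ (kact_domain (erefl : [set (0 : P)] 0) _ _) _ _ x (@y (M * E)%N).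
rewrite card_ffun card_prod card_ffun !card_ord => st.
have {st} : (E.+1 ^ M <= (M * E).+1 ^ N * B)%N.
  apply: st => //; try by [move=> ? ? -> ->; rewrite subr0|move=> c z ->; rewrite scaler0].
  move=> g; exists 1; split; first exact: oner_neq0.
  have [|c ce] := @kspan_range _ _ _ (@y (M * E)%N) (x g).
    apply: gen; rewrite mdegE -[X in (_ <= X)%N]/(M * E)%N.
    apply: (@leq_trans (\sum_(i < M) E)); last by rewrite sum_nat_const card_ord.
    by apply: leq_sum => i _; rewrite mnmE -ltnS.
  by exists c; rewrite scale1r ce subrr.
rewrite leqNgt => /negP; apply.
have M0 : (0 < M)%N by case: (M) NM.
have h1 : ((M * E).+1 ^ N <= (M * E.+1) ^ N)%N.
  by case: (N) => // N'; rewrite leq_exp2r // mulnS; lia.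
apply: (@leq_ltn_trans ((M * E.+1) ^ N * B)); first by rewrite leq_mul2r h1 orbT.
apply: (@leq_trans (E.+1 ^ N.+1)); last by rewrite leq_pexp2l.
rewrite expnMn mulnAC -/E expnS ltn_pmul2r // expn_gt0 //.
Qed.

(** Each variable is a scalar modulo m: if x is transcendental modulo m, [amitsur] gives an l with x
    - l not invertible, hence in m; if x is algebraic, its equation splits into linear factors and m
    is prime. *)
Lemma maximal_point (m : set P) : lmax m -> exists a : 'I_M -> K, forall p, m p -> p.@[a] = 0.
Proof.
move=> [ml m1 mm]; have [m0 mB mM] := ml.
pose W (n : nat) : set P := [set p | (msize p <= n)%N].
have Wall (x : P) : exists n, W n x by exists (msize x); rewrite /W /=.
have Wfin n (T : finType) (x : T -> P) : (forall t, W n (x t)) -> kfree [set 0] x ->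
    (#|T| <= #|{: 'X_{1..M < n}}|)%N.
  move=> Wx fx.
  apply: (@steinitz _ _ _ _ _ (kact_domain (erefl : [set (0 : P)] 0) _ _) _ _ x
     (fun u : 'X_{1..M < n} => 'X_[u])) => //.
  - by move=> ? ? -> ->; rewrite subr0.
  - by move=> c z ->; rewrite scaler0.
  move=> t; exists 1; split; first exact: oner_neq0.
  exists (fun u : 'X_{1..M < n} => (x t)@_u); rewrite scale1r {1}(mpolywE (Wx t)) subrr //.
have mP : ideal2 m by split=> // a x mx; rewrite mulrC; apply: mM.
have prime x y : m (x * y) -> m x \/ m y.
  move=> mxy; case: (pselect (m x)) => [|/mm[a ma]]; [by left|right].
  have -> : y = (1 - a * x) * y + a * (x * y) by rewrite mulrBl mul1r mulrA subrK.
  by apply: lidealD => //; [rewrite mulrC; apply: mM|apply: mM].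
have lin (x : P) : exists l : K, m (x - l%:A).
  case: (pselect (exists q : {poly K}, q != 0 /\ m (horner_alg x q))) => [[q]|nalg].
    have [n] := ubnP (size q); elim: n q => // n IH q sq [q0 mq].
    case: (leqP (size q) 1) => [/size1_polyC e|gt].
      move: mq; rewrite e horner_algC => mq; case: m1.
      have := lidealZ (q`_0)^-1 ml mq; rewrite scalerA mulVf ?scale1r //.
      by apply: contraNneq q0 => z; rewrite e z.
    have [l /factor_theorem[q' e]] := Kc gt.
    move: mq; rewrite e rmorphM /= => /prime[mq|].
      apply: (IH q'); last first.
        by split=> //; apply: contraNneq q0 => z; rewrite e z mul0r.
      move: sq; rewrite e size_Mmonic ?monicXsubC ?size_XsubC //; first lia.
      by apply: contraNneq q0 => z; rewrite e z mul0r.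
    by rewrite rmorphB /= horner_algX horner_algC; exists l.
  have cnt := @amitsur K P W (fun n => #|{: 'X_{1..M < n}}|) Wall Wfin m x mP
     (fun q q0 mq => nalg (ex_intro _ q (conj q0 mq))).
  have [l nl] : exists l : K, ~ exists y, m (y * (x - l%:A) - 1).
    apply: contrapT => /forallNP al; apply: Kunc; apply: sub_countable cnt.
    by apply: subset_card_le => l _ /=; apply: contrapT; apply: al.
  exists l; apply: contrapT => /mm[a ma]; apply: nl; exists a.
  by rewrite -opprB; apply: lidealN.
have /choice[a aP] : forall i : 'I_M, exists l : K, m ('X_i - l%:A) by move=> i; apply: lin.
exists a => p mp.
have ev (q : P) : m (q - (q.@[a])%:A).
  have X1 u : m ('X_[u] - (('X_[u] : P).@[a])%:A).
    rewrite mevalX mpolyXE_id.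
    apply: (big_ind2 (fun (x : P) (y : K) => m (x - y%:A))).
    - by rewrite scale1r subrr.
    - move=> x1 x2 y1 y2 h1 h2.
      have -> : x1 * y1 - (x2 * y2)%:A = x1 * (y1 - y2%:A) + y2%:A * (x1 - x2%:A) :> P.
        rewrite !mulrBr -scalerAr mulr1 -!scalerAl !mul1r scalerA mulrC.
        by rewrite addrA [y2 * x2]mulrC subrK.
      by apply: lidealD => //; apply: mM.
    - move=> i _; elim: (u i) => [|n IH]; first by rewrite !expr0 scale1r subrr.
      rewrite !exprS.
      have -> : 'X_i * 'X_i ^+ n - (a i * a i ^+ n)%:A =
         'X_i * ('X_i ^+ n - (a i ^+ n)%:A) + (a i ^+ n)%:A * ('X_i - (a i)%:A) :> P.
        rewrite !mulrBr -!scalerAr -!scalerAl !mulr1 !mul1r scalerA addrA subrK mulrC //.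
      by apply: lidealD => //; apply: mM.
  elim/mpolyind: q => [|c u q _ _ IH]; first by rewrite meval0 scale0r subr0.
  rewrite mevalD mevalZ scalerDl -scalerA opprD addrACA -scalerBr.
  by apply: lidealD => //; apply: lidealZ.
apply: contrapT => /eqP pa; apply: m1.
have := lidealZ (p.@[a])^-1 ml (mB _ _ mp (ev p)).
by rewrite opprB addrC subrK scalerA mulVf // scale1r.
Qed.

(** A variable none of whose powers lies in the ideal of the forms is set to 1, and the affine
    system so obtained has a zero. *)
Lemma common_zero : (N < M)%N -> exists a : 'I_M -> K, (exists i, a i != 0) /\
  forall l, (f l).@[a] = 0.
Proof.
move=> NM; have /existsNP[i /forallNP Xi] := nilpotent_impossible NM.
have Jl := fideal_lideal; have [J0 JB JM] := Jl.
pose I : set P := [set p | exists h, fideal (p - h * ('X_i - 1))].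
have Il : lideal I.
  split; first by exists 0; rewrite mul0r subr0.
    move=> x y [h hx] [h' hy]; exists (h - h'); have := JB _ _ hx hy.
    by set w := 'X_i - 1; rewrite mulrBl !opprD !opprK addrACA.
  by move=> a x [h hx]; exists (a * h); rewrite -mulrA -mulrBr; apply: (JM).
(* The substitution of X_j / X_i for X_j sends X_i - 1 to 0. Clearing denominators in 1 = sum q f
   would put a power of X_i into the ideal. *)
have I1 : ~ I 1.
  move=> [h [q e]].
  pose F := {fraction P}.
  pose X : F := tofrac ('X_i : P).
  pose phi : P -> F := mmap (tofrac \o @mpolyC M K) (fun j => tofrac ('X_j : P) / X).
  have X0 : X != 0.
    rewrite tofrac_eq0; apply/eqP => /(congr1 (mcoeff U_(i))); rewrite mcoeffXU mcoeff0 eqxx.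
    by move/eqP; rewrite oner_eq0.
  have phiQ (p : P) D : (forall u, u \in msupp p -> (mdeg u <= D)%N) ->
      phi p * X ^+ D = tofrac (\sum_(u <- msupp p) p@_u *: ('X_[u] * 'X_i ^+ (D - mdeg u)) : P).
    move=> pD; rewrite {1}[p]mpolyE /phi raddf_sum mulr_suml raddf_sum /=.
    apply: eq_big_seq => u /pD uD.
    rewrite -!mul_mpolyC rmorphM /= mmapC mmapX !tofracM /= -mulrA; congr (_ * _).
    rewrite -{1}(subnKC uD) exprD mulrA tofracXn; congr (_ * _).
    rewrite mdegE -prodrXr /mmap1 -big_split /= mpolyXE_id rmorph_prod.
    by apply: eq_bigr => j _; rewrite -exprMn mulfVK // rmorphXn.
  have phiX : phi 'X_i = 1 by rewrite /phi mmapX mmap1U divff.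
  have phif l : phi (f l) * X ^+ r = tofrac (f l).
    have /dhomogP fd := fh l.
    rewrite phiQ => [|u /fd ->] //; congr tofrac; rewrite [RHS]mpolyE.
    by apply: eq_big_seq => u /fd /= ->; rewrite subnn mulr1.
  have ph1 : 1 = \sum_l phi (q l) * phi (f l).
    have phiM x y : phi (x * y) = phi x * phi y by exact: rmorphM.
    have phiB x y : phi (x - y) = phi x - phi y by exact: rmorphB.
    have phi1 : phi 1 = 1 by exact: rmorph1.
    have := congr1 phi e; rewrite !phiB phiM phiB phi1 phiX subrr mulr0 subr0 => ->.
    by rewrite /phi rmorph_sum; apply: eq_bigr => l _; apply: phiM.
  pose D := (\max_l msize (q l))%N.
  have qD l u : u \in msupp (q l) -> (mdeg u <= D)%N.
    move=> /msize_mdeg_lt lt; apply: leq_trans (ltnW lt) _.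
    exact: (@leq_bigmax _ (fun l => msize (q l)) l).
  apply: (Xi (D + r)%N).
  exists (fun l => \sum_(u <- msupp (q l)) (q l)@_u *: ('X_[u] * 'X_i ^+ (D - mdeg u))).
  apply/eqP; rewrite -tofrac_eq; apply/eqP; rewrite rmorph_sum rmorphXn /= -/X -[LHS]mul1r ph1 mulr_suml.
  by apply: eq_bigr => l _; rewrite tofracM -phif -phiQ; [rewrite exprD mulrACA|exact: qD].
have [m [mm Im]] := ex_lmax Il I1.
have [a aP] := maximal_point mm; exists a; split.
  exists i; have : m ('X_i - 1) by apply: Im; exists 1; rewrite mul1r subrr.
  move/aP; rewrite mevalB mevalXU meval1 => /eqP; rewrite subr_eq0 => /eqP ->.
  exact: oner_neq0.
move=> l; apply: aP; apply: Im; exists 0; rewrite mul0r subr0.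
exists (fun l' => (l' == l)%:R); rewrite (bigD1 l) //= eqxx mul1r big1 ?addr0 //.
by move=> l' /negPf ->; rewrite mul0r.
Qed.

End Common.

Lemma singular_combination (K : fieldType)
    (Kc : forall p : {poly K}, (1 < size p)%N -> exists x, root p x)
    (Kunc : ~ countable [set: K]) N M r (B : 'I_N -> 'I_M -> 'M[K]_r) :
  (0 < r)%N -> (N < M)%N ->
  exists a : 'I_M -> K, (exists i, a i != 0) /\ forall l, \det (\sum_i a i *: B l i) = 0.
Proof.
move=> r0 NM.
pose X l : 'M[{mpoly K[M]}]_r := \matrix_(s, t) \sum_i B l i s t *: 'X_i.
have Xh l s t : X l s t \is 1.-homog.
  rewrite mxE; apply: rpred_sum => i _; apply: rpredZ; rewrite dhomogX.
  by apply/eqP; exact: mdeg1.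
have fh l : \det (X l) \is r.-homog.
  apply: rpred_sum => s _.
  have ph (T : Type) (u : seq T) (F : T -> {mpoly K[M]}) :
      (forall i, F i \is 1.-homog) -> \prod_(i <- u) F i \is (size u).-homog.
    move=> Fh; elim: u => [|i u IH]; first by rewrite big_nil dhomog1.
    by rewrite big_cons; apply: (dhomogM (d := 1%N) (e := size u)).
  have := ph _ (enum 'I_r) (fun i => X l i (s i)) (fun i => Xh l i (s i)).
  rewrite size_enum_ord big_enum /=.
  by case: (odd_perm s) => h; rewrite ?mul1r // mulN1r rpredN.
have [a [a0 aP]] := common_zero Kc Kunc fh r0 NM.
exists a; split=> // l; rewrite -[RHS](aP l) -det_map_mx; congr (\det _).
apply/matrixP => s t; rewrite !mxE summxE raddf_sum; apply: eq_bigr => i _.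
by rewrite mxE /= mevalZ mevalXU mulrC.
Qed.

(** * Uncountable families of representations *)

Lemma dual_family (K : fieldType) (V : lmodType K) (S T : finType) (e : S -> V) (f : T -> V -> K) :
  (forall t x y, f t (x + y) = f t x + f t y) -> (forall t c x, f t (c *: x) = c * f t x) ->
  (forall r : T -> K, (forall s, \sum_t r t * f t (e s) = 0) -> forall t, r t = 0) ->
  exists w : T -> S -> K, forall t t', f t (\sum_s w t' s *: e s) = (t == t')%:R.
Proof.
move=> fD fZ ind.
pose B : 'M[K]_(#|T|, #|S|) := \matrix_(i, j) f (enum_val i) (e (enum_val j)).
have Bf : row_free B.
  apply/row_freeP; exists (pinvmx B); apply: mulmxVp.
  rewrite -kermx_eq0; apply/rowV0P => u /sub_kermxP uB.
  apply/rowP => i; rewrite mxE -[i]enum_valK.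
  apply: (ind (fun t => u 0 (enum_rank t))) => s.
  have := congr1 (fun X : 'rV_ _ => X 0 (enum_rank s)) uB; rewrite !mxE => E.
  apply: etrans E; rewrite (reindex (@enum_val T predT)) /=; last exact/onW_bij/enum_val_bij.
  by apply: eq_bigr => j _; rewrite enum_valK mxE enum_rankK.
exists (fun t' s => pinvmx B (enum_rank s) (enum_rank t')) => t t'.
have f0 : f t 0 = 0 by apply: (@addrI _ (f t 0)); rewrite -fD !addr0.
rewrite (big_morph _ (fD t) f0).
have := congr1 (fun X : 'M_(_, _) => X (enum_rank t) (enum_rank t')) (mulmxVp Bf).
rewrite !mxE (inj_eq enum_rank_inj) => E; apply: etrans E.
rewrite (reindex (@enum_val S predT)) /=; last exact/onW_bij/enum_val_bij.
by apply: eq_bigr => j _; rewrite fZ enum_valK [B _ _]mxE enum_rankK mulrC.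
Qed.

Lemma countableU (T : choiceType) (F G : set T) : countable F -> countable G -> countable (F `|` G).
Proof.
move=> cF cG; rewrite -bigcup2E; by apply: bigcup_countable => // -[|[|n]] _ //=.
Qed.

Section Families.
Variables (k : fieldType) (A : algType k) (g : nat) (v : 'I_g -> A).
Variables (K : fieldType) (iota : {rmorphism k -> K}).
Hypothesis Vall : forall x, exists n, Vn v n x.
Variables (d : nat) (Lam : choiceType) (rho : Lam -> A -> 'M[K]_d).
Hypothesis rhoP : forall l, rep iota (rho l).
Hypothesis sep : forall l l', l != l' -> exists x, rho l x != 0 /\ rho l' x = 0.
Variables (I : set A) (D : nat).
Hypothesis Il : lideal I.
Hypothesis Irho : forall l x, I x -> rho l x = 0.
Hypothesis Ifin : forall n, exists (T : finType) (u : T -> A),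
  [/\ (#|T| <= D * n.+1)%N, forall t, Vn v n (u t) & forall x, Vn v n x -> kdep I u x].

Let M := Lam -> 'M[K]_d.

(** The K-span of the functions l -> rho l a for a of degree n. The coefficients do not depend on l,
    and this ties the points together. *)
Definition aK (n : nat) : set M := [set y | exists (T : finType) (c : T -> K) (a : T -> A),
  (forall t, Vn v n (a t)) /\ forall l, y l = \sum_t c t *: rho l (a t)].

Lemma fZE (c : K) (x : M) l : (c *: x) l = c *: x l.
Proof. by []. Qed.

Lemma fDE (x y : M) l : (x + y) l = x l + y l.
Proof. by []. Qed.

Lemma aK_rho n a : Vn v n a -> aK n (fun l => rho l a).
Proof.
move=> Va; exists unit, (fun=> 1), (fun=> a); split=> // l.
by rewrite (big_pred1 tt) => [|[]//]; rewrite scale1r.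
Qed.

Lemma aKD n x y : aK n x -> aK n y -> aK n (x + y).
Proof.
move=> [S [c [a [Va xE]]]] [T [c' [a' [Va' yE]]]].
exists (S + T)%type, (fun s => match s with inl s => c s | inr t => c' t end),
  (fun s => match s with inl s => a s | inr t => a' t end).
split=> [[]//|l]; rewrite fDE xE yE.
by rewrite big_sumType.
Qed.

Lemma aKZ n c x : aK n x -> aK n (c *: x).
Proof.
move=> [S [b [a [Va xE]]]]; exists S, (fun s => c * b s), a; split=> // l.
by rewrite fZE xE scaler_sumr; apply: eq_bigr => s _; rewrite scalerA.
Qed.

Lemma aK_sum n (T : finType) (x : T -> M) : (forall t, aK n (x t)) -> aK n (\sum_t x t).
Proof.
move=> ax; elim/big_ind: _ => //; last exact: aKD.
by exists void, (fun=> 0), (fun=> 0); split=> [[]|l]; rewrite big1 // => -[].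
Qed.

Lemma aK_mono m n x : (m <= n)%N -> aK m x -> aK n x.
Proof.
move=> mn [T [c [a [Va xE]]]]; exists T, c, a; split=> // t; exact: Vn_mono (Va t).
Qed.

Definition fmulmx (x y : M) : M := fun l => x l *m y l.

Lemma aKM m n x y : aK m x -> aK n y -> aK (m + n) (fmulmx x y).
Proof.
move=> [S [c [a [Va xE]]]] [T [c' [a' [Va' yE]]]].
exists (S * T)%type, (fun p => c p.1 * c' p.2), (fun p => a p.1 * a' p.2); split.
  by move=> t; apply: VnM.
move=> l; rewrite /fmulmx xE yE mulmx_suml -(pair_bigA _ (fun s t => (c s * c' t) *: rho l (a s * a' t))).
apply: eq_bigr => s _; rewrite mulmx_sumr; apply: eq_bigr => t _ /=.
by rewrite -scalemxAl -scalemxAr scalerA (repM (rhoP l)).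
Qed.

Lemma aK_span n : exists (T : finType) (u : T -> M),
  [/\ (#|T| <= D * n.+1)%N, forall t, aK n (u t) &
      forall y, aK n y -> exists c : T -> K, y = \sum_t c t *: u t].
Proof.
have [T [u [cT Vu du]]] := Ifin n.
exists T, (fun t l => rho l (u t)); split=> // [t|y [S [c [a [Va yE]]]]]; first exact: aK_rho.
have /choice[b bP] : forall s, exists b : T -> k, I (a s - \sum_t b t *: u t).
  by move=> s; apply: du.
exists (fun t => \sum_s c s * iota (b s t)); apply/funext => l.
rewrite fct_sumE yE.
rewrite (eq_bigr (fun s => \sum_t (c s * iota (b s t)) *: rho l (u t))).
  rewrite exchange_big; apply: eq_bigr => t _ /=.
  by rewrite -scaler_suml.
move=> s _; have := Irho l (bP s).
rewrite (repD (rhoP l)) -scaleN1r (repZ (rhoP l)) rmorphN1 scaleN1r => /eqP; rewrite subr_eq0 => /eqP ->.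
rewrite (rep_sum _ (rhoP l)) scaler_sumr; apply: eq_bigr => t _.
by rewrite (repZ (rhoP l)) scalerA.
Qed.

Lemma family_fill (T : finType) (l : T -> Lam) (xi : T -> 'rV[K]_d) m (w : T -> 'M[K]_(d, m)) :
  injective l ->
  (forall x, Vn v (#|T| * d) x -> \sum_t xi t *m rho (l t) x *m w t = 0) ->
  forall t, xi t = 0 \/ w t = 0.
Proof.
move=> li; apply: (fill Vall (fun t => rhoP (l t))) => t t' tt'; apply: sep.
by rewrite (inj_eq li).
Qed.

Lemma uncountable_diff (F G : set Lam) : ~ countable F -> countable G ->
  ~ countable [set l | F l /\ ~ G l].
Proof.
move=> nF cG c; apply: nF.
apply: (@sub_countable _ _ _ ([set l | F l /\ ~ G l] `|` G)).
  by apply: subset_card_le => l Fl; case: (pselect (G l)); [right|left].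
exact: countableU.
Qed.

Lemma uncountable_cases (F : set Lam) (G : nat -> set Lam) : ~ countable F ->
  (forall l, F l -> exists n, G n l) -> exists n, ~ countable (F `&` G n).
Proof.
move=> nF FG; apply: contrapT => /forallNP al; apply: nF.
apply: (@sub_countable _ _ _ (\bigcup_(n in [set: nat]) (F `&` G n))).
  by apply: subset_card_le => l Fl; have [n Gl] := FG l Fl; exists n.
by apply: bigcup_countable => // n _; apply: contrapT; apply: al.
Qed.

Lemma uncountable_inj (F : set Lam) n : ~ countable F ->
  exists f : 'I_n -> Lam, injective f /\ forall i, F (f i).
Proof. by move=> nF; apply: infinite_inj => fF; apply: nF; apply: finite_set_countable. Qed.

(** For each n the y in aK n that vanish off a countable set form a finite-dimensional space, so
    countably many points account for all of them. After their removal a y that is nonzero somewhere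
    is nonzero uncountably often. *)
Lemma clean_family (F : set Lam) : ~ countable F -> exists F', [/\ F' `<=` F, ~ countable F' &
  forall n y, aK n y -> countable [set l | F' l /\ y l <> 0] -> forall l, F' l -> y l = 0].
Proof.
move=> nF.
have /choice[S SP] : forall n, exists S : set Lam, countable S /\
    forall y, aK n y -> countable [set l | F l /\ y l <> 0] -> forall l, F l -> y l <> 0 -> S l.
  move=> n; have [T [u [_ au us]]] := aK_span n.
  pose y (c : 'rV[K]_#|T|) : M := \sum_i c 0 i *: u (enum_val i).
  have yD c c' : y (c + c') = y c + y c'.
    by rewrite /y -big_split; apply: eq_bigr => i _; rewrite mxE scalerDl.
  have yZ a c : y (a *: c) = a *: y c.
    by rewrite /y scaler_sumr; apply: eq_bigr => i _; rewrite mxE scalerA.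
  have y0 : y 0 = 0 by rewrite /y big1 // => i _; rewrite mxE scale0r.
  have [||| B BP] := @subspace_mx K #|T| [set c | countable [set l | F l /\ y c l <> 0]].
  - by rewrite /= y0; apply: (@sub_countable _ _ _ set0) => //; apply: subset_card_le => l [].
  - move=> c c' h h'; apply: (@sub_countable _ _ _ ([set l | F l /\ y c l <> 0] `|` [set l | F l /\ y c' l <> 0])).
      apply: subset_card_le => l [Fl]; rewrite yD => yl.
      case: (pselect (y c l = 0)) => yc; [right|by left].
      by split=> // yc'; apply: yl; rewrite fDE yc yc' addr0.
    exact: countableU.
  - move=> a c h; apply: sub_countable h; apply: subset_card_le => l [Fl]; rewrite yZ => yl.
    by split=> // yc; apply: yl; rewrite fZE yc scaler0.
  exists (\bigcup_(i in [set: 'I_#|T|]) [set l | F l /\ y (row i B) l <> 0]); split.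
    apply: bigcup_countable; first exact: countableP.
    by move=> i _; apply/BP; apply: row_sub.
  move=> z az cz l Fl zl; have [c zE] := us z az.
  pose c' : 'rV_#|T| := \row_i c (enum_val i).
  have yc' : y c' = z.
    rewrite zE (reindex (@enum_val T predT)) /=; last exact/onW_bij/enum_val_bij.
    by apply: eq_bigr => i _; rewrite mxE.
  have /submxP[e c'E] : (c' <= B)%MS by apply/BP; rewrite /= yc'.
  have zB : z = \sum_i e 0 i *: y (row i B).
    rewrite -yc' c'E mulmx_sum_row.
    by rewrite (big_morph y yD y0); apply: eq_bigr => i _; rewrite yZ.
  apply: contrapT => nS; apply: zl; rewrite zB fct_sumE big1 // => i _.
  rewrite fZE.
  case: (pselect (y (row i B) l = 0)) => [->|ne]; first by rewrite scaler0.
  by case: nS; exists i.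
pose G := \bigcup_(n in [set: nat]) S n.
exists [set l | F l /\ ~ G l]; split=> [l []//||n y ay cy l [Fl nG]].
  by apply: uncountable_diff => //; apply: bigcup_countable => // n _; case: (SP n).
apply: contrapT => yl; apply: nG; exists n => //; case: (SP n) => cS Sn; apply: (Sn y) => //.
apply: (@sub_countable _ _ _ ([set l | (F l /\ ~ G l) /\ y l <> 0] `|` G)).
  apply: subset_card_le => l' [Fl' yl']; case: (pselect (G l')); [by right|by left].
apply: countableU => //.
by apply: bigcup_countable => // i _; case: (SP i).
Qed.

Definition supported (F : set Lam) (psi : A -> K) := exists (S : finType) (l : S -> Lam)
   (xi : S -> 'rV[K]_d) (w : S -> 'cV[K]_d), (forall s, F (l s)) /\
   forall x, psi x = \sum_s (xi s *m rho (l s) x *m w s) 0 0.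

Lemma supportedD F psi psi' : supported F psi -> supported F psi' ->
  supported F (fun x => psi x + psi' x).
Proof.
move=> [S [l [xi [w [Fl E]]]]] [S' [l' [xi' [w' [Fl' E']]]]].
exists (S + S')%type, (fun s => match s with inl s => l s | inr t => l' t end),
  (fun s => match s with inl s => xi s | inr t => xi' t end),
  (fun s => match s with inl s => w s | inr t => w' t end).
split=> [[]//|x]; rewrite E E'.
have big_sum (F1 : S + S' -> K) : \sum_s F1 s = \sum_s F1 (inl s) + \sum_s F1 (inr s).
  exact: big_sumType.
by rewrite big_sum.
Qed.

Lemma supportedS F F' psi : F `<=` F' -> supported F psi -> supported F' psi.
Proof.
by move=> FF' [S [l [xi [w [Fl E]]]]]; exists S, l, xi, w; split=> // s; apply: FF'.
Qed.

(* Each step of a strictly decreasing chain of vanishing loci contributes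
   [N * d] functionals at [N] points removed in that step, so that a chain of
   length [m] contradicts the linear growth once [m] is large. *)
Lemma chain_step (F : set Lam) : ~ countable F ->
  (forall F', F' `<=` F -> ~ countable F' -> exists n y G,
     [/\ aK n y, G `<=` F', ~ countable G, forall l, G l -> y l = 0 & exists2 l, F' l & y l <> 0]) ->
  forall m, exists F' c, [/\ F' `<=` F, ~ countable F' & forall N, exists (T : finType) (phi : T -> A -> K),
    [/\ #|T| = (m * (N * d))%N, forall t, supported F (phi t) &
        forall (r : T -> K) psi, supported F' psi ->
          (forall x, Vn v (N * d + c) x -> \sum_t r t * phi t x + psi x = 0) -> forall t, r t = 0]].
Proof.
move=> nF step; elim=> [|m [F1 [c [F1F nF1 IH]]]].
  exists F, 0%N; split=> // N; exists void, (fun _ _ => 0); rewrite card_void; split=> //; by case.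
have [F2 [F21 nF2 cl]] := clean_family nF1.
have [n [y [G [ay G2 nG yG [l0 Fl0 yl0]]]]] := step F2 (fun l h => F1F _ (F21 _ h)) nF2.
have nY : ~ countable [set l | F2 l /\ y l <> 0].
  by move=> /(cl n y ay)/(_ l0 Fl0).
exists G, (c + n)%N; split=> [l Gl||N].
- by apply/F1F/F21/G2.
- by [].
have [T [phi [cT sphi phiP]]] := IH N.
have [l [linj lF]] := uncountable_inj N nY.
have /choice[w wP] : forall i, exists w : 'cV[K]_d, y (l i) *m w != 0.
  move=> i; case: (lF i) => _ yl; apply: contrapT => /forallNP nw; apply: yl.
  apply/matrixP => a b; rewrite mxE; have := nw (delta_mx b 0).
  by move=> /negP/negPn/eqP/colP/(_ a); rewrite -colE !mxE.
pose ph : 'I_N * 'I_d -> A -> K := fun p x => (delta_mx (0 : 'I_1) p.2 *m rho (l p.1) x *m w p.1) 0 0.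
pose phn (s : T + 'I_N * 'I_d) : A -> K := match s with inl t => phi t | inr p => ph p end.
exists (T + 'I_N * 'I_d)%type, phn.
split=> [|[t|p]|r psi psiG van].
- by rewrite card_sum cT card_prod !card_ord mulSn addnC.
- exact: sphi.
- exists unit, (fun=> l p.1), (fun=> delta_mx 0 p.2), (fun=> w p.1); split.
    by move=> _; apply/F1F/F21; case: (lF p.1).
  by move=> x; rewrite (big_pred1 tt) // => -[].
have big_sum (F0 : T + 'I_N * 'I_d -> K) : \sum_s F0 s = \sum_s F0 (inl s) + \sum_s F0 (inr s).
  exact: big_sumType.
pose xi i : 'rV[K]_d := \row_j r (inr (i, j)).
have phE x : \sum_p r (inr p) * ph p x = \sum_i (xi i *m rho (l i) x *m w i) 0 0.
  rewrite (eq_bigr (fun p => r (inr (p.1, p.2)) * ph (p.1, p.2) x)); last by case.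
  rewrite -(pair_bigA _ (fun i j => r (inr (i, j)) * ph (i, j) x)); apply: eq_bigr => i _ /=.
  have -> : xi i = \sum_j r (inr (i, j)) *: delta_mx 0 j.
    by rewrite [LHS]row_sum_delta; apply: eq_bigr => j _; rewrite mxE.
  rewrite !mulmx_suml summxE; apply: eq_bigr => j _.
  by rewrite -!scalemxAl [RHS]mxE.
have rT t : r (inl t) = 0.
  apply: (phiP (fun t => r (inl t)) (fun x => \sum_p r (inr p) * ph p x + psi x)).
    apply: supportedD; last by apply: supportedS psiG => z /G2 /F21.
    exists 'I_N, l, xi, w; split=> [i|x]; last exact: phE.
    by apply/F21; case: (lF i).
  move=> x Vx; have := van x; rewrite big_sum /= -addrA; apply; apply: Vn_mono Vx; lia.
have [S [c' [a [Va yE]]]] := ay.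
(* Testing on x * a s and summing with the coefficients of y inserts y at every point: psi lives
   where y vanishes and drops out. *)
have fl : forall i, xi i = 0 \/ y (l i) *m w i = 0.
  apply: (family_fill linj) => x; rewrite card_ord => Vx.
  apply/matrixP => i0 j0; rewrite !ord1 mxE summxE.
  have psi0 : \sum_s c' s * psi (x * a s) = 0.
    have [S' [l' [xi' [w' [Gl' E]]]]] := psiG.
    under eq_bigr => s _ do rewrite E mulr_sumr.
    rewrite exchange_big big1 //= => s' _.
    have := congr1 (fun X : 'M_1 => X 0 0) (congr1 (fun X => xi' s' *m rho (l' s') x *m X *m w' s') (yE (l' s'))).
    rewrite yG // mulmx0 mul0mx mxE mulmx_sumr mulmx_suml summxE => /esym e; apply: etrans e.
    apply: eq_bigr => s _; rewrite (repM (rhoP _)) mulmxA -scalemxAr -scalemxAl [RHS]mxE.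
    by congr (_ * (_ *m _) _ _); rewrite !mulmxA.
  have : \sum_s c' s * (\sum_i (xi i *m rho (l i) (x * a s) *m w i) 0 0 + psi (x * a s)) = 0.
    rewrite big1 // => s _; rewrite -phE; have := van (x * a s); rewrite big_sum /=.
    rewrite [X in X + _ + _]big1 ?add0r => [->|t _]; rewrite ?mulr0 ?rT ?mul0r //.
    by apply: (@Vn_mono _ _ _ _ (N * d + n)); [lia|apply: VnM].
  under eq_bigr => s _ do rewrite mulrDr.
  rewrite big_split /= psi0 addr0 => e; apply: etrans e.
  under [RHS]eq_bigr => s _ do rewrite mulr_sumr.
  rewrite exchange_big; apply: eq_bigr => i _ /=.
  rewrite yE mulmxA mulmx_sumr mulmx_suml summxE; apply: eq_bigr => s _.
  by rewrite (repM (rhoP _)) -scalemxAr -scalemxAl [LHS]mxE !mulmxA.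
move=> [t|[i j]]; first exact: rT.
case: (fl i) => [/rowP/(_ j)|e]; first by rewrite !mxE.
by have := wP i; rewrite e eqxx.
Qed.

(** Zero loci of the y act as closed sets; linear growth bounds the length of strictly descending
    chains of uncountable ones. *)
Lemma irreducible_family (F : set Lam) : ~ countable F -> exists F', [/\ F' `<=` F, ~ countable F' &
  forall n y G, aK n y -> G `<=` F' -> ~ countable G -> (forall l, G l -> y l = 0) ->
    forall l, F' l -> y l = 0].
Proof.
move=> nF; apply: contrapT => nex.
have d0 : (0 < d)%N.
  by have [l _] := uncountable_inj 1 nF; exact: rep_pos (rhoP (l ord0)).
have [|F1 [c [_ nF1 FP]]] := chain_step nF _ D.+1.
  move=> F' F'F nF'; apply: contrapT => ne; apply: nex; exists F'; split=> // n y G ay GF nG yG l Fl.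
  by apply: contrapT => yl; apply: ne; exists n, y, G; split=> //; exists l.
(* Then N d > D (c + 1), so (D + 1) N d functionals exceed the dimension bound D (N d + c + 1). *)
pose N := (D * c.+1).+1.
have [T [phi [cT sphi phiP]]] := FP N.
have [S [u [cS Vu du]]] := Ifin (N * d + c).
have : (#|T| <= #|S|)%N.
  apply: (functional_count (iota := iota) (I := I) (V := Vn v (N * d + c)) (f := phi) (u := u)) => //.
  - move=> t x y; have [S' [l [xi [w [_ E]]]]] := sphi t; rewrite !E -big_split.
    by apply: eq_bigr => s _; rewrite (repD (rhoP _)) mulmxDr mulmxDl mxE.
  - move=> t a x; have [S' [l [xi [w [_ E]]]]] := sphi t; rewrite !E mulr_sumr.
    by apply: eq_bigr => s _; rewrite (repZ (rhoP _)) -scalemxAr -scalemxAl mxE.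
  - move=> t x Ix; have [S' [l [xi [w [_ E]]]]] := sphi t; rewrite E big1 // => s _.
    by rewrite Irho // mulmx0 mul0mx mxE.
  move=> r rP; apply: (phiP r (fun=> 0)).
    by exists void, (of_void Lam), (fun=> 0), (fun=> 0); split=> [[]|x]; rewrite big1 // => -[].
  by move=> x Vx; rewrite addr0; apply: rP.
rewrite cT; move=> /leq_trans/(_ cS); rewrite leqNgt => /negP; apply.
have : (D * c.+1 < N * d)%N by rewrite /N; nia.
nia.
Qed.

End Families.

Lemma full_rank_factorization (K : fieldType) m n r (b : 'M[K]_(m, n)) : \rank b = r ->
  exists (B : 'M_(m, r)) (C : 'M_(r, n)) (B' : 'M_(r, m)) (C' : 'M_(n, r)),
  [/\ b = B *m C, B' *m B = 1%:M & C *m C' = 1%:M].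
Proof.
move=> <-; have /row_fullP[B' BB] := col_base_full b.
have /row_freeP[C' CC] := row_base_free b.
by exists (col_base b), (row_base b), B', C'; rewrite mulmx_base.
Qed.

(** * Elements of rank one on an uncountable family *)

Section RankOne.
Variables (k : fieldType) (A : algType k) (g : nat) (v : 'I_g -> A).
Variables (K : fieldType) (iota : {rmorphism k -> K}).
Hypothesis Kc : forall p : {poly K}, (1 < size p)%N -> exists x, root p x.
Hypothesis Kunc : ~ countable [set: K].
Hypothesis Vall : forall x, exists n, Vn v n x.
Variables (d : nat) (Lam : choiceType) (rho : Lam -> A -> 'M[K]_d).
Hypothesis rhoP : forall l, rep iota (rho l).
Hypothesis sep : forall l l', l != l' -> exists x, rho l x != 0 /\ rho l' x = 0.
Variables (I : set A) (D : nat).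
Hypothesis Irho : forall l x, I x -> rho l x = 0.
Hypothesis Ifin : forall n, exists (T : finType) (u : T -> A),
  [/\ (#|T| <= D * n.+1)%N, forall t, Vn v n (u t) & forall x, Vn v n x -> kdep I u x].

Local Notation M := (Lam -> 'M[K]_d).
Local Notation aK := (aK v rho).

Section Minimal.
Variables (F : set Lam) (b : M) (c r : nat).
Hypothesis nF : ~ countable F.
Hypothesis ab : aK c b.
Hypothesis rb : forall l, F l -> \rank (b l) = r.
Hypothesis r0 : (0 < r)%N.
Hypothesis irr : forall n y G, aK n y -> G `<=` F -> ~ countable G ->
  (forall l, G l -> y l = 0) -> forall l, F l -> y l = 0.
Hypothesis rmin : forall n y G, aK n y -> G `<=` F -> ~ countable G ->
  (forall l, G l -> \rank (y l) < r)%N -> forall l, F l -> y l = 0.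

(** Modulo [Z] only the compression of y by b counts; the r by r matrices C y B represent it
    below. *)
Let Z : set M := [set y | forall l, F l -> b l *m y l *m b l = 0].

Let HZ : domain_action (fun (a : K) (x : M) => a *: x) setT Z.
Proof.
apply: kact_domain.
- by move=> l _; rewrite mulmx0 mul0mx.
- move=> x y Zx Zy l Fl; rewrite [(x - y) l]/(x l - y l) mulmxBr mulmxBl Zx // Zy //.
  by rewrite subr0.
- by move=> a x Zx l Fl; rewrite fZE -scalemxAr -scalemxAl Zx // scaler0.
Qed.

Let ZZ (a : K) (x : M) : Z x -> Z (a *: x).
Proof. exact: (dact_Zact HZ). Qed.

Lemma ex_dimension : exists h : nat -> nat,
  [/\ forall n, (h n <= D * n.+1)%N,
      forall n, exists y : 'I_(h n) -> M,
        [/\ forall i, aK n (y i), kfree Z y & forall x, aK n x -> kdep Z y x] &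
      forall n (T : finType) (x : T -> M), (forall t, aK n (x t)) -> kfree Z x -> (#|T| <= h n)%N].
Proof.
have bnd n (T : finType) (x : T -> M) : (forall t, aK n (x t)) -> kfree Z x -> (#|T| <= D * n.+1)%N.
  move=> ax fx; have [S [u [cS au us]]] := aK_span rhoP Irho Ifin n.
  apply: leq_trans cS; apply: (@steinitz _ _ _ _ _ HZ T S x u _ _ fx) => // t.
  have [a xE] := us _ (ax t); exists 1; split; first exact: oner_neq0.
  by exists a; rewrite scale1r xE subrr; apply: (dact_Z0 HZ).
have /choice[h hP] : forall n, exists h : nat, exists y : 'I_h -> M,
    [/\ forall i, aK n (y i), kfree Z y & forall x, aK n x -> kdep Z y x].
  move=> n; have [T [y [ay fy dy]]] := @rfree_max _ _ _ _ _ HZ (aK n) _ (fun _ _ => Logic.I) (bnd n).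
  exists #|T|, (y \o enum_val); split=> [i||x ax]; first exact: ay.
    by apply: (rfree_inj HZ) => //; apply: enum_val_inj.
  apply/kdepP; first exact: ZZ.
  apply: (rdep_trans HZ _ _ _ (dy x ax)) => // t.
  by rewrite -[t]enum_rankK; apply: (rdep_mem HZ (x := y \o enum_val)).
exists h; split=> // n.
  have [y [ay fy _]] := hP n; have := bnd n _ y ay fy; by rewrite card_ord.
move=> T x ax fx; have [y [ay fy dy]] := hP n.
rewrite -(card_ord (h n)); apply: (@steinitz _ _ _ _ _ HZ T _ x y _ _ fx) => // t.
by apply/kdepP; [exact: ZZ|apply: dy].
Qed.

Lemma ex_factor : exists (B : Lam -> 'M[K]_(d, r)) (C : Lam -> 'M[K]_(r, d))
    (B' : Lam -> 'M[K]_(r, d)) (C' : Lam -> 'M[K]_(d, r)),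
  forall l, F l -> [/\ b l = B l *m C l, B' l *m B l = 1%:M & C l *m C' l = 1%:M].
Proof.
have /choice[f fP] : forall l, exists f : ('M[K]_(d, r) * 'M[K]_(r, d)) * ('M[K]_(r, d) * 'M[K]_(d, r)),
    F l -> [/\ b l = f.1.1 *m f.1.2, f.2.1 *m f.1.1 = 1%:M & f.1.2 *m f.2.2 = 1%:M].
  move=> l; case: (pselect (F l)) => [Fl|]; last by exists ((0, 0), (0, 0)).
  have [B [C [B' [C' H]]]] := full_rank_factorization (rb Fl).
  by exists ((B, C), (B', C')).
by exists (fun l => (f l).1.1), (fun l => (f l).1.2), (fun l => (f l).2.1), (fun l => (f l).2.2).
Qed.

Variables (B : Lam -> 'M[K]_(d, r)) (C : Lam -> 'M[K]_(r, d)).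
Variables (B' : Lam -> 'M[K]_(r, d)) (C' : Lam -> 'M[K]_(d, r)).
Hypothesis BC : forall l, F l -> [/\ b l = B l *m C l, B' l *m B l = 1%:M & C l *m C' l = 1%:M].

Let G (l : Lam) (X : 'M[K]_d) : 'M[K]_r := C l *m X *m B l.

Lemma compressE l (X : 'M[K]_d) : F l -> b l *m X *m b l = B l *m G l X *m C l.
Proof. by move=> /BC[-> _ _]; rewrite /G !mulmxA. Qed.

Lemma compress0 l (X : 'M[K]_r) : F l -> B l *m X *m C l = 0 -> X = 0.
Proof.
move=> /BC[_ BB CC] e.
have := congr1 (fun Y => B' l *m Y *m C' l) e.
by rewrite mulmx0 mul0mx !mulmxA BB mul1mx -mulmxA CC mulmx1.
Qed.

Lemma Z_compress (y : M) : Z y <-> forall l, F l -> G l (y l) = 0.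
Proof.
split=> [Zy l Fl|Gy l Fl]; first by apply: (compress0 Fl); rewrite -compressE //; apply: Zy.
by rewrite compressE // Gy // mulmx0 mul0mx.
Qed.

(** [family_fill] applies because B has a left inverse and C a right inverse. *)
Lemma compress_functionals N (l : 'I_N -> Lam) (s : 'I_N -> 'cV[K]_r) n (a : 'I_N * 'I_r -> K) :
  injective l -> (forall i, F (l i)) -> (forall i, s i != 0) -> (N * d <= n)%N ->
  (forall y, aK n y -> \sum_p a p * (G (l p.1) (y (l p.1)) *m s p.1) p.2 0 = 0) ->
  forall p, a p = 0.
Proof.
move=> linj lF s0 le van [i j].
pose e i : 'rV[K]_r := \row_j a (i, j).
have [|eC|Bs] := @family_fill k A g v K iota Vall d Lam rho rhoP sep 'I_N l
    (fun i => e i *m C (l i)) 1 (fun i => B (l i) *m s i) linj _ i.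
- move=> x; rewrite card_ord => Vx.
  apply/matrixP => i0 j0; rewrite !ord1 mxE summxE.
  have := van _ (aK_rho rho (Vn_mono le Vx)) => E; apply: etrans E.
  rewrite [RHS](eq_bigr (fun p => a (p.1, p.2) * (G (l p.1) (rho (l p.1) x) *m s p.1) p.2 0)); last by case.
  rewrite -(pair_bigA _ (fun i j => a (i, j) * (G (l i) (rho (l i) x) *m s i) j 0)); apply: eq_bigr => i' _ /=.
  have -> : e i' *m C (l i') *m rho (l i') x *m (B (l i') *m s i') =
      e i' *m (G (l i') (rho (l i') x) *m s i') by rewrite /G !mulmxA.
  by rewrite mxE; apply: eq_bigr => j' _; rewrite [e i' _ _]mxE.
- have [_ _ CC] := BC (lF i).
  have : e i = 0 by rewrite -[LHS]mulmx1 -CC mulmxA eC mul0mx.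
  by move/rowP/(_ j); rewrite !mxE.
have [_ BB _] := BC (lF i).
by have := s0 i; rewrite -[s i]mul1mx -BB -mulmxA Bs mulmx0 eqxx.
Qed.

Lemma compress_span N (l : 'I_N -> Lam) (s : 'I_N -> 'cV[K]_r) n (T : finType) (e : T -> M)
    (a : 'I_N * 'I_r -> K) : (forall i, F (l i)) -> (forall x, aK n x -> kdep Z e x) ->
  (forall t, \sum_p a p * (G (l p.1) (e t (l p.1)) *m s p.1) p.2 0 = 0) ->
  forall y, aK n y -> \sum_p a p * (G (l p.1) (y (l p.1)) *m s p.1) p.2 0 = 0.
Proof.
move=> lF de van y ay; have [w /Z_compress Zw] := de y ay.
rewrite (eq_bigr (fun p => \sum_t w t * (a p * (G (l p.1) (e t (l p.1)) *m s p.1) p.2 0))).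
  by rewrite exchange_big big1 //= => t _; rewrite -mulr_sumr van mulr0.
move=> p _.
have -> : G (l p.1) (y (l p.1)) = \sum_t w t *: G (l p.1) (e t (l p.1)).
  have := Zw _ (lF p.1).
  rewrite [(y - _) _]/(y (l p.1) - (\sum_t w t *: e t) (l p.1)) fct_sumE /G mulmxBr mulmxBl.
  move/eqP; rewrite subr_eq0 => /eqP ->; rewrite mulmx_sumr mulmx_suml.
  by apply: eq_bigr => t _; rewrite fZE -scalemxAr -scalemxAl.
rewrite mulmx_suml summxE mulr_sumr; apply: eq_bigr => t _.
by rewrite -scalemxAl mxE mulrCA.
Qed.

Section Growth.
Variable h : nat -> nat.
Hypothesis hspan : forall n, exists y : 'I_(h n) -> M,
        [/\ forall i, aK n (y i), kfree Z y & forall x, aK n x -> kdep Z y x].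
Hypothesis hmax : forall n (T : finType) (x : T -> M),
  (forall t, aK n (x t)) -> kfree Z x -> (#|T| <= h n)%N.

(* If [x] in [aK n] has compressions [G l x] singular at [(h n).-1] prescribed
   points, then right multiplication by [b x] embeds the compression of [aK m] in
   that of [aK (m + n + c)], and [r] functionals at each of these points vanish on the image. *)
Lemma dimension_gain m n : ((h n).-1 * d <= m + n + c)%N ->
  (h m + (h n).-1 * r <= h (m + n + c))%N.
Proof.
move=> le; have [z [az fz _]] := hspan m.
have [e0|hn] := posnP (h n).
  rewrite e0 /= mul0n addn0 -[h m]card_ord; apply: (hmax _ fz) => t.
  by apply: aK_mono (az t); lia.
set N := (h n).-1 in le *.
have : exists y : 'I_N.+1 -> M, [/\ forall i, aK n (y i), kfree Z y & forall x, aK n x -> kdep Z y x].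
  by rewrite /N (prednK hn); apply: hspan.
case=> y [ay fy dy].
have [l [linj lF]] := uncountable_inj N nF.
have [a [[i0 ai0] aP]] := singular_combination Kc Kunc
  (fun (i : 'I_N) (j : 'I_N.+1) => G (l i) (y j (l i))) r0 (ltnSn N).
pose x : M := \sum_j a j *: y j.
have ax : aK n x by apply: aK_sum => j; apply: aKZ.
have nZx : ~ Z x by move=> Zx; case/eqP: ai0; apply: (fy a).
have GxE l' : G l' (x l') = \sum_j a j *: G l' (y j l').
  rewrite /x fct_sumE /G mulmx_sumr mulmx_suml; apply: eq_bigr => j _.
  by rewrite fZE -scalemxAr -scalemxAl.
have /choice[s sP] : forall i, exists s : 'cV[K]_r, s != 0 /\ G (l i) (x (l i)) *m s = 0.
  move=> i; have := aP i; rewrite -GxE -det_tr => /eqP/det0P[u u0 uG].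
  exists u^T; split; first by rewrite -trmx0 (inj_eq (@trmx_inj _ _ _)).
  by apply: trmx_inj; rewrite trmx_mul trmxK uG trmx0.
have [e [ae fe de]] := hspan (m + n + c).
pose f (p : 'I_N * 'I_r) (u : M) : K := (G (l p.1) (u (l p.1)) *m s p.1) p.2 0.
have fD p u w : f p (u + w) = f p u + f p w.
  by rewrite /f /G fDE mulmxDr !mulmxDl mxE.
have fZ p q u : f p (q *: u) = q * f p u.
  by rewrite /f /G fZE -scalemxAr -!scalemxAl mxE.
have fZ0 p u : Z u -> f p u = 0.
  by move=> /Z_compress Zu; rewrite /f Zu // mul0mx mxE.
have f0 p : f p 0 = 0 by apply: fZ0; apply: (dact_Z0 HZ).
have fS p (T : finType) (u : T -> M) : f p (\sum_t u t) = \sum_t f p (u t).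
  exact: (big_morph _ (fD p) (f0 p)).
have find (q : 'I_N * 'I_r -> K) : (forall t, \sum_p q p * f p (e t) = 0) -> forall p, q p = 0.
  move=> van; apply: (compress_functionals linj lF (fun i => (sP i).1) le) => u au.
  exact: (compress_span lF de van).
have [w wP] := dual_family fD fZ find.
pose z' : 'I_(h m) -> M := fun j => fmulmx (fmulmx (z j) b) x.
pose w' : 'I_N * 'I_r -> M := fun p => \sum_t w p t *: e t.
pose X (u : 'I_(h m) + 'I_N * 'I_r) : M := match u with inl j => z' j | inr p => w' p end.
have aX u : aK (m + n + c) (X u).
  case: u => [j|p]; last by apply: aK_sum => t; apply: aKZ.
  by apply: (@aK_mono _ _ _ _ _ _ _ _ (m + c + n)); [lia|do !apply: aKM].
suff fX : kfree Z X by have := hmax aX fX; rewrite card_sum card_prod !card_ord.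
move=> q Zq.
have {Zq} Zq : Z (\sum_j q (inl j) *: z' j + \sum_p q (inr p) *: w' p).
  by have := Zq; rewrite big_sumType.
have fz' p j : f p (z' j) = 0.
  rewrite /f /G /z' /fmulmx; have [-> _ _] := BC (lF p.1).
  have [_ e'] := sP p.1; rewrite /G in e'.
  by rewrite !mulmxA -[_ *m C (l p.1) *m _]mulmxA -[_ *m (C _ *m _) *m _]mulmxA
    -[_ *m (_ *m B _) *m _]mulmxA e' mulmx0 mxE.
have q0 p : q (inr p) = 0.
  have := fZ0 p _ Zq; rewrite fD !fS big1 ?add0r => [|j _]; last by rewrite fZ fz' mulr0.
  rewrite (bigD1 p) //= big1 ?addr0 => [|p' pp']; last first.
    by rewrite fZ /w' wP eq_sym (negPf pp') mulr0.
  by rewrite fZ /w' wP eqxx mulr1.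
move: Zq; rewrite [X in _ + X]big1 ?addr0 => [Zq|p _]; last by rewrite q0 scale0r.
pose u : M := \sum_j q (inl j) *: z j.
have Gu l' : F l' -> G l' (u l') *m G l' (x l') = 0.
  move=> Fl; have /Z_compress/(_ l' Fl) e' := Zq.
  apply: etrans e'; have [bE _ _] := BC Fl.
  rewrite /u !fct_sumE /G !mulmx_sumr !mulmx_suml; apply: eq_bigr => j _.
  rewrite !fZE /z' /fmulmx bE -!scalemxAr -!scalemxAl; congr (_ *: _).
  by rewrite !mulmxA.
have bxb : aK (c + n + c) (fmulmx (fmulmx b x) b) by do !apply: aKM.
have ncx : countable [set l' | F l' /\ (\rank (fmulmx (fmulmx b x) b l') < r)%N].
  apply: contrapT => nc; apply: nZx => l' Fl'.
  by apply: (rmin bxb _ nc _ Fl') => l'' [].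
case=> [j|p]; last exact: q0.
apply: (fz (fun j => q (inl j))) => /= l' Fl'.
have bub : aK (c + m + c) (fmulmx (fmulmx b u) b).
  by do !apply: aKM => //; apply: aK_sum => i; apply: aKZ.
apply: (irr bub _ (uncountable_diff nF ncx) _ Fl') => [l'' []//|l'' [Fl nx]].
have rG : row_free (G l'' (x l'')).
  rewrite /row_free eqn_leq rank_leq_row leqNgt; apply/negP => lt; apply: nx; split=> //.
  rewrite /fmulmx compressE // -mulmxA; apply: leq_ltn_trans (mxrankM_maxr _ _) _.
  exact: leq_ltn_trans (mxrankM_maxl _ _) lt.
have Gu0 : G l'' (u l'') = 0 by apply: (row_free_inj rG); rewrite Gu // mul0mx.
by rewrite /fmulmx compressE // Gu0 mulmx0 mul0mx.
Qed.

(** By [dimension_gain] the value h n forces h to have asymptotic slope at least r (h n - 1) / (n +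
    c). Repetition gains a factor r each time, so r^i (h n - 1) <= D (n + c + 1) for all i, which is
    impossible for r > 1 once h n > 1. *)
Lemma minimal_rank_one (hle : forall n, (h n <= D * n.+1)%N) : r = 1%N.
Proof.
have bound i n : (r ^ i * (h n).-1 <= D * (n + c).+1)%N.
  elim: i n => [|i IH] n.
    by rewrite mul1n; apply: leq_trans (leq_pred _) (leq_trans (hle n) _); rewrite leq_mul2l; lia.
  set N := (h n).-1; set m0 := (N * d)%N.
  have iter j : (j * (N * r) <= h (m0 + j * (n + c)))%N.
    elim: j => [|j IHj] //.
    have -> : (m0 + j.+1 * (n + c) = m0 + j * (n + c) + n + c)%N by rewrite mulSn; lia.
    apply: leq_trans (dimension_gain _); last by rewrite -/m0; lia.
    by rewrite mulSn addnC leq_add2r.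
  rewrite leqNgt; apply/negP => lt.
  (* This j outweighs the constant D (m0 + c + 1) and the loss r^i from the predecessor of H. *)
  pose j := (D * (m0 + c).+1 + r ^ i).+1%N.
  have := IH (m0 + j * (n + c))%N.
  have := leq_mul (leqnn (r ^ i)) (iter j).
  set H := h _; rewrite expnS in lt; set y := (n + c)%N in lt *.
  have -> : (r ^ i * (j * (N * r)) = j * (r * r ^ i * N))%N by nia.
  have -> : (D * (m0 + j * y + c).+1 = D * (m0 + c).+1 + j * (D * y))%N by nia.
  have : (j * (D * y.+1).+1 <= j * (r * r ^ i * N))%N by rewrite leq_mul2l lt orbT.
  have -> : (j * (D * y.+1).+1 = j * (D * y) + j * D + j)%N by nia.
  have : (r ^ i * H <= r ^ i * H.-1 + r ^ i)%N by rewrite -mulnSr leq_mul2l; lia.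
  by rewrite {3}/j; lia.
(* Two points carry 2 r independent functionals, hence dimension at least 2. *)
have [n hn] : exists n, (1 < h n)%N.
  exists (2 * d)%N; rewrite ltnNge; apply/negP => h1.
  have [y [ay fy dy]] := hspan (2 * d).
  have [l [linj lF]] := uncountable_inj 2 nF.
  have [|a [[p ap] aP]] := @idomain_kernel K ('I_2 * 'I_r)%type 'I_(h (2 * d))
     (fun p t => (G (l p.1) (y t (l p.1)) *m (const_mx 1 : 'cV_r)) p.2 0).
    by rewrite card_prod !card_ord; lia.
  case/eqP: ap; apply: (compress_functionals (s := fun=> const_mx 1) linj lF _ (leqnn _)).
    move=> i; apply/eqP => /colP/(_ (Ordinal r0)); rewrite !mxE => /eqP.
    by rewrite oner_eq0.
  exact: (compress_span (s := fun=> const_mx 1) lF dy aP).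
have [r1|r1] := leqP r 1; first by apply/eqP; rewrite eqn_leq r1.
have := bound (D * (n + c).+1)%N n; rewrite leqNgt => /negP; case.
apply: leq_trans (leq_pmulr _ _); last by lia.
exact: ltn_expl.
Qed.

End Growth.
End Minimal.

(** Take the least positive rank r attained on an uncountable subfamily of an irreducible one. An
    element of smaller rank at uncountably many points vanishes, as [minimal_rank_one] requires. *)
Lemma rank_one_element (F : set Lam) : ~ countable F -> exists F' n t,
  [/\ F' `<=` F, ~ countable F', aK n t & forall l, F' l -> \rank (t l) = 1%N].
Proof.
move=> nF.
have [F0 [F0F nF0 irr0]] := irreducible_family Vall rhoP sep Irho Ifin nF.
pose Q r := `[< (0 < r)%N /\ exists F' n b, [/\ F' `<=` F0, ~ countable F', aK n b &
   forall l, F' l -> \rank (b l) = r] >].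
have exQ : exists r, Q r.
  exists d; apply/asboolP; split.
    by have [l _] := uncountable_inj 1 nF; exact: rep_pos (rhoP (l ord0)).
  exists F0, 0%N, (fun l => rho l 1); split=> // [|l _]; first by apply: aK_rho; apply: Vn1.
  by rewrite (rep1 (rhoP l)) mxrank1.
case: (ex_minnP exQ) => r /asboolP[r0 [F1 [c [b [F10 nF1 ab rb]]]]] rmin0.
have irr n y G : aK n y -> G `<=` F1 -> ~ countable G -> (forall l, G l -> y l = 0) ->
    forall l, F1 l -> y l = 0.
  by move=> ay GF nG yG l /F10; apply: (irr0 n y G ay _ nG yG) => z /GF /F10.
have rmin n y G : aK n y -> G `<=` F1 -> ~ countable G ->
    (forall l, G l -> \rank (y l) < r)%N -> forall l, F1 l -> y l = 0.
  move=> ay GF nG yr; apply: contrapT => ny.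
  have c0 : countable [set l | F1 l /\ y l = 0].
    by apply: contrapT => nc; apply: ny; apply: (irr n y _ ay _ nc) => l [].
  have nG' : ~ countable [set l | G l /\ y l <> 0].
    move=> c1; apply: nG; apply: (@sub_countable _ _ _ ([set l | F1 l /\ y l = 0] `|` [set l | G l /\ y l <> 0])).
      by apply: subset_card_le => l Gl; case: (pselect (y l = 0)) => yl; [left; split=> //; apply: GF|right].
    exact: countableU.
  have [r' nr'] := uncountable_cases (G := fun r => [set l | \rank (y l) = r]) nG' (fun l _ => ex_intro _ _ erefl).
  have [f [_ fP]] := uncountable_inj 1 nr'; have [[Gl yl] /= rl] := fP ord0.
  have := yr _ Gl; rewrite rl ltnNge => /negP; apply; apply: rmin0; apply/asboolP; split.
    by rewrite -rl lt0n mxrank_eq0; apply/eqP.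
  by exists ([set l | G l /\ y l <> 0] `&` [set l | \rank (y l) = r']), n, y;
    split=> // [l [[/GF /F10]]|l []].
exists F1, c, b; split=> //; first by move=> l /F10 /F0F.
have [B [C [B' [C' BC]]]] := ex_factor rb.
have [h [hle hspan hmax]] := ex_dimension F1 b.
by rewrite -(minimal_rank_one nF1 ab r0 irr rmin BC hspan hmax hle).
Qed.

End RankOne.

(** * Standard polynomials *)

From mathcomp Require Import monalg.

Section StandardPolynomial.

Definition stdp (B : nzRingType) (m : nat) (a : 'I_m -> B) : B :=
  \sum_(s : 'S_m) (-1) ^+ s * \prod_i a (s i).

Lemma prodr_enum (B : nzRingType) (I : finType) (F : I -> B) :
  \prod_(i <- enum I) F i = \prod_i F i.
Proof. by rewrite enumT; rewrite [index_enum _]unlock. Qed.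

(** After multilinear expansion the coefficient of each product is a determinant with two equal
    rows. *)
Lemma stdp_span (S : comNzRingType) (B : algType S) (m : nat) (T : finType)
    (c : 'I_m -> T -> S) (b : T -> B) :
  (#|T| < m)%N -> stdp (fun i => \sum_t c i t *: b t) = 0.
Proof.
move=> ltTm; rewrite /stdp.
under eq_bigr => s _ do rewrite bigA_distr_bigA mulr_sumr /=.
rewrite exchange_big big1 //= => f _.
have E (s : 'S_m) : (-1) ^+ s * (\prod_i (c (s i) (f i) *: b (f i))) =
    ((-1) ^+ s * \prod_i c (s i) (f i)) *: \prod_i b (f i).
  rewrite scaler_prod; case: (odd_perm s); last by rewrite expr0 !mul1r.
  by rewrite expr1 !mulN1r scaleNr.
rewrite (eq_bigr _ (fun s _ => E s)) -scaler_suml.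
have /injectivePn[i [j ij eF]] : ~~ injectiveb f.
  by apply/negP => /injectiveP /leq_card; rewrite card_ord leqNgt ltTm.
pose M := \matrix_(i, l) c l (f i).
have <- : \det M = \sum_(s : 'S_m) (-1) ^+ s * \prod_i c (s i) (f i).
  by apply: eq_bigr => s _; congr (_ * _); apply: eq_bigr => l _; rewrite mxE.
by rewrite (determinant_alternate ij) ?scale0r // => l; rewrite !mxE eF.
Qed.

Lemma stdp_morph (B B' : nzRingType) (f : {rmorphism B -> B'}) m (a : 'I_m -> B) :
  f (stdp a) = stdp (f \o a).
Proof.
rewrite /stdp rmorph_sum; apply: eq_bigr => s _.
by rewrite rmorphM rmorph_prod rmorph_sign.
Qed.

Lemma stdp_satisfies_pi (k : fieldType) (A : algType k) m :
  (forall a : 'I_m -> A, stdp a = 0) -> satisfies_pi A.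
Proof.
move=> sa; exists m.
pose w (s : 'S_m) : {fmonom 'I_m} := FMonom [seq s i | i <- enum 'I_m].
pose p : {malg k[{fmonom 'I_m}]} := \sum_(s : 'S_m) << (-1) ^+ s *g w s >>.
have winj : injective w.
  move=> s t /(congr1 (@fmonom_val _)) /= e; apply/permP => i.
  by move/eq_in_map: e => /(_ i); apply; rewrite mem_enum.
exists p; split.
  apply/negP => /eqP /(congr1 (mcoeff (w 1%g))); rewrite mcoeff0 raddf_sum /=.
  rewrite (bigD1 1%g) //= big1 => [|s s1]; rewrite mcoeffU.
    by rewrite eqxx odd_perm1 expr0 addr0 => /eqP; rewrite oner_eq0.
  by rewrite (inj_eq winj) (negPf s1).
move=> a; rewrite /nc_eval /p raddf_sum /=.
rewrite -[RHS](sa a); apply: eq_bigr => s _.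
rewrite mmapU /w /= big_map. rewrite prodr_enum.
by rewrite -[_%:A]/(GRing.in_alg A _) rmorph_sign.
Qed.

End StandardPolynomial.

(** * Modules of finite rank and polynomial identities *)

Section FiniteRank.
Variables (A : nzRingType) (R : idomainType) (act : R -> A -> A) (N : set A).
Hypothesis H : domain_action act N [set 0].
Hypothesis Nl : lideal N.
Hypothesis act_l : forall a r x, N x -> a * act r x = act r (a * x).
Hypothesis prA : prime_ring A.

Lemma finite_rank_stdp (m : nat) y0 : N y0 -> y0 <> 0 ->
  (forall (T : finType) (x : T -> A), (forall t, N (x t)) ->
     rfree act [set 0] x -> (#|T| <= m)%N) ->
  exists m', forall a : 'I_m' -> A, stdp a = 0.
Proof.
move=> Ny0 y0n0 bnd.
have [T [x0 [Nx0 _ dx0]]] := rfree_max H (fun x Nx => Nx) bnd.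
have [N0 NB NM] := Nl.
pose x (i : 'I_#|T|) := x0 (enum_val i).
have Nx i : N (x i) by apply: Nx0.
have dx y : N y -> rdep act [set 0] x y.
  move=> Ny; apply: (rdep_trans H _ _ Ny (dx0 y Ny)) => // t.
  by rewrite -[t]enum_rankK; apply: (@rdep_mem _ _ _ _ _ H _ x).
move: x Nx dx; case: #|T| => [|t] x Nx dx.
  have [p [p0 [r]]] := dx _ Ny0.
  by rewrite big_ord0 subr0 => /(dact_tf H Ny0 p0).
exists (t.+1 * t.+1).+1 => a.
have actS (I : finType) r (z : I -> A) : act r (\sum_i z i) = \sum_i act r (z i).
  by apply: (big_morph _ (dact_Dr H r) (dact_0 H r)).
have act0l z : N z -> act 0 z = 0.
  by move=> Nz; apply: (@addrI _ (act 0 z)); rewrite -(dact_Dl H) ?addr0.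
have sumact (I : finType) (r : I -> R) z : N z -> act (\sum_i r i) z = \sum_i act (r i) z.
  by move=> Nz; elim/big_rec2: _ => [|i w q _ <-]; [apply: act0l | rewrite (dact_Dl H)].
have actC p q z : N z -> act p (act q z) = act q (act p z).
  by move=> Nz; rewrite -!(dact_M H) //; congr (act _ _); rewrite mulrC.
have [p [p0 [M MP]]] : exists p : R, p != 0 /\ exists M : 'I_(t.+1 * t.+1).+1 -> 'M[R]_t.+1,
    forall i j, act p (a i * x j) = \sum_l act (M i l j) (x l).
  have /choice[q qP] : forall u : 'I_(t.+1 * t.+1).+1 * 'I_t.+1, exists q : R, q != 0 /\
     exists r, act q (a u.1 * x u.2) = \sum_l act (r l) (x l).
    move=> u; have [q [q0 [r /= e]]] := dx _ (NM (a u.1) _ (Nx u.2)).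
    by exists q; split=> //; exists r; apply/eqP; rewrite -subr_eq0 e.
  have /choice[r rP] : forall u, exists r, act (q u) (a u.1 * x u.2) = \sum_l act (r l) (x l).
    by move=> u; case: (qP u).
  exists (\prod_u q u); split; first by apply/prodf_neq0 => u _; case: (qP u).
  exists (fun i => \matrix_(l, j) ((\prod_(u | u != (i, j)) q u) * r (i, j) l)) => i j.
  rewrite (bigD1 (i, j)) //= mulrC (dact_M H); last exact: NM.
  rewrite (rP (i, j)) actS; apply: eq_bigr => l _.
  by rewrite mxE (dact_M H).
(* Each factor costs one p, so all terms of the standard polynomial share the same denominator. *)
have step (I : Type) (s : seq I) (f : I -> 'I_(t.+1 * t.+1).+1) j :
    act (p ^+ size s) ((\prod_(i <- s) a (f i)) * x j) =
    \sum_l act ((\prod_(i <- s) M (f i)) l j) (x l).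
  elim: s j => [|i s IH] j.
    rewrite !big_nil mul1r expr0 (dact_1 H) // (bigD1 j) //= big1 => [|l lj].
      by rewrite mxE eqxx (dact_1 H) // addr0.
    by rewrite mxE (negPf lj) act0l.
  have Nw : N ((\prod_(i <- s) a (f i)) * x j) by apply: NM.
  rewrite !big_cons /= exprS -mulrA (dact_M H); last by apply: NM.
  rewrite -act_l // IH mulr_sumr actS.
  rewrite (eq_bigr (fun l => \sum_h act (M (f i) h l * (\prod_(i <- s) M (f i)) l j) (x h))).
    rewrite exchange_big; apply: eq_bigr => h _; rewrite mxE sumact //.
  move=> l _; rewrite act_l // actC; last exact: NM.
  rewrite MP actS; apply: eq_bigr => h _; rewrite -(dact_M H) //.
  by congr (act _ _); rewrite mulrC.
have stdM : stdp M = 0.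
  have -> : M = (fun i => \sum_(u : 'I_t.+1 * 'I_t.+1) M i u.1 u.2 *: delta_mx u.1 u.2).
    by apply/funext => i; rewrite {1}[M i]matrix_sum_delta pair_bigA.
  by apply: stdp_span; rewrite card_prod card_ord.
have std0 j : stdp a * x j = 0.
  apply: (dact_tf H (r := p ^+ size (enum 'I_(t.+1 * t.+1).+1))); first exact: NM.
    by rewrite expf_neq0.
  rewrite /stdp mulr_suml actS.
  have E (s : 'S_(t.+1 * t.+1).+1) :
     act (p ^+ size (enum 'I_(t.+1 * t.+1).+1)) ((-1) ^+ s * \prod_i a (s i) * x j) =
     \sum_l act (((-1) ^+ s * \prod_i M (s i)) l j) (x l).
    have := step _ (enum 'I_(t.+1 * t.+1).+1) s j; rewrite !prodr_enum => e.
    rewrite -mulrA -act_l ?e //; last exact: NM.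
    case: (odd_perm s); rewrite ?expr1 ?expr0 ?mulN1r ?mul1r //.
    rewrite -sumrN; apply: eq_bigr => l _; rewrite mxE.
    apply/eqP; rewrite eq_sym -subr_eq0 opprK -(dact_Dl H) // addNr act0l //.
  rewrite (eq_bigr _ (fun s _ => E s)) exchange_big big1 //= => l _.
  rewrite -sumact // -summxE -/(stdp M) stdM mxE act0l //.
have stdN y : N y -> stdp a * y = 0.
  move=> Ny; have [q [q0 [r /= e]]] := dx _ Ny.
  apply: (dact_tf H (r := q)) => //; first exact: NM.
  rewrite -act_l //; move/eqP: e; rewrite subr_eq0 => /eqP ->.
  rewrite mulr_sumr big1 // => l _; rewrite act_l // std0 (dact_0 H) //.
have e : forall b, stdp a * b * y0 = 0 by move=> b; rewrite -mulrA; apply/stdN/NM.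
by case: (prime_ring_mul prA e).
Qed.

End FiniteRank.

(** * Growth of a centralizer *)

Section PolyAction.
Variables (R : idomainType) (M : zmodType) (act : R -> M -> M) (N : set M).
Hypothesis H : domain_action act N [set 0].
Variable phi : M -> M.
Hypothesis phiN : forall x, N x -> N (phi x).
Hypothesis phiD : forall x y, phi (x + y) = phi x + phi y.
Hypothesis phi_act : forall r x, N x -> phi (act r x) = act r (phi x).

(** The action of R[X] with X acting as phi; it will make A b a module over k[z][c]. *)
Definition pact (f : {poly R}) (x : M) : M := \sum_(i < size f) act f`_i (iter i phi x).

Let iterN i x : N x -> N (iter i phi x).
Proof. by move=> Nx; elim: i => //= i; apply: phiN. Qed.

Let act0l x : N x -> act 0 x = 0.
Proof. by move=> Nx; apply: (@addrI _ (act 0 x)); rewrite -(dact_Dl H) ?addr0. Qed.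

Implicit Types f h : {poly R}.

Lemma pactE n f x : N x -> (size f <= n)%N -> pact f x = \sum_(i < n) act f`_i (iter i phi x).
Proof.
move=> Nx le; rewrite /pact (big_ord_widen n (fun i => act f`_i (iter i phi x))) //.
rewrite [RHS](bigID (fun i : 'I_n => (i < size f)%N)) /= [X in _ = _ + X]big1 ?addr0 // => i.
by rewrite -leqNgt => lei; rewrite nth_default // act0l //; apply: iterN.
Qed.

Lemma pactN f x : N x -> N (pact f x).
Proof.
move=> Nx; rewrite /pact; elim/big_ind: _ => [|y z|i _]; first exact: (dact_N0 H).
  exact: (dact_ND H).
by apply/(dact_Nact H)/iterN.
Qed.

Let phi0 : phi 0 = 0.
Proof. by apply: (@addrI _ (phi 0)); rewrite -phiD !addr0. Qed.

Lemma iter_phiD i x y : iter i phi (x + y) = iter i phi x + iter i phi y.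
Proof. by elim: i => //= i ->; rewrite phiD. Qed.

Lemma iter_phi_act i r x : N x -> iter i phi (act r x) = act r (iter i phi x).
Proof. by move=> Nx; elim: i => //= i ->; rewrite phi_act //; apply: iterN. Qed.

Lemma pactDr f x y : pact f (x + y) = pact f x + pact f y.
Proof.
rewrite /pact -big_split; apply: eq_bigr => i _.
by rewrite iter_phiD (dact_Dr H).
Qed.

Lemma pactDl f h x : N x -> pact (f + h) x = pact f x + pact h x.
Proof.
move=> Nx; rewrite (pactE Nx (size_polyD f h)).
rewrite (pactE Nx (leq_maxl (size f) (size h))) (pactE Nx (leq_maxr (size f) (size h))) -big_split.
by apply: eq_bigr => i _; rewrite coefD (dact_Dl H) //; apply: iterN.
Qed.

Lemma pact0l x : N x -> pact 0 x = 0.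
Proof. by move=> Nx; rewrite /pact size_poly0 big_ord0. Qed.

Lemma pactC r x : N x -> pact r%:P x = act r x.
Proof.
move=> Nx; rewrite (pactE Nx (size_polyC_leq1 r)) big_ord1 coefC /=; by [].
Qed.

Lemma pactMX f x : N x -> pact (f * 'X) x = pact f (phi x).
Proof.
move=> Nx; rewrite (@pactE (size f).+1) //; last first.
  by have := size_polyMleq f 'X; rewrite size_polyX addn2.
rewrite big_ord_recl coefMX /= act0l // add0r; apply: eq_bigr => i _.
by rewrite coefMX /= -iterSr.
Qed.

Lemma phi_pact f x : N x -> phi (pact f x) = pact f (phi x).
Proof.
move=> Nx; rewrite /pact (big_morph phi phiD phi0); apply: eq_bigr => i _.
by rewrite phi_act -?iterS -?iterSr //; apply: iterN.
Qed.

Lemma act_pact r f x : N x -> pact f (act r x) = act r (pact f x).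
Proof.
move=> Nx; rewrite /pact (big_morph (act r) (dact_Dr H r) (dact_0 H r)); apply: eq_bigr => i _.
have Ni := iterN i Nx; rewrite iter_phi_act // -(dact_M H) // -(dact_M H) //.
by congr (act _ _); apply: mulrC.
Qed.

Lemma pactM f h x : N x -> pact (f * h) x = pact f (pact h x).
Proof.
move=> Nx; elim/poly_ind: f x Nx => [|f r IH] x Nx.
  by rewrite mul0r !pact0l //; apply: pactN.
rewrite mulrDl !pactDl; [|exact: pactN|exact: Nx].
rewrite pactC; last exact: pactN.
have -> : pact (f * 'X * h) x = pact f (phi (pact h x)).
  by rewrite mulrAC (pactMX (f * h) Nx) IH ?phi_pact //; apply: phiN.
rewrite (pactMX f (pactN h Nx)); congr (_ + _).
elim/poly_ind: h {IH} x Nx => [|h s IHh] x Nx; first by rewrite mulr0 pact0l // (dact_0 H).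
rewrite mulrDr mulrA !pactDl // !pactMX // IHh; last exact: phiN.
by rewrite (dact_Dr H) -polyCM !pactC // (dact_M H).
Qed.

Hypothesis tf : forall f x, N x -> f != 0 -> pact f x = 0 -> x = 0.

Lemma poly_domain_action : domain_action pact N [set 0].
Proof.
split.
- exact: (dact_N0 H).
- exact: (dact_ND H).
- exact: pactN.
- by [].
- by move=> x y /= -> ->; rewrite subr0.
- by move=> r x /= ->; apply: (@addrI _ (pact r 0)); rewrite -pactDr !addr0.
- by move=> r; apply: (@addrI _ (pact r 0)); rewrite -pactDr !addr0.
- by move=> x Nx; rewrite -polyC1 pactC // (dact_1 H).
- exact: pactM.
- by move=> r s x Nx; apply: pactDl.
- exact: pactDr.
- by move=> r x Nx r0 /= e; apply: tf e.
Qed.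

End PolyAction.

Section Centralizer.
Variables (k : fieldType) (A : algType k) (g : nat) (v : 'I_g -> A) (C : nat).
Hypothesis Vall : forall x, exists n, Vn v n x.
Hypothesis growth : forall n (T : finType) (x : T -> A),
  (forall t, Vn v n (x t)) -> kfree [set 0] x -> (#|T| <= C * n.+1 ^ 2)%N.
Hypothesis prA : prime_ring A.
Hypothesis notPI : ~ satisfies_pi A.
Variables (b y0 : A) (P0 : set A).
Hypothesis bP : forall y x, b * y * b <> 0 -> x * b * y * b = 0 -> x * b = 0.
Hypothesis by0 : b * y0 * b <> 0.
Hypothesis P0i : ideal2 P0.
Hypothesis P0y : P0 y0.
Hypothesis P0b : ~ P0 b.

Let z := y0 * b.
Let ez : {poly k} -> A := horner_alg z.
Let act (q : {poly k}) (x : A) : A := x * ez q.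
Let N : set A := [set x | exists y, x = y * b].

(** This identity makes A b stable under right multiplication by k[z]. *)
Lemma b_horner q : b * ez q = horner_alg (b * y0) q * b.
Proof.
elim/poly_ind: q => [|q c IH]; first by rewrite /ez !rmorph0 mulr0 mul0r.
rewrite /ez !rmorphD !rmorphM /= !horner_algX !horner_algC mulrDr mulrDl.
rewrite mulr_algr mulr_algl; congr (_ + _).
by rewrite mulrA IH /z !mulrA.
Qed.

Lemma NP x : N x -> exists y, x = y * b. Proof. by []. Qed.

Lemma Nl : lideal N.
Proof.
split; first by exists 0; rewrite mul0r.
  by move=> _ _ [x ->] [y ->]; exists (x - y); rewrite mulrBl.
by move=> a _ [x ->]; exists (a * x); rewrite mulrA.
Qed.

Lemma Nb : N b. Proof. by exists 1; rewrite mul1r. Qed.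
Lemma Nz : N z. Proof. by exists y0. Qed.

Lemma Nact q x : N x -> N (act q x).
Proof. by move=> [y ->]; rewrite /act -mulrA b_horner mulrA; exists (y * horner_alg (b * y0) q). Qed.

(** If q has nonzero constant term, b q(z) is a nonzero multiple of b modulo P0, as z lies in P0 and
    b does not. Otherwise a factor z is cancelled by [bP]. *)
Lemma b_ez_neq0 q : q != 0 -> b * ez q <> 0.
Proof.
have [P0l P0r] := P0i; have [P00 P0B P0M] := P0l.
have [n] := ubnP (size q); elim: n q => // n IH q sq q0 bq.
have qE : q = drop_poly 1 q * 'X + (q`_0)%:P.
  have := poly_take_drop 1 q; rewrite expr1 => /esym {1}->; rewrite addrC; congr (_ + _).
  by apply/polyP => -[|i]; rewrite coef_take_poly coefC.
have [q00|q00] := eqVneq q`_0 0.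
  move: qE; rewrite q00 addr0 => qE; set q' := drop_poly 1 q in qE.
  have q'0 : q' != 0 by apply: contraNneq q0 => e; rewrite qE e mul0r.
  apply: (IH q' _ q'0); first by move: sq; rewrite qE size_mulX.
  move: bq; rewrite qE /ez rmorphM /= horner_algX mulrA -/(ez q') b_horner /z !mulrA => bq.
  exact: bP by0 bq.
apply: P0b; have P0z : P0 z by apply: P0r.
have : P0 (q`_0 *: b).
  have -> : q`_0 *: b = b * ez q - b * (ez (drop_poly 1 q) * z).
    have -> : ez q = ez (drop_poly 1 q) * z + (q`_0)%:A.
      by rewrite {1}qE /ez rmorphD rmorphM /= horner_algX horner_algC.
    by rewrite -mulrBr addrC addrA addNr add0r mulr_algr.
  by rewrite bq sub0r; apply: lidealN => //; apply/P0M/P0M.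
by move/(lidealZ (q`_0)^-1 P0l); rewrite scalerA mulVf // scale1r.
Qed.

Lemma z_ez q : z * ez q = y0 * horner_alg (b * y0) q * b.
Proof. by rewrite /z -mulrA b_horner mulrA. Qed.

Lemma ezC q : ez q * z = z * ez q.
Proof. by rewrite -[z]horner_algX -!rmorphM /= mulrC. Qed.

Lemma act_domain : domain_action act N [set 0].
Proof.
split.
- by case: Nl.
- by move=> x y; apply: lidealD; exact: Nl.
- exact: Nact.
- by [].
- by move=> x y /= -> ->; rewrite subr0.
- by move=> r x /= ->; rewrite /act mul0r.
- by move=> r; rewrite /act mul0r.
- by move=> x _; rewrite /act /ez rmorph1 mulr1.
- by move=> r s x _; rewrite /act -mulrA -rmorphM /= mulrC.
- by move=> r s x _; rewrite /act /ez rmorphD mulrDr.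
- by move=> r x y; rewrite /act mulrDl.
move=> q x [y ->] q0 /= e.
have E w : w * b * (y0 * horner_alg (b * y0) q) * b = w * b * (z * ez q) by rewrite z_ez !mulrA.
apply: (bP (y := y0 * horner_alg (b * y0) q)).
  have := E 1; rewrite !mul1r => ->; rewrite -[z]horner_algX -rmorphM.
  by apply: b_ez_neq0; rewrite mulf_neq0 // polyX_eq0.
by rewrite E -ezC mulrA [y * b * _]e mul0r.
Qed.

Lemma infinite_rank (m : nat) : exists (T : finType) (x : T -> A),
  [/\ forall t, N (x t), rfree act [set 0] x & (m < #|T|)%N].
Proof.
apply: contrapT => ne; apply: notPI.
have b0 : b <> 0 by move=> b0; apply: by0; rewrite b0 mulr0.
have [||m' m'P] := finite_rank_stdp act_domain Nl _ prA Nb b0 (m := m).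
- by move=> a r x _; rewrite /act mulrA.
- move=> T x Nx fx; rewrite leqNgt; apply/negP => lt; apply: ne.
  by exists T, x.
exact: stdp_satisfies_pi m'P.
Qed.

(** Commutation with z is required only after left multiplication by b, which is all that the action
    on A b detects. *)
Definition czt : set A := [set c | N c /\ b * c * z = b * z * c].

Lemma cztE c x : czt c -> N x -> x * c * z = x * z * c.
Proof. by move=> [_ e] [y ->]; have := congr1 ( *%R y) e; rewrite !mulrA. Qed.

Lemma cztM c c' : czt c -> czt c' -> czt (c * c').
Proof.
move=> cc cc'; have [_ _ NM] := Nl; split; first by apply: NM; case: cc'.
rewrite mulrA -mulrA; have [[x cE] e] := cc.
rewrite mulrA (cztE cc'); last by apply: NM; exists x.
by rewrite mulrA -e !mulrA.
Qed.

Lemma czt_lideal0 : czt 0. Proof. by split; [case: Nl|rewrite !mulr0 mul0r]. Qed.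

Lemma cztD c c' : czt c -> czt c' -> czt (c + c').
Proof.
move=> [Nc e] [Nc' e']; split; first exact: (lidealD Nl).
by rewrite !mulrDr mulrDl e e'.
Qed.

Lemma cztZ a c : czt c -> czt (a *: c).
Proof.
move=> [Nc e]; split; first exact: (lidealZ _ Nl).
by rewrite -!scalerAr -scalerAl e.
Qed.

Lemma czt_act c q x : czt c -> N x -> act q x * c = act q (x * c).
Proof.
move=> cc Nx; rewrite /act; elim/poly_ind: q => [|q a IH]; first by rewrite /ez rmorph0 !mulr0 mul0r.
rewrite /ez rmorphD rmorphM /= horner_algX horner_algC !mulrDr mulrDl.
rewrite -!scalerAr !mulr1 -scalerAl; congr (_ + _).
rewrite mulrA -(cztE cc); last exact: (Nact q Nx).
by rewrite IH !mulrA.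
Qed.

Section Algebraic.
Variable c : A.
Hypothesis cc : czt c.
Let phi (x : A) := x * c.

Let phiN x : N x -> N (phi x).
Proof. by move=> _; have [_ _ NM] := Nl; apply: NM; case: cc. Qed.

Let phiD x y : phi (x + y) = phi x + phi y. Proof. by rewrite /phi mulrDl. Qed.

Let phi_act r x : N x -> phi (act r x) = act r (phi x).
Proof. by move=> Nx; apply: czt_act. Qed.

Let iter_phi i x : iter i phi x = x * c ^+ i.
Proof. by elim: i => [|i IH]; rewrite ?mulr1 //= IH /phi -mulrA -exprSr. Qed.

Let act2 := pact act phi.

Let act2l a f x : a * act2 f x = act2 f (a * x).
Proof.
by rewrite /act2 /pact mulr_sumr; apply: eq_bigr => i _; rewrite !iter_phi /act !mulrA.
Qed.

Lemma act2_b f : act2 f b = \sum_(i < size f) b * c ^+ i * ez f`_i.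
Proof. by apply: eq_bigr => i _; rewrite iter_phi. Qed.

(** Otherwise A b is torsion-free over a polynomial ring in z and c. The (n + 1)^2 monomials exhaust
    quadratic growth, so the rank is finite and A satisfies an identity. *)
Lemma algebraic_over : exists f : {poly {poly k}}, f != 0 /\ act2 f b = 0.
Proof.
apply: contrapT => nalg; apply: notPI.
have bf f : f != 0 -> act2 f b <> 0 by move=> f0 e; apply: nalg; exists f.
have tf f x : N x -> f != 0 -> act2 f x = 0 -> x = 0.
  move=> [y ->] f0 e.
  have [y' y'E] : N (act2 f z) by apply: (pactN act_domain phiN f Nz).
  have bz : act2 f (b * z) = act2 f b * z.
    have := act_pact act_domain phiN phi_act 'X f Nb.
    by rewrite /act /ez horner_algX.
  apply: (bP (y := y')).
    rewrite -mulrA -y'E act2l bz => h; apply: (bf f f0).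
    apply: (dact_tf act_domain (r := 'X)) => //; last by rewrite /act /ez horner_algX.
      exact: (pactN act_domain phiN f Nb).
    by rewrite polyX_eq0.
  rewrite -mulrA -y'E act2l -mulrA -act2l bz mulrA act2l e mul0r //.
have H2 := poly_domain_action act_domain phiN phiD phi_act tf.
have b0 : b <> 0 by move=> b0; apply: by0; rewrite b0 mulr0.
have [s0 Vc] := Vall c; have [s1 Vz] := Vall z; pose s := (s0 + s1)%N.
have [||m' m'P] := finite_rank_stdp H2 Nl _ prA Nb b0 (m := (C * (s0 + s1).+1 ^ 2)%N).
- by move=> a f x _; apply: act2l.
- move=> T x Nx fx.
  have /choice[e eP] : forall t, exists e, Vn v e (x t) by move=> t; apply: Vall.
  pose n := (\max_t e t)%N.
  pose X (p : T * ('I_n.+1 * 'I_n.+1)) := x p.1 * c ^+ p.2.1 * z ^+ p.2.2.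
  have VX p : Vn v (n + n * s0 + n * s1) (X p).
    apply: VnM; first apply: VnM.
    - by apply: Vn_mono (eP p.1); apply: (@leq_bigmax _ e).
    - by apply: (@Vn_mono _ _ _ _ (p.2.1 * s0)); [rewrite leq_mul2r -ltnS ltn_ord orbT|apply: VnX].
    - by apply: (@Vn_mono _ _ _ _ (p.2.2 * s1)); [rewrite leq_mul2r -ltnS ltn_ord orbT|apply: VnX].
  have fX : kfree [set 0] X.
    move=> r /= r0 [t [i j]].
    pose q t i : {poly k} := \poly_(j < n.+1) r (t, (inord i, inord j)).
    pose f t : {poly {poly k}} := \poly_(i < n.+1) q t i.
    have f0 : \sum_t act2 (f t) (x t) = 0.
      rewrite -[RHS]r0 (eq_bigr (fun t => \sum_u r (t, u) *: X (t, u))).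
        by rewrite pair_bigA; apply: eq_bigr => -[].
      move=> t' _; rewrite /act2 (pactE act_domain phiN (Nx t') (size_poly _ _)).
      rewrite (eq_bigr (fun i : 'I_n.+1 => \sum_j r (t', (i, j)) *: X (t', (i, j)))).
        by rewrite pair_bigA; apply: eq_bigr => -[].
      move=> i' _; rewrite iter_phi coef_poly ltn_ord /act /ez /q poly_def linear_sum mulr_sumr.
      apply: eq_bigr => j' _; rewrite -mul_polyC rmorphM rmorphXn /= horner_algC horner_algX.
      by rewrite mulr_algl -scalerAr !inord_val.
    have := fx f f0 t => /(congr1 (fun p : {poly {poly k}} => p`_i`_j)).
    by rewrite coef_poly ltn_ord coef_poly ltn_ord !inord_val !coef0.
  have := growth VX fX; rewrite !card_prod !card_ord => h.
  have : (#|T| * (n.+1 * n.+1) <= C * (s0 + s1).+1 ^ 2 * (n.+1 * n.+1))%N.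
    apply: leq_trans h _; rewrite -mulnA leq_mul2l mulnn -expnMn leq_exp2r //.
    by apply/orP; right; lia.
  by rewrite leq_pmul2r.
exact: stdp_satisfies_pi m'P.
Qed.

(* Cancelling powers of [c] in an equation for [c] over k[z] leaves one with a
   nonzero constant coefficient, and that coefficient is then a multiple of [c]. *)
Lemma denominator : b * c <> 0 -> exists c' q, [/\ czt c', q != 0 & b * c * c' = b * ez q].
Proof.
move=> bc0; have [f [f0 fb]] := algebraic_over.
have [f' [f'0 f'b]] : exists f : {poly {poly k}}, f`_0 != 0 /\ act2 f b = 0.
  have [n] := ubnP (size f); elim: n f f0 fb => // n IH f f0 fb sf.
  have [f00|] := eqVneq f`_0 0; last by exists f.
  have fE : f = drop_poly 1 f * 'X.
    have := poly_take_drop 1 f; rewrite expr1 => /esym {1}->.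
    rewrite -[RHS]add0r; congr (_ + _).
    by apply/polyP => -[|i]; rewrite coef_take_poly coef0 ?f00.
  set f' := drop_poly 1 f in fE.
  have f'0 : f' != 0 by apply: contraNneq f0 => e; rewrite fE e mul0r.
  apply: (IH f' f'0); last by move: sf; rewrite fE size_mulX.
  have : act2 f' b * c = 0.
    rewrite -[LHS]/(phi (act2 f' b)) /act2 (phi_pact phiN phiD phi_act f' Nb).
    by rewrite -(pactMX act_domain phiN f' Nb) -fE.
  have [y ->] : N (act2 f' b) by apply: (pactN act_domain phiN f' Nb).
  have [[x cE] _] := cc; rewrite cE mulrA => e; apply: bP e.
  by rewrite -mulrA -cE.
pose c' := - \sum_(i < (size f').-1) c ^+ i * ez f'`_i.+1 * z.
have sf' : size f' = (size f').-1.+1.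
  by rewrite prednK // lt0n size_poly_eq0; apply: contraNneq f'0 => ->; rewrite coef0.
have cX i : forall x, N x -> x * c ^+ i * z = x * z * c ^+ i.
  elim: i => [|i IH] x Nx; first by rewrite !mulr1.
  by rewrite exprS (mulrA x) IH; [rewrite (cztE cc Nx) (mulrA (x * z))|apply: phiN].
have NcX i : N (b * c ^+ i).
  by elim: i => [|i IH]; [rewrite mulr1; apply: Nb|rewrite exprSr mulrA; apply: phiN].
exists c', (f'`_0 * 'X); split.
- rewrite /c' -scaleN1r; apply: cztZ; elim/big_ind: _ => [||i _]; [exact: czt_lideal0|exact: cztD|].
  have [_ _ NM] := Nl; split; first by apply: NM; apply: Nz.
  set X := c ^+ i; set e := ez _.
  rewrite -(mulrA X) (mulrA b X) (mulrA (b * z) X) -(cX i b Nb) -/X.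
  by rewrite -(mulrA (b * X) (e * z)) -(mulrA (b * X) z) (mulrA z e z) -ezC.
- by rewrite mulf_neq0 ?polyX_eq0.
have := f'b; rewrite act2_b sf' big_ord_recl /= expr0 mulr1 => /eqP; rewrite addr_eq0 => /eqP e.
rewrite /ez rmorphM /= horner_algX mulrA -/(ez _) e mulrN mulNr; congr (- _).
rewrite mulr_sumr mulr_suml; apply: eq_bigr => i _.
by rewrite /bump /= add1n exprS !mulrA.
Qed.

End Algebraic.

Lemma rdep_left (T : finType) (x : T -> A) a y :
  rdep act [set 0] x y -> rdep act [set 0] (fun t => a * x t) (a * y).
Proof.
move=> [p [p0 [r /= e]]]; exists p; split=> //; exists r => /=.
have := congr1 ( *%R a) e; rewrite mulr0 mulrBr /act mulrA mulr_sumr => e'; apply: etrans e'.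
by congr (_ - _); apply: eq_bigr => t _; rewrite mulrA.
Qed.

(** Adding u to the x i creates a relation in which u has a coefficient c with b c nonzero;
    [denominator] moves this coefficient into k[z]. *)
Lemma dependent_elt n (x : 'I_n.+1 -> A) u : (forall i, Vn v n (x i)) -> Vn v n.+1 u ->
  (forall c : 'I_n.+1 -> A, (forall i, czt (c i)) ->
     \sum_i x i * (b * c i) = 0 -> forall i, b * c i = 0) ->
  ~ (exists x : 'I_n.+2 -> A, (forall i, Vn v n.+1 (x i)) /\
    forall c : 'I_n.+2 -> A, (forall i, czt (c i)) ->
      \sum_i x i * (b * c i) = 0 -> forall i, b * c i = 0) ->
  exists q (c : 'I_n.+1 -> A), [/\ q != 0, forall i, czt (c i) &
    u * (b * ez q) = \sum_i x i * (b * c i)].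
Proof.
move=> Vx Vu ind ne.
pose x' (i : 'I_n.+2) := if unlift ord_max i is Some j then x j else u.
have x'l j : x' (lift ord_max j) = x j by rewrite /x' liftK.
have x'm : x' ord_max = u by rewrite /x' unlift_none.
have sumE (c : 'I_n.+2 -> A) : \sum_i x' i * (b * c i) =
    u * (b * c ord_max) + \sum_j x j * (b * c (lift ord_max j)).
  by rewrite (bigD1_ord ord_max) //= x'm; congr (_ + _); apply: eq_bigr => j _; rewrite x'l.
have Vx' i : Vn v n.+1 (x' i).
  by rewrite /x'; case: unliftP => [j _|_] //; apply: Vn_mono (Vx j).
apply: contrapT => nq; apply: ne; exists x'; split=> // c cc; rewrite sumE => e.
have cm0 : b * c ord_max = 0.
  apply: contrapT => /(denominator (cc ord_max))[c' [q [cc' q0 qE]]]; apply: nq.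
  exists q, (fun j => - (c (lift ord_max j) * c')); split=> // [j|].
    by rewrite -scaleN1r; apply/cztZ/cztM.
  rewrite -qE mulrA (mulrA u) -(mulrA u); move/eqP: e; rewrite addr_eq0 => /eqP ->.
  rewrite mulNr mulr_suml -sumrN; apply: eq_bigr => j _.
  by rewrite !mulrN -!mulrA.
move: e; rewrite cm0 mulr0 add0r => /ind ind' i.
by case: (unliftP ord_max i) => [j ->|->] //; apply: ind'.
Qed.

Section Letters.
Variables (G : nat) (cl : 'I_G -> A).
Hypothesis clP : forall i, czt (cl i).

Lemma N_ev y w : N y -> N (y * ev cl w).
Proof.
elim: w y => [|i w IH] y Ny; first by rewrite ev_nil mulr1.
by rewrite ev_cons mulrA; apply: IH; have [_ _ NM] := Nl; apply: NM; case: (clP i).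
Qed.

Lemma act_ev q y w : N y -> act q y * ev cl w = act q (y * ev cl w).
Proof.
elim: w y => [|i w IH] y Ny; first by rewrite ev_nil !mulr1.
rewrite ev_cons !mulrA czt_act // IH //.
by have [_ _ NM] := Nl; apply: NM; case: (clP i).
Qed.

Lemma czt_ev w : w <> [::] -> czt (ev cl w).
Proof.
elim: w => // i [|j w] IH _; first by rewrite ev_cons ev_nil mulr1.
by rewrite ev_cons; apply: cztM => //; apply: IH.
Qed.

(** Powers of z take up one degree of the quadratic growth, so words in finitely many centralizing
    elements have linear growth over k[z]. Each word is algebraic, and [words_finite] applies. *)
Lemma words_bounded : exists L, forall w,
  rdep act [set 0] (fun u : L.-bseq 'I_G => b * ev cl u) (b * ev cl w).
Proof.
have /choice[e eP] : forall i, exists e, Vn v e (cl i) by move=> i; apply: Vall.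
pose s0 := (\max_i e i)%N.
have [s1 Vz] := Vall z; have [s2 Vb] := Vall b.
have Vcl w : Vn v (size w * s0) (ev cl w).
  elim: w => [|i w IH]; first by rewrite ev_nil; apply: Vn1.
  rewrite ev_cons mulSn; apply: VnM => //; apply: Vn_mono (eP i).
  exact: (@leq_bigmax _ e).
apply: (@words_finite G _ _ act N [set 0] act_domain (fun w => b * ev cl w) _ _
  (C * (s0 + s1 + s2).+1 ^ 2)).
- by move=> w; apply/N_ev/Nb.
- move=> T r w a b' /= e0.
  have [y yE] : N (b * ev cl a) by apply/N_ev/Nb.
  rewrite (eq_bigr (fun t => y * act (r t) (b * ev cl (w t)) * ev cl b')).
    by rewrite -mulr_suml -mulr_sumr e0 mulr0 mul0r.
  move=> t _; have Nw : N (b * ev cl (w t)) by apply/N_ev/Nb.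
  rewrite !ev_cat mulrA yE -(mulrA y) (mulrA b) [y * _]mulrA -[LHS]act_ev; last first.
    by rewrite mulrA; have [_ _ NM] := Nl; rewrite -mulrA; apply: NM.
  by rewrite /act !mulrA.
- move=> n T f _ sf fx.
  pose X (p : T * 'I_n.+1) := b * ev cl (f p.1) * z ^+ p.2.
  have VX p : Vn v (s2 + n * s0 + n * s1) (X p).
    apply: VnM; first apply: VnM => //.
      by apply: Vn_mono (Vcl _); rewrite leq_mul2r sf orbT.
    by apply: (@Vn_mono _ _ _ _ (p.2 * s1)); [rewrite leq_mul2r -ltnS ltn_ord orbT|apply: VnX].
  have fX : kfree [set 0] X.
    move=> r /= r0 [t i].
    pose q t : {poly k} := \poly_(i < n.+1) r (t, inord i).
    have q0 : \sum_t act (q t) (b * ev cl (f t)) = 0.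
      rewrite -[RHS]r0 (eq_bigr (fun t => \sum_i r (t, i) *: X (t, i))).
        by rewrite pair_bigA; apply: eq_bigr => -[].
      move=> t' _; rewrite /act /ez /q poly_def linear_sum mulr_sumr.
      apply: eq_bigr => j _; rewrite -mul_polyC rmorphM rmorphXn /= horner_algC horner_algX.
      by rewrite mulr_algl -scalerAr inord_val.
    have := fx q q0 t => /(congr1 (fun p : {poly k} => p`_i)).
    by rewrite coef_poly ltn_ord inord_val coef0.
  have := growth VX fX; rewrite card_prod !card_ord => h.
  rewrite -(leq_pmul2r (ltn0Sn n)); apply: leq_trans h _.
  rewrite -(mulnA (C * _)) -(mulnA C) leq_mul2l mulnn -expnMn leq_exp2r //.
  by apply/orP; right; lia.
move=> w w0; have [f [f0]] := algebraic_over (czt_ev w0); rewrite act2_b => fb.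
have sf : size f = (size f).-1.+1 by rewrite prednK // lt0n size_poly_eq0.
have evX i : ev cl (wpow w i) = ev cl w ^+ i.
  by elim: i => [|i IH]; rewrite ?ev_nil // wpowS ev_cat IH exprS.
exists (size f).-1, (lead_coef f); rewrite lead_coef_eq0; split=> //.
exists (fun i : 'I_(size f).-1 => - f`_i) => /=.
rewrite -[RHS]fb sf big_ord_recr /= [RHS]addrC -sumrN; congr (_ + _).
  by rewrite /act evX lead_coefE.
by apply: eq_bigr => i _; rewrite /act /ez rmorphN mulrN opprK evX.
Qed.

End Letters.

(* If no n + 2 elements of degree n + 1 are independent, then up to denominators
   from k[z] left multiplication by words maps the n + 1 given ones to their
   combinations with coefficients generated by a finite subset of the
   centralizer; by [words_bounded] the rank over k[z] would be finite. *)
Lemma right_independent n : exists x : 'I_n.+1 -> A, (forall i, Vn v n (x i)) /\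
  forall c : 'I_n.+1 -> A, (forall i, czt (c i)) ->
     \sum_i x i * (b * c i) = 0 -> forall i, b * c i = 0.
Proof.
elim: n => [|n [x [Vx ind]]].
  exists (fun=> 1); split=> [_|c _]; first exact: Vn1.
  by rewrite big_ord1 mul1r => e i; rewrite ord1.
apply: contrapT => ne.
have dep u Vu := dependent_elt (u := u) Vx Vu ind ne.
(* These are 1 and the products of a letter with some x i. The centralizing coefficients that
   express them become the finite alphabet [cl]. *)
pose U (o : option ('I_g * 'I_n.+1)) : A := if o is Some p then v p.1 * x p.2 else 1.
have /choice[qc qcP] : forall o, exists qc : {poly k} * ('I_n.+1 -> A),
    [/\ qc.1 != 0, forall i, czt (qc.2 i) & U o * (b * ez qc.1) = \sum_i x i * (b * qc.2 i)].
  move=> o; have [|q [c H]] := dep (U o); last by exists (q, c).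
  case: o => [[s i]|] /=; last exact: Vn1.
  rewrite -add1n; apply: VnM => //.
  by rewrite -[v s]mulr1 -(ev_nil v) -ev_cons; apply: Vn_ev.
pose T0 : finType := (option ('I_g * 'I_n.+1) * 'I_n.+1)%type.
pose cl (h : 'I_#|T0|) := (qc (enum_val h).1).2 (enum_val h).2.
have clP h : czt (cl h) by have [_ cP _] := qcP (enum_val h).1; apply: cP.
have [L LP] := words_bounded clP.
pose Y (p : 'I_n.+1 * L.-bseq 'I_#|T0|) : A := x p.1 * (b * ev cl p.2).
have [_ _ NM] := Nl.
have Nw w : N (b * ev cl w) by apply/(N_ev clP)/Nb.
have NY p : N (Y p) by apply: NM.
have HD := act_domain.
have D1 i w : rdep act [set 0] Y (x i * (b * ev cl w)).
  apply: (rdep_comp HD (f := pair i) NY); first exact: NM.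
  exact: (rdep_left (x i) (LP w)).
have D2 o w : rdep act [set 0] Y (U o * (b * ev cl w)).
  have [q0 cP qE] := qcP o.
  apply: (rdep_unact HD NY _ q0); first exact: NM.
  have -> : act (qc o).1 (U o * (b * ev cl w)) =
      \sum_i x i * (b * ev cl (enum_rank ((o, i) : T0) :: w)).
    have -> : U o * (b * ev cl w) = U o * b * ev cl w by rewrite mulrA.
    rewrite -(act_ev clP); last by apply/NM/Nb.
    rewrite /act -(mulrA (U o)) qE mulr_suml; apply: eq_bigr => i _.
    by rewrite ev_cons /cl enum_rankK /= !mulrA.
  apply: (rdep_sum HD NY) => [i|i]; [exact: NM|exact: D1].
have D3 w : rdep act [set 0] Y (ev v w * b).
  elim: w => [|i w IH].
    by have := D2 None [::]; rewrite /= !ev_nil mulr1.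
  rewrite ev_cons -mulrA.
  apply: (rdep_trans HD _ NY _ (rdep_left (v i) IH)); [by move=> p; apply: NM|by apply/NM/NM/Nb|].
  by move=> [j u]; rewrite /Y /= mulrA; apply: (D2 (Some (i, j))).
have D4 y : N y -> rdep act [set 0] Y y.
  move=> [a ->]; have [m Va] := Vall a; have [c ->] := VnP Va.
  rewrite mulr_suml; apply: (rdep_sum HD NY) => w.
    by apply: NM; apply: Nb.
  have -> : c w *: ev v w * b = act (c w)%:P (ev v w * b).
    by rewrite /act /ez horner_algC mulr_algr scalerAl.
  by apply: (rdep_act HD) => //; apply/NM/Nb.
have [T [y [Ny fy lt]]] := infinite_rank #|{: 'I_n.+1 * L.-bseq 'I_#|T0|}|.
have := @steinitz _ _ _ _ _ HD T _ y Y Ny NY fy (fun t => D4 _ (Ny t)).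
by rewrite leqNgt lt.
Qed.

(** Multiplying the b x t b by the n + 1 elements of [right_independent] gives (n + 1) |T|
    independent elements of degree O(n). *)
Lemma centralizer_growth : exists E, forall n (T : finType) (x : T -> A),
  (forall t, Vn v n (x t)) -> (forall t, b * x t * b * y0 * b = b * y0 * b * x t * b) ->
  kfree [set 0] (fun t => b * x t * b) -> (#|T| <= E * n.+1)%N.
Proof.
have [s Vb] := Vall b; exists (C * (2 * s).+2 ^ 2)%N => n T x Vx cx fx.
have xc t : czt (x t * b) by split; [exists (x t)|rewrite /z; have := cx t; rewrite !mulrA].
have [x' [Vx' ind]] := right_independent n.
pose X (p : T * 'I_n.+1) := x' p.2 * (b * (x p.1 * b)).
have VX p : Vn v (n + (s + (n + s))) (X p) by do !apply: VnM.
have fX : kfree [set 0] X.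
  move=> r /= r0 [t i].
  have /(_ i) e : forall i, b * \sum_t r (t, i) *: (x t * b) = 0.
    apply: ind => [j|].
      elim/big_ind: _ => [||t' _]; [exact: czt_lideal0|exact: cztD|exact: cztZ].
    rewrite -[RHS]r0 (eq_bigr (fun j => \sum_t r (t, j) *: X (t, j))).
      by rewrite exchange_big pair_bigA; apply: eq_bigr => -[].
    by move=> j _; rewrite !mulr_sumr; apply: eq_bigr => t' _; rewrite -!scalerAr.
  apply: (fx (fun t => r (t, i))) => /=; rewrite -[RHS]e mulr_sumr; apply: eq_bigr => t' _.
  by rewrite -scalerAr mulrA.
have := growth VX fX; rewrite card_prod card_ord => h.
rewrite -(leq_pmul2r (ltn0Sn n)); apply: leq_trans h _.
rewrite -(mulnA (C * _)) -(mulnA C) leq_mul2l mulnn -expnMn leq_exp2r //.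
by apply/orP; right; lia.
Qed.

End Centralizer.

(** * Counting functionals *)

Definition nzideal (A : nzRingType) (J : set A) := ideal2 J /\ exists2 x, J x & x <> 0.

Section Counting.
Variables (k : fieldType) (A : algType k) (g : nat) (v : 'I_g -> A) (C : nat).
Variables (K : fieldType) (iota : {rmorphism k -> K}).
Hypothesis growth : forall n (T : finType) (x : T -> A),
  (forall t, Vn v n (x t)) -> kfree [set 0] x -> (#|T| <= C * n.+1 ^ 2)%N.

Definition functional (phi : A -> K) :=
  (forall x y, phi (x + y) = phi x + phi y) /\ (forall c x, phi (c *: x) = iota c * phi x).

Lemma functional0 phi : functional phi -> phi 0 = 0.
Proof. by move=> [D _]; apply: (@addrI _ (phi 0)); rewrite -D !addr0. Qed.

Lemma functional_sum phi (T : finType) (x : T -> A) : functional phi ->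
  phi (\sum_t x t) = \sum_t phi (x t).
Proof. by move=> H; apply: (big_morph _ H.1 (functional0 H)). Qed.

Variables (good : (A -> K) -> Prop) (R : nat).

(* Functionals that vanish on some smaller ideal but are independent already on
   [J]; the factor [R] accounts for the rank of b being d / R only. *)
Definition gadget (J : set A) := exists J' c, [/\ nzideal J', J' `<=` J &
  forall n, exists (T : finType) (phi : T -> A -> K),
    [/\ (n <= #|T| * R)%N, forall t, functional (phi t) /\ good (phi t),
        forall t x, J' x -> phi t x = 0 &
        forall r : T -> K, (forall x, Vn v (n + c) x -> J x -> \sum_t r t * phi t x = 0) ->
          forall t, r t = 0]].

(** The old functionals vanish on J, so a relation restricted to J kills the coefficients of the new
    ones first. *)
Lemma stack_gadgets : nzideal [set: A] -> (forall J, nzideal J -> gadget J) ->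
  forall m, exists J c, nzideal J /\
  forall n, exists (T : finType) (phi : T -> A -> K),
    [/\ (m * n <= #|T| * R)%N, forall t, functional (phi t) /\ good (phi t),
        forall t x, J x -> phi t x = 0 &
        forall r : T -> K, (forall x, Vn v (n + c) x -> \sum_t r t * phi t x = 0) ->
          forall t, r t = 0].
Proof.
move=> nzA gad; elim=> [|m [J [c [nzJ IH]]]].
  exists setT, 0%N; split=> // n; exists void, (fun _ _ => 0).
  by split=> // -[].
have [J' [c' [nzJ' J'J gJ]]] := gad J nzJ.
exists J', (c + c')%N; split=> // n.
have [T [phi [cT phg phJ phi_ind]]] := IH n.
have [T' [phi' [cT' phg' phJ' phi_ind']]] := gJ n.
pose ph (s : T + T') : A -> K := match s with inl t => phi t | inr t => phi' t end.
exists (T + T')%type, ph; split.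
- by rewrite card_sum mulnDl mulSn addnC leq_add.
- by case.
- by case=> [t x /J'J|t x]; [apply: phJ|apply: phJ'].
move=> r rP.
have sumE x : \sum_s r s * ph s x = \sum_t r (inl t) * phi t x + \sum_t r (inr t) * phi' t x.
  exact: big_sumType.
have r' t : r (inr t) = 0.
  apply: (phi_ind' (fun t => r (inr t))) => x Vx Jx.
  have := rP x; rewrite sumE big1 ?add0r => [|t' _]; last by rewrite phJ // mulr0.
  by apply; apply: Vn_mono Vx; lia.
case=> [t|//]; apply: (phi_ind (fun t => r (inl t))) => x Vx.
have := rP x; rewrite sumE [X in _ + X]big1 ?addr0 => [|t' _]; last by rewrite r' mul0r.
by apply; apply: Vn_mono Vx; lia.
Qed.

Variables (theta pi : {linear A -> A}) (s E : nat).
Hypothesis s_gt0 : (0 < s)%N.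
Hypothesis thetaV : forall n x, Vn v n x -> Vn v (n + s) (theta x).
Hypothesis goodP : forall phi, functional phi -> good phi ->
  (forall x, phi (theta x) = 0) /\ (forall x, pi x = 0 -> phi x = 0).
Hypothesis piV : exists a, forall n x, Vn v n x -> Vn v (n + a) (pi x).
Hypothesis kernel_growth : forall n (T : finType) (x : T -> A),
  (forall t, Vn v n (x t)) -> (forall t, pi (theta (x t)) = 0) ->
  kfree [set 0] (pi \o x) -> (#|T| <= E * n.+1)%N.

Let H0 : domain_action (fun (c : k) (x : A) => c *: x) setT [set 0].
Proof.
by apply: kact_domain => [|x y -> ->|c x ->] //=; rewrite ?subr0 ?scaler0.
Qed.

Lemma max_image (f : {linear A -> A}) n m :
  (forall (T : finType) (x : T -> A), (forall t, Vn v n (x t)) -> kfree [set 0] (f \o x) -> (#|T| <= m)%N) ->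
  exists h (x : 'I_h -> A), [/\ forall t, Vn v n (x t), kfree [set 0] (f \o x) &
    forall y, Vn v n y -> exists c : 'I_h -> k, f y = f (\sum_t c t *: x t)].
Proof.
move=> bnd.
have [||T [y [Sy fy dy]]] := @rfree_max _ _ _ _ _ H0 (f @` Vn v n) m.
- by [].
- move=> T y Sy fy; have /choice[x xP] : forall t, exists x, Vn v n x /\ f x = y t.
    by move=> t; have [x ? ?] := Sy t; exists x.
  apply: (bnd T x) => [t|]; first by case: (xP t).
  by have -> : f \o x = y by apply/funext => t; case: (xP t).
have /choice[x xP] : forall t, exists x, Vn v n x /\ f x = y t.
  by move=> t; have [x ? ?] := Sy t; exists x.
pose e : 'I_#|T| -> T := enum_val.
exists #|T|, (x \o e); split=> [t||z Vz]; first by case: (xP (e t)).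
  have -> : f \o (x \o e) = y \o e by apply/funext => t /=; case: (xP (e t)).
  by apply: (rfree_inj H0) => //; apply: enum_val_inj.
have [|c ce] := (kdepP y (f z) _).1 (dy _ (ex_intro2 _ _ z Vz erefl)).
  by move=> c x0 ->; rewrite /= scaler0.
exists (c \o e); move/eqP: ce; rewrite subr_eq0 => /eqP ->.
rewrite linear_sum (reindex (@enum_val T predT)) /=; last exact/onW_bij/enum_val_bij.
by apply: eq_bigr => t _; rewrite linearZ /=; case: (xP (e t)) => _ ->.
Qed.

(* With [a n] the dimension of [pi] of Vn, independent functionals on Vn (n + s)
   that factor through [pi] and kill the image of [theta] number at most
   [a (n + s)] minus the rank of [pi \o theta] on Vn, which is [a n] up to O(n). *)
Lemma functional_gap : exists a : nat -> nat, (exists a0, forall n, (a n <= C * (n + a0).+1 ^ 2)%N) /\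
  forall n (T : finType) (phi : T -> A -> K),
   (forall t, functional (phi t) /\ good (phi t)) ->
   (forall r : T -> K, (forall x, Vn v (n + s) x -> \sum_t r t * phi t x = 0) -> forall t, r t = 0) ->
   (#|T| + a n <= a (n + s) + E * n.+1)%N.
Proof.
have [a0 piV'] := piV.
have bnd n (T : finType) (x : T -> A) : (forall t, Vn v n (x t)) -> kfree [set 0] (pi \o x) ->
    (#|T| <= C * (n + a0).+1 ^ 2)%N.
  by move=> Vx fx; apply: growth fx => t; apply: piV'.
have /choice[a aP] n := max_image (f := pi) (bnd n).
exists a; split.
  by exists a0 => n; have [x [Vx fx _]] := aP n; have := bnd n _ x Vx fx; rewrite card_ord.
move=> n T phi phg ind.
have [u [Vu fu du]] := aP n.
pose pt : {linear A -> A} := pi \o theta.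
have bnd' (S : finType) (x : S -> A) : (forall t, Vn v n (x t)) -> kfree [set 0] (pt \o x) ->
    (#|S| <= C * ((n + s) + a0).+1 ^ 2)%N.
  by move=> Vx fx; apply: growth fx => t; apply/piV'/thetaV.
have [h [x [Vx fx dx]]] := max_image bnd'.
have le1 : (a n <= h + E * n.+1)%N.
  rewrite leqNgt; apply/negP => lt.
  have /choice[c cP] : forall i, exists c : 'I_h -> k, pt (u i) = pt (\sum_t c t *: x t).
    by move=> i; apply: dx.
  have [|e [eB ef]] := @kernel_family k 'I_(a n) 'I_h c (E * n.+1).+1.
    by rewrite !card_ord addnS.
  pose y i := \sum_j e i j *: u j.
  suff : (#|'I_(E * n.+1).+1| <= E * n.+1)%N by rewrite card_ord ltnn.
  apply: (kernel_growth (x := y)).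
  - by move=> i; apply: Vn_sum => j; apply: VnZ.
  - move=> i; rewrite -[LHS]/(pt (y i)) /y linear_sum.
    rewrite (eq_bigr (fun j => \sum_t (e i j * c j t) *: pt (x t))).
      by rewrite exchange_big big1 //= => t _; rewrite -scaler_suml eB scale0r.
    move=> j _; rewrite linearZ /= -[pi (theta _)]/(pt (u j)) cP linear_sum scaler_sumr.
    by apply: eq_bigr => t _; rewrite linearZ /= scalerA.
  move=> r /= r0; apply: ef => j; apply: (fu (fun j => \sum_i r i * e i j)) => /=.
  rewrite -[RHS]r0 (eq_bigr (fun j => \sum_i (r i * e i j) *: pi (u j))).
    rewrite exchange_big; apply: eq_bigr => i _ /=; rewrite /y linear_sum scaler_sumr.
    by apply: eq_bigr => j' _; rewrite linearZ /= scalerA.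
  by move=> j' _; rewrite scaler_suml.
have [u' [Vu' fu' du']] := aP (n + s)%N.
have phpi t y y' : pi y = pi y' -> phi t y = phi t y'.
  have [pf pg] := phg t; have [_ gP] := goodP pf pg => e.
  have := gP (y - y'); rewrite linearB e subrr => /(_ erefl).
  by rewrite pf.1 -scaleN1r pf.2 rmorphN1 mulN1r => /eqP; rewrite subr_eq0 => /eqP.
have phS t (c : 'I_(a (n + s)%N) -> k) : phi t (\sum_j c j *: u' j) = \sum_j iota (c j) * phi t (u' j).
  have [pf pg] := phg t; rewrite functional_sum //; apply: eq_bigr => j _; exact: pf.2.
pose Ph : 'M[K]_(#|T|, a (n + s)%N) := \matrix_(i, j) phi (enum_val i) (u' j).
have rPh : \rank Ph = #|T|.
  apply/eqP; rewrite -[_ == _]/(row_free Ph) -kermx_eq0; apply/rowV0P => w /sub_kermxP wPh.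
  apply/rowP => i; rewrite mxE -[i]enum_valK.
  apply: (ind (fun t => w 0 (enum_rank t))) => y Vy; have [c cE] := du' y Vy.
  rewrite (eq_bigr (fun t => \sum_j iota (c j) * (w 0 (enum_rank t) * phi t (u' j)))); last first.
    by move=> t _; rewrite (phpi t _ _ cE) phS mulr_sumr; apply: eq_bigr => j _; rewrite mulrCA.
  rewrite exchange_big big1 //= => j _; rewrite -mulr_sumr.
  have := congr1 (fun X : 'rV_ _ => X 0 j) wPh; rewrite !mxE => e.
  rewrite (_ : \sum_t _ = 0) ?mulr0 //; apply: etrans e.
  rewrite (reindex (@enum_val T predT)) /=; last exact/onW_bij/enum_val_bij.
  by apply: eq_bigr => t _; rewrite enum_valK [Ph _ _]mxE.
have /choice[e eP] : forall i, exists e : 'I_(a (n + s)%N) -> k, pi (theta (x i)) = pi (\sum_j e j *: u' j).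
  by move=> i; apply: du'; apply: thetaV.
pose Em : 'M[k]_(h, a (n + s)%N) := \matrix_(i, j) e i j.
have rEm : \rank Em = h.
  apply/eqP; rewrite -[_ == _]/(row_free Em) -kermx_eq0; apply/rowV0P => w /sub_kermxP wE.
  apply/rowP => i; rewrite mxE; apply: (fx (fun i => w 0 i)) => /=.
  rewrite (eq_bigr (fun i => \sum_j (w 0 i * e i j) *: pi (u' j))).
    rewrite exchange_big big1 //= => j _; rewrite -scaler_suml.
    have := congr1 (fun X : 'rV_ _ => X 0 j) wE; rewrite !mxE => E0.
    rewrite (_ : \sum_i _ = 0) ?scale0r //; apply: etrans E0.
    by apply: eq_bigr => i' _; rewrite mxE.
  move=> i' _; rewrite eP linear_sum scaler_sumr; apply: eq_bigr => j _.
  by rewrite linearZ /= scalerA.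
have PE : Ph *m (map_mx iota Em)^T = 0.
  apply/matrixP => i j; rewrite !mxE.
  have [pf pg] := phg (enum_val i); have [gP _] := goodP pf pg.
  apply: etrans (gP (x j)); rewrite (phpi _ _ _ (eP j)) phS; apply: eq_bigr => l _.
  by rewrite !mxE mulrC.
have := mulmx0_rank_max PE; rewrite mxrank_tr mxrank_map rPh rEm.
by move: le1; lia.
Qed.

(** Summing the gaps over steps of length s makes R a(c + j s) at least Q j^2 / 2 up to a linear
    term, against the quadratic bound on a. *)
Lemma growth_contradiction :
  ~ forall m, exists c, forall n, exists (T : finType) (phi : T -> A -> K),
    [/\ (m * n <= #|T| * R)%N, forall t, functional (phi t) /\ good (phi t) &
        forall r : T -> K, (forall x, Vn v (n + c) x -> \sum_t r t * phi t x = 0) ->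
          forall t, r t = 0].
Proof.
have [a [[a0 ale] gap]] := functional_gap.
move=> all.
(* Q / 2 exceeds R C (s + 1)^2 by 1, which absorbs the linear loss j W; the summand R E of m pays
   for the kernel. *)
pose Q := (2 * R * C * s.+1 ^ 2 + 2)%N.
have [c cP] := all (R * E + Q)%N.
pose W := (R * E * c.+1)%N; pose al j := a (c + j * s)%N.
have step j : (Q * j.+1 + R * al j <= R * al j.+1 + W)%N.
  have [T [phi [cT phg ind]]] := cP (j.+1 * s)%N.
  have eN : (j.+1 * s + c = c + j * s + s)%N by rewrite mulSn; lia.
  have := gap (c + j * s)%N T phi phg; rewrite -eN => /(_ ind); rewrite addnC in eN.
  rewrite -[(j.+1 * s + c)%N]addnC -/(al j.+1) -/(al j) => le.
  have le1 : (R * #|T| + R * al j <= R * al j.+1 + R * E * (c + j * s).+1)%N.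
    by rewrite -!mulnDr -mulnA -mulnDr leq_mul2l le orbT.
  have le2 : (R * E * (c + j * s).+1 <= W + R * E * (j.+1 * s))%N.
    by rewrite /W -mulnDr leq_mul2l; apply/orP; right; rewrite mulSn; lia.
  have le3 : (Q * j.+1 <= Q * (j.+1 * s))%N by rewrite leq_mul2l leq_pmulr // orbT.
  move: cT; rewrite mulnDl [(#|T| * R)%N]mulnC; lia.
have sum j : (Q * j ^ 2 <= 2 * (R * al j) + 2 * (j * W))%N.
  elim: j => [|j IH]; first by rewrite muln0.
  have st := step j.
  have -> : (Q * j.+1 ^ 2 = Q * j ^ 2 + 2 * (Q * j) + Q)%N by nia.
  have e1 : (Q * j.+1 = Q * j + Q)%N by nia.
  have e2 : (j.+1 * W = j * W + W)%N by nia.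
  by rewrite e1 in st; rewrite e2; lia.
pose j := (W + c + a0 + 1)%N.
have le1 := sum j.
have le2 : (al j <= C * (j * s.+1) ^ 2)%N.
  apply: leq_trans (ale _) _; rewrite leq_mul2l leq_exp2r //; apply/orP; right.
  by rewrite mulnS; set js := (j * s)%N; rewrite /j; lia.
have le3 : (2 * (R * al j) <= 2 * R * C * s.+1 ^ 2 * j ^ 2)%N.
  have -> : (2 * R * C * s.+1 ^ 2 * j ^ 2 = 2 * (R * (C * (j * s.+1) ^ 2)))%N by rewrite expnMn; nia.
  by rewrite !leq_mul2l le2 !orbT.
have le4 : (j * W < j ^ 2)%N.
  by rewrite -mulnn ltn_mul2l; apply/andP; split; rewrite /j; lia.
move: le1; rewrite /Q mulnDl; lia.
Qed.

End Counting.

(** * Functionals from uncountable families *)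

Lemma ex_linear (k : fieldType) (A : algType k) (f : A -> A) : linear f ->
  exists F : {linear A -> A}, forall x, F x = f x.
Proof.
move=> lf; pose F : {linear A -> A} := HB.pack f (GRing.isLinear.Build k A A *:%R f lf).
by exists F.
Qed.

Section Main.
Variables (k : fieldType) (A : algType k) (g : nat) (v : 'I_g -> A) (C : nat).
Variables (K : fieldType) (iota : {rmorphism k -> K}).
Hypothesis Kc : forall p : {poly K}, (1 < size p)%N -> exists x, root p x.
Hypothesis Kunc : ~ countable [set: K].
Hypothesis kunc : ~ countable [set: k].
Hypothesis Vall : forall x, exists n, Vn v n x.
Hypothesis growth : forall n (T : finType) (x : T -> A),
  (forall t, Vn v n (x t)) -> kfree [set 0] x -> (#|T| <= C * n.+1 ^ 2)%N.
Hypothesis prA : prime_ring A.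
Hypothesis goA : left_goldie A.
Hypothesis notPI : ~ satisfies_pi A.
Hypothesis notPrim : ~ primitive_ring A.

Definition prim (P : set A) := exists L, lmax L /\ P = core L.

Lemma prim_nz P : prim P -> nzideal P.
Proof.
move=> [L [Lm ->]]; have [Ll _ _] := Lm; split; first exact: core_ideal2.
apply: contrapT => nx; apply: notPrim; apply: (core0_primitive Lm).
apply/seteqP; split=> [x Px|_ ->]; last by case: (core_ideal2 Ll) => -[].
by apply: contrapT => x0; apply: nx; exists x.
Qed.

Lemma prim1 P : prim P -> ~ P 1.
Proof. by move=> [L [[_ L1 _] ->]] /core_sub. Qed.

Lemma nz_linear (J : set A) : nzideal J -> exists D, linear_growth v J D.
Proof.
move=> [Ji [x Jx x0]]; have [c [Jc cr]] := left_regular_mem prA goA Ji Jx x0.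
exact: linear_growth_ideal Vall growth _ _ Ji Jc cr.
Qed.

Lemma nzI (J J' : set A) : nzideal J -> nzideal J' -> nzideal (J `&` J').
Proof.
move=> [[[J0 JB JM] Jr] [x Jx x0]] [[[J0' JB' JM'] Jr'] [y Jy y0]]; split.
  split; first split=> //.
  - by move=> a b [? ?] [? ?]; split; [apply: JB|apply: JB'].
  - by move=> a b [? ?]; split; [apply: JM|apply: JM'].
  - by move=> a b [? ?]; split; [apply: Jr|apply: Jr'].
apply: contrapT => nz; have e : forall a, x * a * y = 0.
  move=> a; apply: contrapT => ne; apply: nz; exists (x * a * y) => //.
  by split; [exact/Jr/Jr|exact: JM'].
by case: (prime_ring_mul prA e).
Qed.

Lemma prim_cofinite L : lmax L -> exists n D, linear_growth v L D /\
  forall x, exists2 y, Vn v n y & L (x - y).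
Proof.
move=> Lm; have [D lgr] := nz_linear (prim_nz (ex_intro _ L (conj Lm erefl))).
have [n cof] := core_cofinite Vall growth kunc Lm lgr.
by exists n, D; split=> //; apply: linear_growthS lgr; apply: core_sub.
Qed.

Lemma ex_rep_prim P : prim P -> exists R : {d & A -> 'M[K]_d},
  rep iota (projT2 R) /\ forall a, projT2 R a = 0 <-> P a.
Proof.
move=> [L [Lm ->]]; have [n [D [lgr cof]]] := prim_cofinite Lm.
have [d [rho H]] := ex_rep iota Lm lgr cof.
by exists (existT _ d rho).
Qed.

(** A / core L embeds in the endomorphisms of the finite-dimensional space A / L. *)
Lemma ex_codim P : prim P -> exists n (u : 'I_n -> A), kfree P u /\ forall x, kdep P u x.
Proof.
move=> [L [Lm ->]]; have [n [D [lgr cof]]] := prim_cofinite Lm.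
have [Ll L1 _] := Lm; have [N [u [fu du]]] := cofinite_basis Ll lgr cof.
have [cd [cdD cdZ cd0 _]] := ex_coord Ll fu du.
have [Pl _] := core_ideal2 Ll; have HP := lideal_kact Pl.
have bnd (T : finType) (x : T -> A) : kfree (core L) x -> (#|T| <= N * N)%N.
  move=> fx; rewrite leqNgt; apply/negP => lt.
  have [|c [[t ct] cP]] := @idomain_kernel k T ('I_N * 'I_N)%type (fun t p => cd (x t * u p.1) p.2 0).
    by rewrite card_prod card_ord.
  case/eqP: ct; apply: fx => /= b.
  have [e Le] := du b; have [L0 LB LM] := Ll.
  rewrite -[b](subrK (\sum_i e i *: u i)) mulrDr; apply: lidealD => //; first exact: LM.
  rewrite mulr_sumr; apply: lideal_sum => // i; rewrite -scalerAr; apply: lidealZ => //.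
  apply/cd0; apply/colP => j; rewrite mxE; apply: etrans (cP (i, j)) => /=.
  have cd00 : cd 0 = 0 by apply/cd0.
  rewrite mulr_suml (big_morph cd cdD cd00) summxE; apply: eq_bigr => t' _.
  by rewrite -scalerAl cdZ mxE.
have [//|T x _|T [w [_ fw dw]]] := @rfree_max _ _ _ _ _ HP setT (N * N)%N; first exact: bnd.
exists #|T|, (w \o enum_val); split; first by apply: (rfree_inj HP) => //; apply: enum_val_inj.
move=> x; apply/kdep_lideal => //.
apply: (rdep_trans HP _ _ _ (dw x _)) => // t.
by rewrite -[t]enum_rankK; apply: (rdep_mem HP (x := w \o enum_val)).
Qed.

Definition codim (P : set A) n := exists u : 'I_n -> A, kfree P u /\ forall x, kdep P u x.

Lemma prim_sep P Q n : prim P -> prim Q -> codim P n -> codim Q n -> P <> Q ->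
  exists x, Q x /\ ~ P x.
Proof.
move=> pP pQ [u [fu du]] [w [fw dw]] PQ; apply: contrapT => nx; apply: PQ.
have [[Pl _] _] := prim_nz pP; have [[Ql _] _] := prim_nz pQ.
have QP : Q `<=` P by move=> x Qx; apply: contrapT => Px; apply: nx; exists x.
apply/seteqP; split=> // x Px; apply: contrapT => Qx.
pose y (o : option 'I_n) := if o is Some i then u i else x.
have HQ := lideal_kact Ql.
have fy : kfree Q y.
  move=> r; rewrite big_option /= => Qr.
  have ri i : r (Some i) = 0.
    apply: (fu (fun i => r (Some i))) => /=.
    have := QP _ Qr; set s := \sum_t _ => h; rewrite -[s](addKr (r None *: x)).
    by apply: lidealD => //; apply: lidealN => //; apply: lidealZ.
  case=> [i|]; first exact: ri.
  apply: contrapT => /eqP r0; apply: Qx.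
  have := Qr; rewrite big1 ?addr0 => [|i _]; last by rewrite ri scale0r.
  by move/(lidealZ (r None)^-1 Ql); rewrite scalerA mulVf // scale1r.
have := @steinitz _ _ _ _ _ HQ _ _ y w (fun _ => Logic.I) (fun _ => Logic.I) fy
  (fun t => (kdep_lideal w (y t) Ql).2 (dw (y t))).
by rewrite card_option card_ord ltnn.
Qed.

Variable R : set A -> {d & A -> 'M[K]_d}.
Hypothesis RP : forall P, prim P -> rep iota (projT2 (R P)) /\ forall a, projT2 (R P) a = 0 <-> P a.

(** Degree and codimension take countably many values, so both are constant on an uncountable
    subfamily; equal codimension excludes inclusions and lets [prim_sep] separate the points. *)
Lemma select (S : {d & A -> 'M[K]_d} -> Prop) (F : set (set A)) :
  (forall P, F P -> prim P /\ S (R P)) -> ~ countable F ->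
  exists d (Lam : choiceType) (Pl : Lam -> set A) (rho : Lam -> A -> 'M[K]_d),
  [/\ forall l, F (Pl l), forall l, rep iota (rho l), forall l a, rho l a = 0 <-> Pl l a,
      forall l, S (existT _ d (rho l)) &
      (forall l l', l != l' -> exists x, rho l x != 0 /\ rho l' x = 0) /\ ~ countable [set: Lam]].
Proof.
move=> FS nF.
pose G n := [set P | exists d N, [/\ n = pickle (d, N), projT1 (R P) = d & codim P N]].
have FG P : F P -> exists n, G n P.
  move=> /FS[pP _]; have [N cP] := ex_codim pP.
  by exists (pickle (projT1 (R P), N)), (projT1 (R P)), N.
have [n nG] := uncountable_cases nF FG.
have [f [_ /(_ ord0)[_ [d [N [nE _ _]]]]]] := uncountable_inj 1 nG.
have GE P : G n P -> projT1 (R P) = d /\ codim P N.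
  by move=> [d' [N' [nE' dE cP]]]; move: nE'; rewrite nE => /(pcan_inj pickleK) [-> ->].
pose F' := F `&` G n; pose Lam : choiceType := set_type F'.
pose Pl (l : Lam) : set A := val l.
have PlF l : F' (Pl l) by apply: set_mem; apply: (valP l).
have /choice[rho rhoE] : forall l, exists rho : A -> 'M[K]_d, R (Pl l) = existT _ d rho.
  move=> l; have [_ /GE[dE _]] := PlF l; move: dE; case: (R (Pl l)) => d' rho /= e.
  by move: rho; rewrite e => rho; exists rho.
have pPl l : prim (Pl l) by have [/FS[]] := PlF l.
have RPl l : rep iota (rho l) /\ forall a, rho l a = 0 <-> Pl l a.
  by have := RP (pPl l); rewrite rhoE.
exists d, Lam, Pl, rho; split.
- by move=> l; case: (PlF l).
- by move=> l; case: (RPl l).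
- by move=> l; case: (RPl l).
- by move=> l; rewrite -rhoE; have [/FS[]] := PlF l.
split; last first.
  move=> cL; apply: nG; rewrite -/F'.
  have -> : F' = Pl @` [set: Lam].
    apply/seteqP; split=> [P FP|_ [l _ <-]] //.
    by exists (SigSub (mem_set FP)).
  exact: sub_countable (card_image_le _ _) cL.
move=> l l' ll'; have [_ /GE[_ cP]] := PlF l; have [_ /GE[_ cP']] := PlF l'.
have [|x [Px nPx]] := prim_sep (pPl l) (pPl l') cP cP'.
  by move/val_inj => e; rewrite e eqxx in ll'.
exists x; split; last by apply/(RPl l').2.
by apply/eqP => /(RPl l).2.
Qed.

Lemma singular_col d (X : 'M[K]_d) : \det X = 0 -> exists2 s : 'cV[K]_d, s <> 0 & X *m s = 0.
Proof.
move/eqP; rewrite -det_tr => /det0P[w w0 wX]; exists w^T.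
  by move/(congr1 trmx); rewrite trmxK trmx0; apply/eqP.
by apply: trmx_inj; rewrite trmx_mul trmxK wX trmx0.
Qed.

Lemma irr_bounded d (rho : A -> 'M[K]_d) m m' (X : 'M[K]_(m, d)) (W : 'M[K]_(d, m')) :
  rep iota rho -> (forall y, Vn v d y -> X *m rho y *m W = 0) -> X = 0 \/ W = 0.
Proof.
move=> rP XW; case: (pselect (W = 0)) => [|W0]; [by right|left].
apply/row_matrixP => i; rewrite row0.
have sep1 (t t' : unit) : t != t' -> exists x, rho x != 0 /\ rho x = 0 by case: t; case: t'.
have [|//|//] := fill Vall (T := unit) (fun=> rP) sep1 (xi := fun=> row i X) (w := fun=> W) _ tt.
move=> x; rewrite card_unit mul1n => Vx.
by rewrite (bigD1 tt) //= big1 ?addr0 => [|[]//]; rewrite -!row_mul XW ?row0.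
Qed.

Section Points.
Variables (J : set A) (d : nat) (Lam : choiceType) (Pl : Lam -> set A) (rho : Lam -> A -> 'M[K]_d).
Hypothesis kP : forall l a, rho l a = 0 <-> Pl l a.
Hypothesis rP : forall l, rep iota (rho l).

Lemma uniform_nonzero (F : set Lam) : (forall l, ~ J `<=` Pl l) -> ~ countable F ->
  exists j, ~ countable (F `&` [set l | exists z, [/\ J z, Vn v j z & rho l z <> 0]]).
Proof.
move=> nJ nF; apply: uncountable_cases nF _ => l _; apply: contrapT => nz; apply: (nJ l) => z Jz.
apply/kP; apply: contrapT => z0; apply: nz; have [j Vz] := Vall z.
by exists j, z.
Qed.
End Points.

(** A vector s with rho(c0) s = 0 makes the d coordinates of rho(x) s vanish on A c0. An element z
    of J, nonzero at the point in question, transfers relations on J to all short words. *)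
Lemma gadget_singular c0 J I : nzideal J -> nzideal I ->
  ~ countable [set P | [/\ prim P, I `<=` P, ~ J `<=` P & \det (projT2 (R P) c0) = 0]] ->
  gadget v iota (fun phi => forall u, phi (u * c0) = 0) 1 J.
Proof.
move=> nzJ nzI' nF.
have [|d [Lam [Pl [rho [FP rP kP SP [sep nL]]]]]] :=
    select (S := fun X => \det (projT2 X c0) = 0) _ nF.
  by move=> P [pP _ _ dP].
have nJ l : ~ J `<=` Pl l by case: (FP l).
have IP l x : I x -> rho l x = 0 by case: (FP l) => _ IP _ _ Ix; apply/kP/IP.
have [j nG] := uniform_nonzero kP nJ nL.
exists (I `&` J), (d + (j + d))%N; split=> [||n]; [exact: nzI|by move=> x []|].
have d0 : (0 < d)%N.
  by have [f _] := uncountable_inj 1 nG; exact: rep_pos (rP (f ord0)).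
(* Then n < N d <= n + d. *)
pose N := (n %/ d).+1; have [l [linj lG]] := uncountable_inj N nG.
have /choice[s sP] : forall i, exists s : 'cV[K]_d, s <> 0 /\ rho (l i) c0 *m s = 0.
  by move=> i; have [s ? ?] := singular_col (SP (l i)); exists s.
have leN : (N * d <= n + d)%N by rewrite mulSn addnC leq_add2r leq_trunc_div.
exists ('I_N * 'I_d)%type, (fun p x => (rho (l p.1) x *m s p.1) p.2 0); split.
- by rewrite muln1 card_prod !card_ord ltnW // ltn_ceil.
- move=> [i a] /=; have H := rP (l i); split; first split.
  + by move=> x y; rewrite (repD H) mulmxDl mxE.
  + by move=> c x; rewrite (repZ H) -scalemxAl mxE.
  by move=> u; rewrite (repM H) -mulmxA (sP i).2 mulmx0 mxE.
- by move=> [i a] x [Ix _] /=; rewrite IP // mul0mx mxE.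
move=> r r0 [i0 a0].
pose xi i : 'rV[K]_d := \row_a r (i, a).
have sumE x : \sum_t r t * (rho (l t.1) x *m s t.1) t.2 0 = \sum_i (xi i *m rho (l i) x *m s i) 0 0.
  rewrite (eq_bigr (fun t => r (t.1, t.2) * (rho (l t.1) x *m s t.1) t.2 0)) => [|[]//].
  rewrite -(pair_bigA _ (fun i a => r (i, a) * (rho (l i) x *m s i) a 0)) /=.
  apply: eq_bigr => i _; rewrite -mulmxA [RHS]mxE; apply: eq_bigr => a _.
  by rewrite [xi _ _ _]mxE.
suff xi0 : xi i0 = 0 by have := congr1 (fun X : 'rV_ _ => X 0 a0) xi0; rewrite !mxE.
have [_ [z [Jz Vz z0]]] := lG i0; apply: contrapT => xi0.
have [[_ _ JM] Jr] := nzJ.1.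
have [y Vy|//|s0] := irr_bounded (X := rho (l i0) z) (W := s i0) (rP (l i0)); last first.
  by case: (sP i0).
have [|//|] := family_fill Vall rP sep (xi := xi) (w := fun i => rho (l i) (z * y) *m s i) linj _ i0.
  move=> x; rewrite card_ord => Vx.
  apply/matrixP => p q; rewrite !ord1 [RHS]mxE summxE -[RHS](r0 (x * (z * y))).
  - rewrite sumE; apply: eq_bigr => i _.
    by rewrite (repM (rP (l i)) x) !mulmxA.
  - have -> : (n + (d + (j + d)) = (n + d) + (j + d))%N by lia.
    by apply: VnM (Vn_mono leN Vx) (VnM Vz Vy).
  - by apply: JM; apply: Jr.
by rewrite (repM (rP (l i0))).
Qed.

Lemma rank_sum_le (T : finType) m n r (X : T -> 'M[K]_(m, n)) : (forall t, \rank (X t) <= r)%N ->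
  (\rank (\sum_t X t)%R <= #|T| * r)%N.
Proof.
move=> Xr; apply: leq_trans (_ : \sum_(t : T) r <= _)%N; last by rewrite sum_nat_const.
elim/big_ind2: _ => [|x a y b xa yb|t _]; [by rewrite mxrank0| |exact: Xr].
exact: leq_trans (mxrank_add _ _) (leq_add xa yb).
Qed.

Section Nonsingular.
Variables (b y0 : A) (T0 : finType) (a a' : T0 -> A).
Let c0 := \sum_t a t * b * a' t.

(* Writing rho b = B C with full ranks, take X = B N C for N in the commutant of
   C (rho y0) B. *)
Lemma commuting_traces d (rho : A -> 'M[K]_d) r : rep iota rho -> \rank (rho b) = r ->
  exists (X : 'I_r -> 'M[K]_d),
  [/\ forall h x, \tr (X h *m rho (x * b * y0 - y0 * b * x)) = 0,
      forall h x, b * x * b = 0 -> \tr (X h *m rho x) = 0 &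
      forall f : 'I_r -> K, \sum_h f h *: X h = 0 -> forall h, f h = 0].
Proof.
move=> H rb; have [B [Cm [B' [C' [bE BB CC]]]]] := full_rank_factorization rb.
have [N [NC Nfree]] := commutant Kc (Cm *m rho y0 *m B).
exists (fun h => B *m N h *m Cm); split=> [h x|h x bxb|f f0].
- rewrite -scaleN1r (repD H) (repZ H) rmorphN1 scaleN1r !(repM H) bE mulmxBr linearB /=.
  apply/eqP; rewrite subr_eq0; apply/eqP.
  rewrite -!mulmxA mxtrace_mulC -!mulmxA [RHS]mxtrace_mulC -!mulmxA.
  rewrite [in RHS]mxtrace_mulC -!mulmxA.
  have := NC h; set G := Cm *m rho y0 *m B => NG; pose Y := Cm *m rho x *m B.
  transitivity (\tr (N h *m Y *m G)); first by rewrite /Y /G !mulmxA.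
  by rewrite [LHS]mxtrace_mulC (mulmxA G) -[G *m _]NG -(mulmxA (N h)) [LHS]mxtrace_mulC /Y /G !mulmxA.
- have e : rho (b * x * b) = 0 by rewrite bxb; apply: rep0 H.
  have {}e : Cm *m rho x *m B = 0.
    move: e; rewrite !(repM H) bE => e.
    have : B' *m (B *m Cm *m rho x *m (B *m Cm)) *m C' = 0 by rewrite e mulmx0 mul0mx.
    by rewrite !mulmxA BB mul1mx -!mulmxA CC mulmx1 !mulmxA.
  by rewrite -!mulmxA mxtrace_mulC -!mulmxA [Cm *m _]mulmxA e mulmx0 linear0.
- apply: Nfree; have : B' *m (\sum_h f h *: (B *m N h *m Cm)) *m C' = 0 by rewrite f0 mulmx0 mul0mx.
  rewrite mulmx_sumr mulmx_suml => e; apply: etrans e; apply: eq_bigr => h _.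
  by rewrite -scalemxAr -scalemxAl !mulmxA BB mul1mx -!mulmxA CC mulmx1.
Qed.

(** Since c0 is nonsingular and a sum of |T0| products through b, the rank of b is at least d /
    |T0|. A common tau = p q of rank one turns tr (M rho(x) tau rho(w)) into q rho(w) M rho(x) p, to
    which [family_fill] applies. *)
Lemma gadget_nonsingular J I : nzideal J -> nzideal I ->
  ~ countable [set P | [/\ prim P, I `<=` P, ~ J `<=` P & \det (projT2 (R P) c0) <> 0]] ->
  gadget v iota (fun phi => (forall x, phi (x * b * y0 - y0 * b * x) = 0) /\
                            forall x, b * x * b = 0 -> phi x = 0) #|T0| J.
Proof.
move=> nzJ nzI' nF.
have [|d [Lam [Pl [rho [FP rP kP SP [sep nL]]]]]] :=
    select (S := fun X => \det (projT2 X c0) <> 0) _ nF.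
  by move=> P [pP _ _ dP].
have nJ l : ~ J `<=` Pl l by case: (FP l).
have IP l x : I x -> rho l x = 0 by case: (FP l) => _ IP _ _ Ix; apply/kP/IP.
have [D lgI] := nz_linear nzI'.
have Ifin n : exists (T : finType) (u : T -> A),
    [/\ (#|T| <= D * n.+1)%N, forall t, Vn v n (u t) & forall x, Vn v n x -> kdep I u x].
  have [T [u [Vu fu du]]] := finite_basis growth n nzI'.1.1.
  by exists T, u; split=> //; apply: lgI fu.
have [F' [n0 [tau [_ nF' [T1 [kap [a1 [Va1 tauE]]]] tau1]]]] :=
  rank_one_element Kc Kunc Vall rP sep IP Ifin nL.
have [j nG] := uniform_nonzero kP nJ nF'.
have [r nG'] := uncountable_cases (G := fun r => [set l | \rank (rho l b) = r]) nG
  (fun l _ => ex_intro _ _ erefl).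
exists (I `&` J), (d + (n0 + (d + (j + d))))%N; split=> [||n]; [exact: nzI|by move=> x []|].
have [d0 dr] : (0 < d)%N /\ (d <= #|T0| * r)%N.
  have [f [_ /(_ ord0)[[_ _] rb]]] := uncountable_inj 1 nG'.
  have H := rP (f ord0); split; first exact: rep_pos H.
  have -> : d = \rank (rho (f ord0) c0).
    by apply/esym/mxrank_unit; rewrite unitmxE unitfE; apply/eqP/SP.
  rewrite /c0 (rep_sum _ H); apply: rank_sum_le => t; rewrite !(repM H) -[in leqRHS]rb.
  exact: leq_trans (mxrankM_maxl _ _) (mxrankM_maxr _ _).
pose N := (n %/ d).+1; have [l [linj lG]] := uncountable_inj N nG'.
have leN : (N * d <= n + d)%N by rewrite mulSn addnC leq_add2r leq_trunc_div.
have /choice[X XP] : forall i, exists X : 'I_r -> 'M[K]_d,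
  [/\ forall h x, \tr (X h *m rho (l i) (x * b * y0 - y0 * b * x)) = 0,
      forall h x, b * x * b = 0 -> \tr (X h *m rho (l i) x) = 0 &
      forall f : 'I_r -> K, \sum_h f h *: X h = 0 -> forall h, f h = 0].
  by move=> i; apply: commuting_traces => //; case: (lG i).
exists ('I_N * 'I_r)%type, (fun p x => \tr (X p.1 p.2 *m rho (l p.1) x)); split.
- rewrite card_prod !card_ord -mulnA [(r * _)%N]mulnC.
  by apply: leq_trans (leq_mul (leqnn _) dr); rewrite ltnW // ltn_ceil.
- move=> [i h] /=; have H := rP (l i); have [X1 X2 _] := XP i; split; split.
  + by move=> x y; rewrite (repD H) mulmxDr linearD.
  + by move=> c x; rewrite (repZ H) -scalemxAr linearZ.
  + exact: X1.
  + exact: X2.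
- by move=> [i h] x [Ix _] /=; rewrite IP // mulmx0 linear0.
move=> f f0 [i0 h0].
pose M i : 'M[K]_d := \sum_h f (i, h) *: X i h.
have sumE x : \sum_t f t * \tr (X t.1 t.2 *m rho (l t.1) x) = \sum_i \tr (M i *m rho (l i) x).
  rewrite (eq_bigr (fun t => f (t.1, t.2) * \tr (X t.1 t.2 *m rho (l t.1) x))) => [|[]//].
  rewrite -(pair_bigA _ (fun i h => f (i, h) * \tr (X i h *m rho (l i) x))) /=.
  apply: eq_bigr => i _; rewrite mulmx_suml linear_sum; apply: eq_bigr => h _.
  by rewrite -scalemxAl linearZ.
suff M0 : M i0 = 0.
  by have [_ _ Xf] := XP i0; exact: (Xf (fun h => f (i0, h)) M0).
have /choice[p /choice[q pq]] : forall i, exists (p : 'cV[K]_d) (q : 'rV[K]_d),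
    [/\ tau (l i) = p *m q, p <> 0 & q <> 0].
  move=> i; have [[Fl _] _] := lG i; have := tau1 _ Fl => rt.
  have [p [q [p' [q' [pq pp qq]]]]] := full_rank_factorization rt.
  have one : (1%:M : 'M[K]_1) <> 0 by apply/eqP; apply: oner_neq0.
  exists p, q; split=> // e.
    by apply: one; rewrite -pp e mulmx0.
  by apply: one; rewrite -qq e mul0mx.
have [[_ [z [Jz Vz z0]]] _] := lG i0.
have [[_ _ JM] Jr] := nzJ.1.
have key w : J w -> Vn v (d + (j + d)) w -> q i0 *m rho (l i0) w *m M i0 = 0.
  move=> Jw Vw.
  have [|//|] := family_fill Vall rP sep (xi := fun i => q i *m rho (l i) w *m M i) (w := p) linj _ i0;
    last by case: (pq i0).
  move=> x; rewrite card_ord => Vx.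
  have st t : \sum_i \tr (M i *m rho (l i) (x * a1 t * w)) = 0.
    rewrite -sumE; apply: f0; last exact: JM.
    have -> : (n + (d + (n0 + (d + (j + d)))) = (n + d) + n0 + (d + (j + d)))%N by lia.
    by apply: VnM Vw; apply: VnM (Va1 t); apply: Vn_mono Vx.
  apply/matrixP => e e'; rewrite !ord1 -trace_mx11 linear_sum /= [RHS]mxE.
  have : \sum_t kap t * (\sum_i \tr (M i *m rho (l i) (x * a1 t * w))) = 0.
    by rewrite big1 // => t _; rewrite st mulr0.
  move=> h; apply: etrans h.
  under [RHS]eq_bigr => t _ do rewrite mulr_sumr.
  rewrite [RHS]exchange_big; apply: eq_bigr => i _ /=; have H := rP (l i).
  transitivity (\tr (M i *m rho (l i) x *m tau (l i) *m rho (l i) w)).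
    have [-> _ _] := pq i; rewrite -!mulmxA [RHS]mxtrace_mulC -!mulmxA.
    by rewrite [RHS]mxtrace_mulC -!mulmxA [RHS]mxtrace_mulC -!mulmxA.
  rewrite tauE mulmx_sumr mulmx_suml linear_sum; apply: eq_bigr => t _.
  by rewrite -scalemxAr -scalemxAl linearZ /= !(repM H) !mulmxA.
have H := rP (l i0); apply: contrapT => M0.
have [_ _ q0] := pq i0.
(* Irreducibility strips q and then rho(z) from the product, which leaves M = 0. *)
have zy y' : Vn v d y' -> rho (l i0) z *m rho (l i0) y' *m M i0 = 0.
  move=> Vy'; have [y Vy|//|//] := irr_bounded (X := q i0) (W := rho (l i0) z *m rho (l i0) y' *m M i0) H.
  have := key (y * (z * y')); rewrite !(repM H) !mulmxA; apply.
  - by apply: JM; apply: Jr.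
  - exact: VnM Vy (VnM Vz Vy').
by case: (irr_bounded H zy).
Qed.
End Nonsingular.

Lemma rep_stdp d (rho : A -> 'M[K]_d) m (x : 'I_m -> A) : rep iota rho -> (d * d < m)%N ->
  rho (stdp x) = 0.
Proof.
case: d rho => [|d] rho H dm; first by have := rep_pos H.
have rhoB : zmod_morphism rho.
  by move=> y z; rewrite -scaleN1r (repD H) (repZ H) rmorphN1 scaleN1r.
have rhoM : monoid_morphism rho by split; [exact: rep1 H|exact: repM H].
pose f : {rmorphism A -> 'M[K]_d.+1} := HB.pack rho (GRing.isZmodMorphism.Build _ _ _ rhoB)
  (GRing.isMonoidMorphism.Build _ _ _ rhoM).
rewrite -[rho]/(f : _ -> _) stdp_morph.
have -> : f \o x = fun i => \sum_t f (x i) t.1 t.2 *: delta_mx t.1 t.2.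
  apply/funext => i /=; rewrite [LHS]matrix_sum_delta pair_bigA.
  by [].
by apply: stdp_span; rewrite card_prod !card_ord.
Qed.

(** The ideal contains all values of the standard polynomial of degree d^2 + 1, and these are not
    all zero as A is not PI. *)
Lemma ideal_of_degree_nz d :
  nzideal [set x | forall P, prim P -> (projT1 (R P) <= d)%N -> P x].
Proof.
split; first split; first split.
- by move=> P /prim_nz[[[]]].
- by move=> x y Px Py P pP dP; have [[[_ PB _] _] _] := prim_nz pP; apply: PB; [apply: Px|apply: Py].
- by move=> a x Px P pP dP; have [[[_ _ PM] _] _] := prim_nz pP; exact: (PM a x (Px P pP dP)).
- by move=> a x Px P pP dP; have [[_ Pr] _] := prim_nz pP; exact: (Pr a x (Px P pP dP)).
apply: contrapT => nx; apply: notPI; apply: (@stdp_satisfies_pi _ _ (d * d).+1) => x.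
apply: contrapT => x0; apply: nx; exists (stdp x) => // P pP dP.
have [H kP] := RP pP; apply/kP; apply: rep_stdp H _.
by rewrite ltnS leq_mul.
Qed.

Lemma finite_roots (p : {poly K}) : p != 0 -> finite_set [set l | root p (iota l)].
Proof.
move=> p0; apply: contrapT => /(infinite_inj (size p))[f [finj fr]].
have := @max_poly_roots _ p [seq iota (f i) | i : 'I_(size p)] p0.
rewrite size_map -cardE card_ord ltnn => H; apply/notF/H.
  by apply/allP => _ /mapP[i _ ->]; apply: fr.
by rewrite map_inj_uniq ?enum_uniq // => i j /fmorph_inj/finj.
Qed.

Lemma rep_shift d (rho : A -> 'M[K]_d) c l : rep iota rho -> 
  rho (c - l%:A) = rho c - (iota l)%:M.
Proof.
move=> H; rewrite -scaleN1r (repD H) !(repZ H) (rep1 H) rmorphN1 scaleN1r.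
by rewrite scale_scalar_mx mulr1.
Qed.

Lemma countable_eigenvalues (F : set (set A)) c : countable F -> (forall P, F P -> prim P) ->
  countable [set l | exists2 P, F P & \det (projT2 (R P) (c - l%:A)) = 0].
Proof.
move=> cF pF.
apply: (@sub_countable _ _ _
  (\bigcup_(P in F) [set l | \det (projT2 (R P) (c - l%:A)) = 0])).
  by apply: subset_card_le => l [P FP e]; exists P.
apply: bigcup_countable => // P /pF/RP[]; case: (R P) => d rho /= H _.
apply: finite_set_countable; apply: sub_finite_set (finite_roots (monic_neq0 (char_poly_monic (rho c)))).
move=> l /= e; have : \det (rho (c - l%:A)) == 0 by apply/eqP.
move=> /det0P[w w0]; rewrite rep_shift // mulmxBr => /eqP; rewrite subr_eq0 mul_mx_scalar => /eqP we.
by rewrite -eigenvalue_root_char; apply/eigenvalueP; exists w.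
Qed.

(** An equation for c with nonzero constant term would put 1 into P; one with zero constant term can
    be divided by c. *)
Lemma regular_transcendental P c : prim P -> P c -> (forall x, x * c = 0 -> x = 0) ->
  forall q, q != 0 -> horner_alg c q <> 0.
Proof.
move=> pP Pc creg; have [[Pl Pr] _] := prim_nz pP; have [_ _ PM] := Pl.
elim/poly_ind => [|q l IH]; first by rewrite eqxx.
rewrite rmorphD rmorphM /= horner_algX horner_algC.
case: (eqVneq l 0) => [->|l0 _ e].
  rewrite polyC0 addr0 scale0r addr0 mulf_eq0 negb_or => /andP[q0 _] /creg.
  exact: IH.
apply: (prim1 pP).
have : P (l%:A) by rewrite -[l%:A](addKr (horner_alg c q * c)) e addr0; apply: lidealN => //; apply: PM.
by move/(lidealZ l^-1 Pl); rewrite scalerA mulVf // scale1r.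
Qed.

(** An injective map of the finite-dimensional space A / P is surjective. *)
Lemma regular_left_inverse P n c : prim P -> codim P n -> (forall x, P (x * c) -> P x) ->
  exists y, P (y * c - 1).
Proof.
move=> pP [u [fu du]] creg; have [[Pl Pr] _] := prim_nz pP; have HP := lideal_kact Pl.
pose y i := u i * c.
have fy : kfree P y.
  move=> r Pr0; apply: fu; apply: creg; rewrite mulr_suml.
  by under eq_bigr => i _ do rewrite -scalerAl.
have : kdep P y 1.
  apply/kdep_lideal => //; apply: contrapT => nd.
  have fo := rfree_option HP (fun _ => Logic.I) Logic.I fy nd.
  have := @steinitz _ _ _ _ _ HP _ _ _ u (fun _ => Logic.I) (fun _ => Logic.I) fo
    (fun t => (kdep_lideal u _ Pl).2 (du _)).
  by rewrite card_option card_ord ltnn.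
move=> [r Pr0]; exists (\sum_i r i *: u i).
have := lidealN Pl Pr0; rewrite opprB mulr_suml.
by under eq_bigr => i _ do rewrite scalerAl.
Qed.

(* Were all these sets countable, the [P] without [c] would be too, since each
   contains some [ideal_of_degree_nz]; then [l] can avoid their eigenvalues at [c]. *)
Lemma uncountable_family J : nzideal J ->
  exists2 I, nzideal I & ~ countable [set P | [/\ prim P, I `<=` P & ~ J `<=` P]].
Proof.
move=> nzJ; apply: contrapT => nI.
have cI I : nzideal I -> countable [set P | [/\ prim P, I `<=` P & ~ J `<=` P]].
  by move=> nzI'; apply: contrapT => nc; apply: nI; exists I.
have [L1 [L1m _]] := ex_lmax (I := [set 0 : A]) (ideal2_set0 A).1 (fun e => elimN eqP (oner_neq0 A) e).
have pP1 : prim (core L1) by exists L1.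
have [J1i [x J1x x0]] := nzI nzJ (prim_nz pP1).
have [c [[Jc P1c] creg]] := left_regular_mem prA goA J1i J1x x0.
have cam := amitsur Vall growth (ideal2_set0 A) (regular_transcendental pP1 P1c creg).
pose bad := [set P | prim P /\ ~ P c].
have cbad : countable bad.
  apply: (@sub_countable _ _ _ (\bigcup_(d in [set: nat]) [set P | [/\ prim P,
     [set x | forall Q, prim Q -> (projT1 (R Q) <= d)%N -> Q x] `<=` P & ~ J `<=` P]])).
    apply: subset_card_le => P [pP Pc]; exists (projT1 (R P)) => //; split=> //.
      by move=> y; apply.
    by move=> JP; apply/Pc/JP.
  by apply: bigcup_countable => // d _; apply/cI/ideal_of_degree_nz.
have ceig := countable_eigenvalues c cbad (fun P => @proj1 _ _).
have [l [l0 lam leig]] : exists l, [/\ l != 0, ~ (exists y, y * (c - l%:A) - 1 = 0) &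
    forall P, bad P -> \det (projT2 (R P) (c - l%:A)) <> 0].
  apply: contrapT => nl; apply: kunc.
  apply: sub_countable (countableU (countableU cam ceig) (countable1 0)).
  apply: subset_card_le => l _; apply: contrapT => nlU; apply: nl; exists l; split.
  - by apply/eqP => l0; apply: nlU; right.
  - by move=> [y e]; apply: nlU; left; left; exists y.
  - by move=> P bP e; apply: nlU; left; right; exists P.
have [||L [Lm AL]] := @ex_lmax k A [set x | exists y, x = y * (c - l%:A)].
- split.
  + by exists 0; rewrite mul0r.
  + by move=> _ _ [y ->] [z ->]; exists (y - z); rewrite mulrBl.
  + by move=> a _ [y ->]; exists (a * y); rewrite mulrA.
- by move=> [y e]; apply: lam; exists y; rewrite -e subrr.
have pP : prim (core L) by exists L.
have [Ll L1' _] := Lm.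
(* c acts on the generator of A / L as the nonzero scalar l. *)
have Pc : ~ core L c.
  move=> /core_sub Lc; have : L (l%:A).
    have -> : l%:A = c - 1 * (c - l%:A) by rewrite mul1r subKr.
    by case: (Ll) => _ LB _; apply: LB => //; apply: AL; exists 1.
  by move/(lidealZ l^-1 Ll); rewrite scalerA mulVf // scale1r.
have [H kP] := RP pP; have := leig _ (conj pP Pc); move: H kP.
case: (R (core L)) => d rho /= H kP /eqP det0.
have [n cod] := ex_codim pP.
have [|y Py] := regular_left_inverse (c := c - l%:A) pP cod.
  move=> y /kP; rewrite (repM H) => e; apply/kP.
  have U : rho (c - l%:A) \in unitmx by rewrite unitmxE unitfE.
  by rewrite -[rho y](mulmxK U) e mul0mx.
apply: L1'; case: (Ll) => _ LB _.
have -> : 1 = y * (c - l%:A) - (y * (c - l%:A) - 1) by rewrite subKr.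
by apply: LB; [apply: AL; exists y|apply: core_sub].
Qed.

Lemma nzT : nzideal [set: A].
Proof. by split; [split|exists 1 => //; apply/eqP/oner_neq0]. Qed.

Definition many (Q : set A -> Prop) J := exists2 I, nzideal I &
  ~ countable [set P | [/\ prim P, I `<=` P, ~ J `<=` P & Q P]].

Lemma many_dichotomy (Q : set A -> Prop) J : nzideal J -> many Q J \/ many (fun P => ~ Q P) J.
Proof.
move=> /uncountable_family[I nzI' nc]; apply: contrapT => /not_orP[n1 n2]; apply: nc.
have c1 : countable [set P | [/\ prim P, I `<=` P, ~ J `<=` P & Q P]].
  by apply: contrapT => nc; apply: n1; exists I.
have c2 : countable [set P | [/\ prim P, I `<=` P, ~ J `<=` P & ~ Q P]].
  by apply: contrapT => nc; apply: n2; exists I.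
apply: sub_countable (countableU c1 c2); apply: subset_card_le => P [pP IP JP].
by case: (pselect (Q P)) => QP; [left|right].
Qed.

Lemma many_sub (Q : set A -> Prop) J J' : J `<=` J' -> many Q J -> many Q J'.
Proof.
move=> JJ' [I nzI' nc]; exists I => //; apply: contra_not nc; apply: sub_countable.
by apply: subset_card_le => P [pP IP JP QP]; split=> // J'P; apply: JP => x /JJ'/J'P.
Qed.

Lemma functionals_contradiction (good : (A -> K) -> Prop) r (theta pi : A -> A) s s' E :
  (forall J, nzideal J -> gadget v iota good r J) ->
  linear theta -> linear pi -> (0 < s)%N ->
  (forall n x, Vn v n x -> Vn v (n + s) (theta x)) ->
  (forall n x, Vn v n x -> Vn v (n + s') (pi x)) ->
  (forall phi, good phi -> (forall x, phi (theta x) = 0) /\ forall x, pi x = 0 -> phi x = 0) ->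
  (forall n (T : finType) (x : T -> A), (forall t, Vn v n (x t)) ->
    (forall t, pi (theta (x t)) = 0) -> kfree [set 0] (fun t => pi (x t)) -> (#|T| <= E * n.+1)%N) ->
  False.
Proof.
move=> gad /ex_linear[th thE] /ex_linear[p pE] s0 Vth Vp gP ker.
have thE' : (th : A -> A) = theta by apply/funext => x; rewrite thE.
have pE' : (p : A -> A) = pi by apply/funext => x; rewrite pE.
apply: (@growth_contradiction _ _ _ v C K iota growth good r th p s E s0).
- by rewrite thE'.
- by rewrite thE' pE' => phi _; apply: gP.
- by exists s'; rewrite pE'.
- by rewrite thE' pE'.
- move=> m; have [J [c [_ Jc]]] := stack_gadgets nzT gad m.
  by exists c => n; have [T [phi [cT phg _ ind]]] := Jc n; exists T, phi.
Qed.

Lemma main_contradiction_rep : False.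
Proof.
have [b [b0 bP]] := max_annihilator_mul goA.
have Bb : ideal_gen b b by rewrite -[X in _ X](mulr1 b) -[X in X * 1]mul1r; apply: ideal_gen_mem.
have [_ [[T0 [a [a' ->]]] creg]] := left_regular_mem prA goA (ideal2_gen b) Bb b0.
set c0 := \sum_t _ in creg.
pose Q P := \det (projT2 (R P) c0) = 0.
case: (pselect (forall J, nzideal J -> many Q J)) => [mQ|].
  have [s Vs] := Vall c0.
  have gad J : nzideal J -> gadget v iota (fun phi => forall u, phi (u * c0) = 0) 1 J.
    by move=> nzJ; have [I nzI' nc] := mQ J nzJ; apply: gadget_singular nzJ nzI' nc.
  (* Right multiplication by c0 is injective, so the kernel bound holds with E = 0. *)
  apply: (functionals_contradiction (theta := fun u => u * c0) (pi := id) (s := s.+1) (s' := 0) (E := 0) gad) => //.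
  - by move=> l x y; rewrite mulrDl -scalerAl.
  - by move=> n x Vx; apply: Vn_mono (VnM Vx Vs); rewrite addnS.
  - by move=> n x Vx; rewrite addn0.
  - move=> phi gphi; split=> // x ->; by rewrite -(mul0r c0).
  - move=> n T x _ x0 fx; rewrite mul0n leqn0; apply/eqP; apply: eq_card0 => t.
    have := fx (fun=> 1); rewrite /= big1 => [/(_ erefl t)/eqP|t' _]; first by rewrite oner_eq0.
    by rewrite (creg _ (x0 t')) scaler0.
move=> /existsNP[J1 /not_implyP[nzJ1 nQ]].
(* J1 lacks large singular families, hence so does its intersection with any J, and the nonsingular
   alternative must hold there. *)
have mN J : nzideal J -> many (fun P => ~ Q P) J.
  move=> nzJ; case: (many_dichotomy Q (nzI nzJ nzJ1)) => [mQ|].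
    by case: nQ; apply: many_sub mQ => x [].
  by apply: many_sub => x [].
have [P0 [pP0 QP0]] : exists P, prim P /\ ~ Q P.
  have [I _ nc] := mN _ nzT; apply: contrapT => nP; apply: nc.
  by apply: sub_countable (countable0 (set A)); apply: subset_card_le => P [pP _ _ QP]; case: nP; exists P.
have P0b : ~ P0 b.
  have [H kP] := RP pP0; move=> /kP b0'; apply: QP0; rewrite /Q /c0 (rep_sum _ H) big1.
    by case: (projT1 _) (rep_pos H) => // n _; rewrite det0.
  by move=> t _; rewrite !(repM H) b0' mulmx0 mul0mx.
have [[P0l P0r] [p P0p p0]] := prim_nz pP0.
(* Primeness allows a nonzero p of P0 to be placed between factors b, so y0 = x p y lies in P0 and b
   y0 b is nonzero. *)
have [x bxp] : exists x, b * x * p <> 0.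
  by apply: contrapT => /forallNP nx; case: (prime_ring_mul prA (fun x => contrapT (nx x))).
have [y bxpy] : exists y, b * x * p * y * b <> 0.
  by apply: contrapT => /forallNP nx; case: (prime_ring_mul prA (fun x => contrapT (nx x))).
pose y0 := x * p * y.
have by0 : b * y0 * b <> 0 by rewrite /y0 !mulrA.
have P0y0 : P0 y0 by apply: P0r; case: P0l => _ _; apply.
have [E EP] := centralizer_growth Vall growth prA notPI bP by0 (conj P0l P0r) P0y0 P0b.
have [s1 V1] := Vall b; have [s2 V2] := Vall y0.
have gad J : nzideal J -> gadget v iota (fun phi => (forall x, phi (x * b * y0 - y0 * b * x) = 0) /\
    forall x, b * x * b = 0 -> phi x = 0) #|T0| J.
  by move=> nzJ; have [I nzI' nc] := mN J nzJ; apply: gadget_nonsingular nzJ nzI' nc.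
(* Here pi (theta x) = 0 reads b x b y0 b = b y0 b x b, the situation of [centralizer_growth]. *)
apply: (functionals_contradiction (theta := fun x => x * b * y0 - y0 * b * x)
  (pi := fun u => b * u * b) (s := (s1 + s2).+1) (s' := (s1 + s1)%N) (E := E) gad) => //.
- move=> l u w; rewrite !mulrDl !mulrDr -!scalerAl -scalerAr scalerBr.
  by rewrite opprD addrACA.
- by move=> l u w; rewrite !(mulrDr, mulrDl) -scalerAr -scalerAl.
- move=> n u Vu; apply: VnB.
    by apply: Vn_mono (VnM (VnM Vu V1) V2); lia.
  by apply: Vn_mono (VnM (VnM V2 V1) Vu); lia.
- by move=> n u Vu; apply: Vn_mono (VnM (VnM V1 Vu) V1); lia.
- move=> n T u Vu e fu; apply: (EP n T u) => // t.
  by apply/eqP; rewrite -subr_eq0; apply/eqP; have := e t; rewrite mulrBr mulrBl !mulrA.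
Qed.
End Main.

Lemma main_contradiction (k : fieldType) (A : algType k) (g : nat) (v : 'I_g -> A) (C : nat)
    (K : fieldType) (iota : {rmorphism k -> K}) :
  (forall p : {poly K}, (1 < size p)%N -> exists x, root p x) -> ~ countable [set: k] ->
  (forall x, exists n, Vn v n x) ->
  (forall n (T : finType) (x : T -> A), (forall t, Vn v n (x t)) -> kfree [set 0] x ->
    (#|T| <= C * n.+1 ^ 2)%N) ->
  prime_ring A -> left_goldie A -> ~ satisfies_pi A -> ~ primitive_ring A -> False.
Proof.
move=> Kc kunc Vall growth prA goA notPI notPrim.
have Kunc : ~ countable [set: K].
  move=> cK; apply: kunc; apply: sub_countable cK.
  by have := @card_ge_preimage _ _ setT iota; rewrite preimage_setT; apply => x y _ _ /fmorph_inj.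
have /choice[R RP] : forall P : set A, exists R : {d & A -> 'M[K]_d}, prim P ->
    rep iota (projT2 R) /\ forall a, projT2 R a = 0 <-> P a.
  move=> P; case: (pselect (prim P)) => pP.
    by have [R RP] := ex_rep_prim iota kunc Vall growth prA goA notPrim pP; exists R.
  by exists (existT _ 0%N (fun=> 0)).
exact: (main_contradiction_rep Kc Kunc kunc Vall growth prA goA notPI notPrim RP).
Qed.

(** * Algebraically closed extensions *)

Section CountableSubfield.
Variables (k : fieldType) (s : seq k).

(** Trees name the elements of the subfield generated by s, which is therefore countable; nodes of
    other shapes denote 1. *)
Fixpoint expr_eval (e : GenTree.tree nat) : k :=
  match e with
  | GenTree.Leaf i => s`_i
  | GenTree.Node 0 [:: e1; e2] => expr_eval e1 - expr_eval e2
  | GenTree.Node 1 [:: e1; e2] => expr_eval e1 / expr_eval e2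
  | _ => 1
  end.

Definition rational_in : {pred k} := [pred x | `[< exists e, expr_eval e = x >]].

Lemma rational_in_divring : GRing.divring_closed rational_in.
Proof.
split=> [|x y|x y]; rewrite !inE.
- by exists (GenTree.Node 2 [::]).
- by move=> [e <-] [f <-]; exists (GenTree.Node 0 [:: e; f]).
- by move=> [e <-] [f <-]; exists (GenTree.Node 1 [:: e; f]).
Qed.

HB.instance Definition _ := GRing.isDivringClosed.Build k rational_in rational_in_divring.

Record csubfield := CSubfield { csubfield_val : k; _ : csubfield_val \in rational_in }.

HB.instance Definition _ := [isSub for csubfield_val].
HB.instance Definition _ := [Choice of csubfield by <:].
HB.instance Definition _ := [SubChoice_isSubIntegralDomain of csubfield by <:].
HB.instance Definition _ := [SubIntegralDomain_isSubField of csubfield by <:].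

Lemma csubfield_ex (x : csubfield) : exists e, expr_eval e == val x.
Proof. by case: x => x /= /asboolP[e <-]; exists e. Qed.

Let csub_code (x : csubfield) := xchoose (csubfield_ex x).
Let csub_decode e : option csubfield := insub (expr_eval e).

Lemma csub_codeK : pcancel csub_code csub_decode.
Proof. by move=> x; rewrite /csub_decode /csub_code (eqP (xchooseP (csubfield_ex x))) valK. Qed.

HB.instance Definition _ := PCanIsCountable csub_codeK.

Definition csubfield_countField : countFieldType := csubfield.
End CountableSubfield.

(* [k] embeds in the ultraproduct of the algebraic closures of its finitely
   generated subfields; these are countable, so that their closures are available. *)
Section Ultraproduct.
Variables (I : Type) (F : I -> closedFieldType) (U : set_system I).
Hypothesis UU : UltraFilter U.

Definition dfamily := forall i, F i.
HB.instance Definition _ := gen_eqMixin dfamily.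
HB.instance Definition _ := gen_choiceMixin dfamily.

Definition ultra_eq : rel dfamily := fun x y => `[< U [set i | x i = y i] >].

Let UF : Filter U := @filter_filter _ _ (ultra_proper).

Lemma ultra_eq_equiv : equiv_class_of ultra_eq.
Proof.
split=> [x|x y|y x z].
- by apply/asboolP; apply: filterS filterT.
- by apply/idP/idP => /asboolP h; apply/asboolP; apply: filterS h.
- move=> /asboolP h /asboolP h'; apply/asboolP.
  by apply: filterS (filterI h h') => i [] /= ->.
Qed.

Canonical ultra_eq_equivRel := EquivRelPack ultra_eq_equiv.

Definition ultraproduct := {eq_quot ultra_eq}%qT.
HB.instance Definition _ := Choice.on ultraproduct.

Definition upi (x : dfamily) : ultraproduct := (\pi_ultraproduct x)%qT.

Lemma upiP x y : upi x = upi y <-> U [set i | x i = y i].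
Proof.
by split=> [/eqmodP/asboolP|h]; last by apply/eqmodP/asboolP.
Qed.

Lemma upi_surj (a : ultraproduct) : exists x, a = upi x.
Proof. by exists (repr a); rewrite /upi reprK. Qed.

Let rp (a : ultraproduct) : dfamily := repr a.

Let upi_rp x : U [set i | rp (upi x) i = x i].
Proof. by apply/upiP; rewrite /upi /rp reprK. Qed.

Definition uzero : ultraproduct := upi (fun=> 0).
Definition uone : ultraproduct := upi (fun=> 1).
Definition uopp a : ultraproduct := upi (fun i => - rp a i).
Definition uadd a b : ultraproduct := upi (fun i => rp a i + rp b i).
Definition umul a b : ultraproduct := upi (fun i => rp a i * rp b i).
Definition uinv a : ultraproduct := upi (fun i => (rp a i)^-1).

Lemma uoppE x : uopp (upi x) = upi (fun i => - x i).
Proof. by apply/upiP; apply: filterS (upi_rp x) => i /= ->. Qed.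

Lemma uinvE x : uinv (upi x) = upi (fun i => (x i)^-1).
Proof. by apply/upiP; apply: filterS (upi_rp x) => i /= ->. Qed.

Lemma uaddE x y : uadd (upi x) (upi y) = upi (fun i => x i + y i).
Proof. by apply/upiP; apply: filterS (filterI (upi_rp x) (upi_rp y)) => i [/= -> ->]. Qed.

Lemma umulE x y : umul (upi x) (upi y) = upi (fun i => x i * y i).
Proof. by apply/upiP; apply: filterS (filterI (upi_rp x) (upi_rp y)) => i [/= -> ->]. Qed.

Lemma upi_ext (x y : dfamily) : (forall i, x i = y i) -> upi x = upi y.
Proof. by move=> xy; apply/upiP; apply: filterS filterT => i _; apply: xy. Qed.

Lemma uaddA : associative uadd.
Proof.
move=> a b c; have [x ->] := upi_surj a; have [y ->] := upi_surj b; have [z ->] := upi_surj c.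
by rewrite !uaddE; apply: upi_ext => i; rewrite addrA.
Qed.

Lemma uaddC : commutative uadd.
Proof.
move=> a b; have [x ->] := upi_surj a; have [y ->] := upi_surj b.
by rewrite !uaddE; apply: upi_ext => i; rewrite addrC.
Qed.

Lemma uadd0 : left_id uzero uadd.
Proof.
move=> a; have [x ->] := upi_surj a.
by rewrite uaddE; apply: upi_ext => i; rewrite add0r.
Qed.

Lemma uaddN : left_inverse uzero uopp uadd.
Proof.
move=> a; have [x ->] := upi_surj a.
by rewrite uoppE uaddE; apply: upi_ext => i; rewrite addNr.
Qed.

HB.instance Definition _ := GRing.isZmodule.Build ultraproduct uaddA uaddC uadd0 uaddN.

Lemma umulA : associative umul.
Proof.
move=> a b c; have [x ->] := upi_surj a; have [y ->] := upi_surj b; have [z ->] := upi_surj c.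
by rewrite !umulE; apply: upi_ext => i; rewrite mulrA.
Qed.

Lemma umulC : commutative umul.
Proof.
move=> a b; have [x ->] := upi_surj a; have [y ->] := upi_surj b.
by rewrite !umulE; apply: upi_ext => i; rewrite mulrC.
Qed.

Lemma umul1 : left_id uone umul.
Proof.
move=> a; have [x ->] := upi_surj a.
by rewrite umulE; apply: upi_ext => i; rewrite mul1r.
Qed.

Lemma umulDl : left_distributive umul uadd.
Proof.
move=> a b c; have [x ->] := upi_surj a; have [y ->] := upi_surj b; have [z ->] := upi_surj c.
by rewrite !(uaddE, umulE); apply: upi_ext => i; rewrite mulrDl.
Qed.

Lemma uone_neq0 : uone != uzero.
Proof.
apply/eqP => /upiP h; apply: (@filter_not_empty _ U ultra_proper).
by apply: filterS h => i /eqP; rewrite /= oner_eq0.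
Qed.

HB.instance Definition _ :=
  GRing.Zmodule_isComNzRing.Build ultraproduct umulA umulC umul1 umulDl uone_neq0.

Lemma umulV a : a != 0 -> uinv a * a = 1.
Proof.
have [x ->] := upi_surj a => x0; rewrite uinvE [LHS]umulE.
apply/upiP; case: (in_ultra_setVsetC [set i | x i = 0] UU) => h.
  by case/eqP: x0; apply/upiP.
by apply: filterS h => i /= /eqP; apply: mulVf.
Qed.

Lemma uinv0 : uinv 0 = 0.
Proof. by rewrite [uinv _]uinvE; apply: upi_ext => i; rewrite invr0. Qed.

HB.instance Definition _ := GRing.ComNzRing_isField.Build ultraproduct umulV uinv0.

Lemma upi_sum n (x : 'I_n -> dfamily) : \sum_j upi (x j) = upi (fun i => \sum_j x j i).
Proof.
elim: n x => [|n IH] x; first by rewrite big_ord0; apply: upi_ext => i; rewrite big_ord0.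
by rewrite big_ord_recl IH [LHS]uaddE; apply: upi_ext => i; rewrite big_ord_recl.
Qed.

Lemma upi_exp x n : upi x ^+ n = upi (fun i => x i ^+ n).
Proof.
elim: n => [|n IH]; first by apply: upi_ext => i; rewrite expr0.
by rewrite exprS IH [LHS]umulE; apply: upi_ext => i; rewrite exprS.
Qed.

Lemma ultraproduct_closed (p : {poly ultraproduct}) : (1 < size p)%N -> exists x, root p x.
Proof.
move=> p1; pose n := size p.
have /choice[c cE] : forall j : 'I_n, exists x, p`_j = upi x by move=> j; apply: upi_surj.
have p1' : (n.-1 < n)%N by rewrite prednK // ltnW.
pose q i : {poly F i} := \sum_(j < n) c j i *: 'X^j.
have qE i (j : 'I_n) : (q i)`_j = c j i.
  rewrite coef_sum (bigD1 j) //= coefZ coefXn eqxx mulr1 big1 ?addr0 // => j' jj.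
  by rewrite coefZ coefXn eq_sym -[_ == _]/(j' == j) (negPf jj) mulr0.
(* The default 0 is harmless: the leading coefficient is nonzero for U-almost all i, and there a
   root exists. *)
pose r : dfamily := fun i => xget 0 [set r | root (q i) r].
have rP i : c (Ordinal p1') i <> 0 -> root (q i) (r i).
  move=> c0; apply: (xgetPex 0 (P := [set r | root (q i) r])).
  apply/closed_rootP.
  have lt : (n.-1 < size (q i))%N.
    by rewrite ltnNge; apply/negP => /leq_sizeP/(_ _ (leqnn _)); rewrite (qE i (Ordinal p1')).
  by rewrite neq_ltn; apply/orP; right; apply: leq_trans lt; rewrite -/n in p1; case: (n) p1 => [|[]].
exists (upi r); rewrite /root horner_coef.
rewrite (eq_bigr (fun j => upi (fun i => c j i * r i ^+ j))) => [|j _]; last first.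
  by rewrite cE upi_exp [LHS]umulE.
rewrite upi_sum; apply/eqP/upiP.
case: (in_ultra_setVsetC [set i | c (Ordinal p1') i = 0] UU) => h.
  have : lead_coef p == 0 by apply/eqP; rewrite lead_coefE (cE (Ordinal p1')); apply/upiP.
  by rewrite lead_coef_eq0 => /eqP p0; rewrite p0 size_poly0 in p1.
apply: filterS h => i /= /rP; rewrite /root horner_sum => /eqP e; apply: etrans e.
by apply: eq_bigr => j _; rewrite hornerZ hornerXn.
Qed.
End Ultraproduct.

Lemma algebraically_closed_extension (k : fieldType) : exists (K : fieldType) (iota : {rmorphism k -> K}),
  forall p : {poly K}, (1 < size p)%N -> exists x, root p x.
Proof.
(* An ultrafilter above [G] makes each x in k belong to the subfield generated by almost every s. *)
pose G := [set S : set (seq k) | exists a : seq k, forall s, {subset a <= s} -> S s].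
have Gp : ProperFilter G.
  split; first by move=> [a /(_ a)]; apply.
  split; first by exists [::].
    move=> P Q [a aP] [b bQ]; exists (a ++ b) => s abs.
    by split; [apply: aP|apply: bQ] => x xs; apply: abs; rewrite mem_cat xs ?orbT.
  by move=> P Q PQ [a aP]; exists a => s /aP/PQ.
have [U [UU GU]] := ultraFilterLemma Gp.
have UF : Filter U by case: UU => -[].
pose F (s : seq k) : closedFieldType := projT1 (countable_algebraic_closure (csubfield_countField s)).
pose f s : {rmorphism csubfield s -> F s} :=
  sval (projT2 (countable_algebraic_closure (csubfield_countField s))).
(* The default 0 occurs only for s outside a set of U, so [iota] is still a morphism. *)
pose g s (x : k) : F s := oapp (f s) 0 (insub x).
have inU x : U [set s | exists2 y : csubfield s, val y = x & g s x = f s y].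
  apply: GU; exists [:: x] => s /(_ x); rewrite inE eqxx => /(_ erefl) xs.
  have xR : x \in rational_in s.
    by rewrite inE; exists (GenTree.Leaf (index x s)); rewrite /= nth_index.
  by exists (CSubfield xR); rewrite // /g insubT.
pose iota x := upi UU (fun s => g s x).
have iB : zmod_morphism iota.
  move=> x y; apply/esym; rewrite -[- _]/(uopp _) uoppE [LHS]uaddE; apply/upiP.
  apply: filterS (filterI (inU (x - y)) (filterI (inU x) (inU y))).
  move=> s [[z zE gz] [[a aE ga] [b bE gb]]] /=; rewrite gz ga gb -rmorphB; congr (f s _).
  by apply: val_inj; rewrite zE raddfB /= aE bE.
have iM : monoid_morphism iota.
  split.
    apply/upiP; apply: filterS (inU 1) => s [z zE gz] /=; rewrite gz -(rmorph1 (f s)); congr (f s _).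
    by apply: val_inj; rewrite zE rmorph1.
  move=> x y; apply/esym; rewrite [LHS]umulE; apply/upiP.
  apply: filterS (filterI (inU (x * y)) (filterI (inU x) (inU y))).
  move=> s [[z zE gz] [[a aE ga] [b bE gb]]] /=; rewrite gz ga gb -rmorphM; congr (f s _).
  by apply: val_inj; rewrite zE rmorphM /= aE bE.
pose i : {rmorphism k -> ultraproduct F UU} := HB.pack iota
  (GRing.isZmodMorphism.Build _ _ _ iB) (GRing.isMonoidMorphism.Build _ _ _ iM).
exists (ultraproduct F UU), i; exact: ultraproduct_closed.
Qed.

Theorem theorem1p1 (R : realType) (k : fieldType) (A : algType k) :
  ~ countable [set: k] ->
  finitely_generated A ->
  prime_ring A ->
  goldie A ->
  quadratic_growth A R ->
  primitive_ring A \/ satisfies_pi A.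
Proof.
move=> kunc _ prA [goA _] /quadratic_growth_words[g [v [C [Vall growth]]]].
have [K [iota Kc]] := algebraically_closed_extension k.
apply: contrapT => /not_orP[notPrim notPI].
exact: (main_contradiction iota Kc kunc Vall growth prA goA notPI notPrim).
Qed.
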